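(* Let $d\ge2$ and let $X$ be an affine process on $S_d^+$ with transition function $p_t(x,d\xi)$, whose generator (on rapidly decreasing functions supported on $S_d^+$) is \[ \mathcal Af(x)=2\langle\nabla \alpha\nabla f(x),x\rangle+ \langle \nabla f(x), b+B(x)\rangle- (c+\langle \gamma,x\rangle)f(x)+\int_{S_d^+ \setminus\{0\}} \left(f(x+\xi)-f(x)\right)\big(m(d\xi)+\langle \mu(d\xi), x\rangle\big) \] for an admissible parameter set $(\alpha,b,B,c,\gamma,m,\mu)$, and suppose the diffusion coefficient $\alpha$ is either invertible or zero. Then for all $t\ge0$, $x\in S_d^+$ and $u\in S_d^{++}+iS_d$, \[ \int_{S_d^+}e^{-\langle u,\xi\rangle}p_t(x,d\xi)=e^{-\phi(t,u)-\langle\psi(t,u),x\rangle}, \] where $\phi:\mathbb R_+\times(S_d^{++}+iS_d)\to\mathbb R_++i\mathbb R$ and $\psi:\mathbb R_+\times(S_d^{++}+iS_d)\to S_d^{++}+iS_d$ are the unique global solutions of \begin{align*} \partial_t\phi(t,u)&=\langle b,\psi(t,u)\rangle + c-\int_{S_d^+\setminus\{0\}}\left(e^{-\langle \psi(t,u),\xi\rangle}-1\right)m(d\xi),\\ \partial_t\psi(t,u)&=-2\psi(t,u)\alpha\psi(t,u)+B^\top(\psi(t,u))+\gamma-\int_{S_d^+\setminus\{0\}}\left(e^{-\langle \psi(t,u),\xi\rangle}-1\right)\mu(d\xi), \end{align*} with $\phi(0,u)=0$, $\psi(0,u)=u$.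
   Context: $S_d$: real symmetric $d\times d$ matrices, $\langle x,y\rangle=\operatorname{tr}(xy)$ (extended complex-bilinearly to $S_d+iS_d$), norm $\|\cdot\|$; $S_d^+$ positive semidefinite, $S_d^{++}$ positive definite matrices; $\preceq$ the order induced by $S_d^+$. $B^\top$ is the adjoint of $B$ w.r.t. $\langle\cdot,\cdot\rangle$ (extended complex-linearly). $\nabla$ is the gradient w.r.t. $\langle\cdot,\cdot\rangle$ viewed as a matrix of operators $(\nabla_{ij})$, and $\langle\nabla\alpha\nabla f(x),x\rangle=\sum_{i,j,k,l}x_{li}\alpha_{jk}\nabla_{ij}\nabla_{kl}f(x)$. An affine process on $S_d^+$ is a stochastically continuous time-homogeneous (sub-)Markov process with transition function $p_t(x,d\xi)$ such that $\int e^{-\langle u,\xi\rangle}p_t(x,d\xi)=e^{-\phi(t,u)-\langle\psi(t,u),x\rangle}$ for all $t\ge0$, $u,x\in S_d^+$, for some $\phi:\mathbb R_+\times S_d^+\to\mathbb R_+$, $\psi:\mathbb R_+\times S_d^+\to S_d^+$. An admissible parameter set $(\alpha,b,B,c,\gamma,m,\mu)$: $\alpha\in S_d^+$; $b\in S_d^+$ with $b\succeq(d-1)\alpha$; $c\ge0$; $\gamma\in S_d^+$; a Borel measure $m$ on $S_d^+\setminus\{0\}$ with $\int(\|\xi\|\wedge1)m(d\xi)<\infty$; an $S_d^+$-valued sigma-finite measure $\mu$ on $S_d^+\setminus\{0\}$ (i.e. $\mu(E)\in S_d^+$ for Borel $E$ with closure in $S_d^+\setminus\{0\}$) with $\int(\|\xi\|\wedge1)\mu(d\xi)<\infty$;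 a linear $B:S_d\to S_d$ with $\langle B(x),u\rangle\ge0$ whenever $x,u\in S_d^+$, $\langle x,u\rangle=0$. *)

(* Defs.v *)
From HB Require Import structures.
From mathcomp Require Import all_boot all_order all_algebra.
From mathcomp Require Import all_classical all_reals all_analysis.
From mathcomp Require Import measurable_realfun.

Set Implicit Arguments.
Unset Strict Implicit.
Unset Printing Implicit Defensive.

Import Order.TTheory GRing.Theory Num.Theory.
Import numFieldNormedType.Exports.

Local Open Scope classical_set_scope.
Local Open Scope ring_scope.

Section AffineDefs.
Variables (R : realType) (d : nat).

Local Notation M := 'M[R]_d.

(** Borel sigma-algebra on the space of d x d real matrices (which contains
    S_d and S_d^+ as closed subsets). *)
Definition Mx := g_sigma_algebraType (@open M).

Definition inner (x y : M) : R := \tr (x *m y).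

Definition fnorm (x : M) : R := Num.sqrt (inner x x).

Definition sym (x : M) : Prop := x^T = x.

Definition psd (x : M) : Prop :=
  sym x /\ forall v : 'cV[R]_d, 0 <= (v^T *m x *m v) ord0 ord0.

Definition pd (x : M) : Prop :=
  sym x /\ forall v : 'cV[R]_d, v != 0 -> 0 < (v^T *m x *m v) ord0 ord0.

Definition psdset : set Mx := [set x | psd x].
Definition psdset0 : set Mx := [set x | psd x /\ x <> 0].

(** (E_ij + E_ji)/2 : for a symmetric G, <G, Sij i j> = G i j *)
Definition Sij (i j : 'I_d) : M := 2^-1 *: (delta_mx i j + delta_mx j i).

(** gradient w.r.t. <.,.> on S_d (a symmetric matrix):
    (grad f x)_{ij} = <grad f x, Sij i j> = D f(x)[Sij i j]. *)
Definition grad (f : M -> R) (x : M) : M :=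
  \matrix_(i, j) 'D_(Sij i j) f x.

Definition adjoint (B : M -> M) (y : M) : M :=
  \matrix_(i, j) inner y (B (Sij i j)).

Fixpoint Dn (vs : seq M) (f : M -> R) : M -> R :=
  match vs with
  | [::] => f
  | v :: vs' => 'D_v (Dn vs' f)
  end.

Definition smooth_sym (f : M -> R) : Prop :=
  forall (vs : seq M) (v : M), (forall w, w \in vs -> sym w) -> sym v ->
    continuous (Dn vs f) /\ forall x, derivable (Dn vs f) x v.

(** rapidly decreasing C^infty function on S_d^+ (given through a smooth
    function on S_d whose restriction to S_d^+ is the function) *)
Definition rapidly_decreasing (f : M -> R) : Prop :=
  smooth_sym f /\
  forall (k : nat) (vs : seq M), (forall w, w \in vs -> sym w) ->
    exists C : R, forall x, psd x -> (1 + fnorm x) ^+ k * `|Dn vs f x| <= C.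

(** real and imaginary parts of exp(-(a + i b)) *)
Definition cexp_re (a b : R) : R := expR (- a) * cos b.
Definition cexp_im (a b : R) : R := - (expR (- a) * sin b).

(** Admissible parameter set (alpha, b, B, c, gamma, m, mu), where the
    S_d^+-valued measure mu is given by a density: mu(dxi) = H(xi) nu(dxi). *)
Definition admissible (alpha b : M) (B : M -> M) (c : R) (gamma : M)
    (m nu : {measure set Mx -> \bar R}) (H : M -> M) : Prop :=
  [/\ psd alpha, psd b, psd (b - (d.-1)%:R *: alpha), 0 <= c & psd gamma]
  /\ [/\ m (~` psdset0) = 0%E &
        (\int[m]_(xi in psdset0) (Num.min (fnorm xi) 1)%:E < +oo)%E]
  /\ [/\ nu (~` psdset0) = 0%E,
        (forall i j, measurable_fun psdset0 (fun xi : Mx => H xi i j)),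
        (forall xi : Mx, psdset0 xi -> psd (H xi)) &
        (\int[nu]_(xi in psdset0) (Num.min (fnorm xi) 1 * \tr (H xi))%:E < +oo)%E]
  /\ [/\ (forall (a : R) (x y : M), sym x -> sym y -> B (a *: x + y) = a *: B x + B y),
        (forall x, sym x -> sym (B x)) &
        (forall x u, psd x -> psd u -> inner x u = 0 -> 0 <= inner (B x) u)].

Definition mu_integral (nu : {measure set Mx -> \bar R}) (H : M -> M)
    (g : M -> R) : M :=
  \matrix_(i, j) \int[nu]_(xi in psdset0) (g xi * H xi i j).

Definition generator (alpha b : M) (B : M -> M) (c : R) (gamma : M)
    (m nu : {measure set Mx -> \bar R}) (H : M -> M) (f : M -> R) (x : M) : R :=
  2 * (\sum_(i < d) \sum_(j < d) \sum_(k < d) \sum_(l < d)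
         x l i * alpha j k * grad (fun y => grad f y k l) x i j)
  + inner (grad f x) (b + B x)
  - (c + inner gamma x) * f x
  + \int[m]_(xi in psdset0) (f (x + xi) - f x)
  + \int[nu]_(xi in psdset0) ((f (x + xi) - f x) * inner (H xi) x).

Definition affine_transition (p : R -> M -> {measure set Mx -> \bar R}) : Prop :=
  [/\ (forall t (x : M), 0 <= t -> psd x ->
          p t x (~` psdset) = 0%E /\ (p t x setT <= 1)%E),
      (forall t (A : set Mx), 0 <= t -> measurable A ->
          measurable_fun psdset (fun x : Mx => p t x A)),
      (forall (x : M) (A : set Mx), psd x -> measurable A ->
          p 0 x A = (\1_A x)%:E),
      (forall s t (x : M) (A : set Mx), 0 <= s -> 0 <= t -> psd x -> measurable A ->
          p (s + t) x A = (\int[p s x]_(y in psdset) p t y A)%E) &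
      (forall (x : M) (f : M -> R), psd x -> continuous f ->
          (exists C, forall y, `|f y| <= C) ->
          {within [set t : R | 0 <= t],
             continuous (fun t => \int[p t x]_(xi in psdset) f xi)})]
  /\ exists (phi0 : R -> M -> R) (psi0 : R -> M -> M),
      forall t (u x : M), 0 <= t -> psd u -> psd x ->
        [/\ 0 <= phi0 t u, psd (psi0 t u) &
            \int[p t x]_(xi in psdset) expR (- inner u xi)
              = expR (- phi0 t u - inner (psi0 t u) x)].

Definition has_generator (p : R -> M -> {measure set Mx -> \bar R})
    (alpha b : M) (B : M -> M) (c : R) (gamma : M)
    (m nu : {measure set Mx -> \bar R}) (H : M -> M) : Prop :=
  forall (f : M -> R) (x : M), rapidly_decreasing f -> psd x ->
    (fun t => (\int[p t x]_(xi in psdset) f xi - f x) / t) @ 0^'+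
      --> generator alpha b B c gamma m nu H f x.

(** (ph1 + i ph2, ps1 + i ps2) is a global solution on R_+ of the generalized
    Riccati equations with initial value (0, u1 + i u2), with
    phi valued in R_+ + iR and psi valued in S_d^{++} + iS_d. *)
Definition riccati_solution (alpha b : M) (B : M -> M) (c : R) (gamma : M)
    (m nu : {measure set Mx -> \bar R}) (H : M -> M) (u1 u2 : M)
    (ph1 ph2 : R -> R) (ps1 ps2 : R -> M) : Prop :=
  [/\ ph1 0 = 0, ph2 0 = 0, ps1 0 = u1 & ps2 0 = u2]
  /\ (forall t : R, 0 <= t -> [/\ 0 <= ph1 t, pd (ps1 t) & sym (ps2 t)])
  /\ [/\ {within [set t : R | 0 <= t], continuous ph1},
        {within [set t : R | 0 <= t], continuous ph2},
        {within [set t : R | 0 <= t], continuous ps1} &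
        {within [set t : R | 0 <= t], continuous ps2}]
  /\ forall t : R, 0 < t ->
     [/\ is_derive t 1 ph1
           (inner b (ps1 t) + c
            - \int[m]_(xi in psdset0)
                 (cexp_re (inner (ps1 t) xi) (inner (ps2 t) xi) - 1)),
         is_derive t 1 ph2
           (inner b (ps2 t)
            - \int[m]_(xi in psdset0) cexp_im (inner (ps1 t) xi) (inner (ps2 t) xi)),
         is_derive t 1 ps1
           ((-2) *: (ps1 t *m alpha *m ps1 t - ps2 t *m alpha *m ps2 t)
            + adjoint B (ps1 t) + gamma
            - mu_integral nu H
                (fun xi => cexp_re (inner (ps1 t) xi) (inner (ps2 t) xi) - 1)) &
         is_derive t 1 ps2
           ((-2) *: (ps1 t *m alpha *m ps2 t + ps2 t *m alpha *m ps1 t)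
            + adjoint B (ps2 t)
            - mu_integral nu H
                (fun xi => cexp_im (inner (ps1 t) xi) (inner (ps2 t) xi)))].

End AffineDefs.

(* Main.v *)
(** The Riccati equations are solved by Picard iteration after a radial
    truncation of the quadratic part.  The real part of [psi] cannot leave the
    open cone because the vector field is quasi-monotone and the extra terms
    produced by the imaginary part only push inwards; when [alpha] is invertible
    the energy [tr (A alpha A alpha) + tr (C alpha C alpha)] of the solution
    [A + i C] stays bounded, so the truncation is inactive and the solution is
    global (for [alpha = 0] the field has linear growth).

    For the transform formula, real and imaginary parts of
    [exp (- (a + i th) - <A + i C, x>)] are rapidly decreasing, and the generator
    maps them to the right-hand sides of the Riccati equations.  Let [g_t] be
    such a function with exponents following the Riccati solution; then
    [s |-> P_s g_(T-s) x] is continuous with zero right derivative, hence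
    constant, and its values at [0] and [T] are the two sides of the formula.
    The right derivative of [P_s g] is [P_s] of the generator by dominated
    convergence: the quotients [(P_h g - g) / h] are bounded uniformly on the
    cone.  For [g = exp (- <A, x>)] this follows from the real affine formula,
    as the exponents are affine in [x] and are controlled at finitely many
    points; the oscillating factor reduces to this case since
    [cos (b + z)] is, up to a multiple of [cosh (e z) - 1], a combination of
    [exp (e z)] and [exp (- e z)]. *)
Require Import Defs.
From HB Require Import structures.
From mathcomp Require Import all_boot all_order all_algebra.
From mathcomp Require Import all_classical all_reals all_analysis.
From mathcomp Require Import measurable_realfun.
From mathcomp Require Import ring lra.

Import Order.TTheory GRing.Theory Num.Theory.
Import numFieldNormedType.Exports.

Set Implicit Arguments.
Unset Strict Implicit.
Unset Printing Implicit Defensive.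

Local Open Scope classical_set_scope.
Local Open Scope ring_scope.

(** * The cone of positive semidefinite matrices: trace pairing, coercivity, norms *)

Section PositiveSemidefinite.
Variables (R : realType) (d : nat).
Implicit Types (x y A : 'M[R]_d) (v w : 'cV[R]_d).

(** The quadratic term is not the only obstacle to Picard iteration. Only [min (fnorm xi) 1] is
    integrable for the jump measures, so the integrals of [exp (- <psi, xi>) - 1] are in general
    Lipschitz in [psi] only while its real part keeps a margin from the boundary of the cone. Hence
    a second truncation: [<A, xi>] is replaced by its maximum with [e * fnorm xi]. Both truncations
    are removed by a priori bounds that do not depend on them, a decaying positive lower barrier for
    the real part and the energy bound, so [e] and [rho] can be fixed once the time horizon is
    known. The energy is chosen for its sign: by cyclicity of the trace, the cubic terms in its
    derivative are minus pairings of positive semidefinite matrices, for every [C].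

    In the second half the obstacle is uniformity. The generator is given only as a pointwise limit,
    while the argument needs quotients bounded on the whole unbounded cone. The margin of the real
    part pays for this: the exponential decay it gives absorbs all polynomial growth in [\tr x].
    Complex numbers never appear; a phase [th] is carried, and a shift by [pi / 2] yields imaginary
    parts. *)

Definition qf x v : R := (v^T *m x *m v) ord0 ord0.

Lemma innerE x y : inner x y = \sum_i \sum_j x i j * y j i.
Proof. by rewrite /inner /mxtrace; apply: eq_bigr => i _; rewrite mxE. Qed.

Lemma innerC x y : inner x y = inner y x.
Proof. by rewrite /inner mxtrace_mulC. Qed.

Lemma innerDl x y z : inner (x + y) z = inner x z + inner y z.
Proof. by rewrite /inner mulmxDl mxtraceD. Qed.

Lemma innerDr x y z : inner z (x + y) = inner z x + inner z y.
Proof. by rewrite innerC innerDl !(innerC z). Qed.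

Lemma innerZl a x y : inner (a *: x) y = a * inner x y.
Proof. by rewrite /inner -scalemxAl mxtraceZ. Qed.

Lemma innerZr a x y : inner x (a *: y) = a * inner x y.
Proof. by rewrite innerC innerZl innerC. Qed.

Lemma innerNl x y : inner (- x) y = - inner x y.
Proof. by rewrite -scaleN1r innerZl mulN1r. Qed.

Lemma innerNr x y : inner x (- y) = - inner x y.
Proof. by rewrite innerC innerNl innerC. Qed.

Lemma innerBl x y z : inner (x - y) z = inner x z - inner y z.
Proof. by rewrite innerDl innerNl. Qed.

Lemma innerBr x y z : inner z (x - y) = inner z x - inner z y.
Proof. by rewrite innerDr innerNr. Qed.

Lemma inner0r x : inner x 0 = 0.
Proof. by rewrite /inner mulmx0 mxtrace0. Qed.

Lemma inner0l x : inner 0 x = 0.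
Proof. by rewrite innerC inner0r. Qed.

Lemma inner_scalar l x : inner l%:M x = l * \tr x.
Proof. by rewrite /inner mul_scalar_mx mxtraceZ. Qed.

(** Rank-one matrices turn the quadratic form into a pairing, so that linearity, derivatives and
    trace bounds for [qf] are inherited from [inner]. *)
Lemma inner_col x v : inner x (v *m v^T) = qf x v.
Proof.
rewrite /inner /qf mulmxA mxtrace_mulC mulmxA /mxtrace big_ord1.
by congr (fun_of_matrix _ _ _); apply: val_inj.
Qed.

Lemma qfD x y v : qf (x + y) v = qf x v + qf y v.
Proof. by rewrite -!inner_col innerDl. Qed.

Lemma qfZ a x v : qf (a *: x) v = a * qf x v.
Proof. by rewrite -!inner_col innerZl. Qed.

Lemma qfB x y v : qf (x - y) v = qf x v - qf y v.
Proof. by rewrite -!inner_col innerBl. Qed.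

Lemma qfE x v : qf x v = \sum_i \sum_j v i ord0 * x i j * v j ord0.
Proof.
rewrite /qf mxE exchange_big /=; apply: eq_bigr => j _.
by rewrite mxE big_distrl /=; apply: eq_bigr => i _; rewrite !mxE.
Qed.

Lemma tr_colmul v : \tr (v *m v^T) = \sum_i v i ord0 ^+ 2.
Proof.
by rewrite /mxtrace; apply: eq_bigr => i _; rewrite mxE big_ord1 mxE expr2.
Qed.

Lemma qf_scalar l v : qf l%:M v = l * \sum_i v i ord0 ^+ 2.
Proof. by rewrite -inner_col inner_scalar tr_colmul. Qed.

Lemma sqnorm_gt0 v : v != 0 -> 0 < \sum_i v i ord0 ^+ 2.
Proof.
move=> v0; rewrite lt_def sumr_ge0 ?andbT => [|i _]; last exact: sqr_ge0.
apply: contra v0 => /eqP s0; apply/eqP/matrixP => i j; rewrite mxE ord1.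
have := psumr_eq0P (fun i _ => sqr_ge0 (v i ord0)) s0.
by move=> /(_ i isT)/eqP; rewrite sqrf_eq0 => /eqP.
Qed.

Lemma symD x y : sym x -> sym y -> sym (x + y).
Proof. by rewrite /sym => sx sy; rewrite linearD /= sx sy. Qed.

Lemma symN x : sym x -> sym (- x).
Proof. by rewrite /sym => sx; rewrite linearN /= sx. Qed.

Lemma symB x y : sym x -> sym y -> sym (x - y).
Proof. by move=> sx sy; apply: symD => //; exact: symN. Qed.

Lemma symZ a x : sym x -> sym (a *: x).
Proof. by rewrite /sym => sx; rewrite linearZ /= sx. Qed.

Lemma sym_scalar l : sym (l%:M : 'M[R]_d).
Proof. exact: tr_scalar_mx. Qed.

Lemma sym0 : sym (0 : 'M[R]_d).
Proof. exact: trmx0. Qed.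

Lemma symE x i j : sym x -> x i j = x j i.
Proof. by move=> sx; rewrite -{1}sx mxE. Qed.

Lemma sym_colmul v : sym (v *m v^T).
Proof. by rewrite /sym trmx_mul trmxK. Qed.

Lemma sym_Sij (i j : 'I_d) : sym (Sij R i j).
Proof. by apply: symZ; rewrite /sym linearD /= !trmx_delta addrC. Qed.

Lemma psdI x : sym x -> (forall v, 0 <= qf x v) -> psd x.
Proof. by []. Qed.

Lemma psd_qf x v : psd x -> 0 <= qf x v.
Proof. by move=> -[_]; exact. Qed.

Lemma pd_qf x v : pd x -> v != 0 -> 0 < qf x v.
Proof. by move=> -[_]; exact. Qed.

Lemma psdD x y : psd x -> psd y -> psd (x + y).
Proof.
move=> px py; apply: psdI; first exact: symD px.1 py.1.
by move=> v; rewrite qfD addr_ge0 ?psd_qf.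
Qed.

Lemma psd0 : psd (0 : 'M[R]_d).
Proof. by split; [exact: sym0|move=> v; rewrite mulmx0 mul0mx mxE]. Qed.

Lemma psd_scalar l : 0 <= l -> psd (l%:M : 'M[R]_d).
Proof.
move=> l0; apply: psdI; first exact: sym_scalar.
move=> v; rewrite qf_scalar mulr_ge0// sumr_ge0// => i _.
exact: sqr_ge0.
Qed.

Lemma qf_colmul w v : qf (w *m w^T) v = ((w^T *m v) ord0 ord0) ^+ 2.
Proof.
rewrite /qf mulmxA -mulmxA mxE big_ord1 expr2.
by congr (_ * _); rewrite -[in LHS](trmxK w) -trmx_mul mxE.
Qed.

Lemma psd_colmul v : psd (v *m v^T).
Proof.
by apply: psdI => [|w]; [exact: sym_colmul|rewrite qf_colmul sqr_ge0].
Qed.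

Lemma qf_delta x i : qf x (delta_mx i ord0) = x i i.
Proof.
by rewrite /qf trmx_delta -mulmxA -colE -rowE !mxE.
Qed.

Lemma sym_entry_tr x v i : sym x ->
  (x *m v) i ord0 = (v^T *m x *m delta_mx i (ord0 : 'I_1)) ord0 ord0.
Proof.
by move=> sx; rewrite -colE [RHS]mxE -[in LHS]sx -[in LHS](trmxK v) -trmx_mul mxE.
Qed.

Lemma qf_shift x v i s : sym x ->
  qf x (v + s *: delta_mx i ord0)
    = qf x v + 2 * s * (x *m v) i ord0 + s ^+ 2 * x i i.
Proof.
move=> sx; rewrite -(qf_delta x i) /qf.
set e : 'cV[R]_d := delta_mx i ord0.
have -> : (x *m v) i ord0 = (v^T *m x *m e) ord0 ord0 by exact: sym_entry_tr.
have h : (e^T *m x *m v) ord0 ord0 = (v^T *m x *m e) ord0 ord0.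
  have <- : (v^T *m x *m e)^T = e^T *m x *m v.
    by rewrite !trmx_mul trmxK sx mulmxA.
  by rewrite [LHS]mxE.
have -> : (v + s *: e)^T = v^T + s *: e^T by apply/matrixP => a b; rewrite !mxE.
rewrite !mulmxDl !mulmxDr -!scalemxAl -!scalemxAr.
have D (a b : 'M[R]_1) : (a + b) ord0 ord0 = a ord0 ord0 + b ord0 ord0.
  by rewrite mxE.
have Z t (a : 'M[R]_1) : (t *: a) ord0 ord0 = t * a ord0 ord0 by rewrite mxE.
by rewrite !D !Z h; ring.
Qed.

Lemma psd_diag_ge0 x i : psd x -> 0 <= x i i.
Proof. by move=> [_ px]; rewrite -qf_delta; exact: px. Qed.

(** A nonnegative quadratic polynomial is evaluated at its vertex [- a / c]. When [c = 0] it is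
    affine, and the chosen point, where it would equal -1, is a contradiction unless [a = 0]. *)
Lemma quadratic_ge0_discr (a b c : R) :
  (forall s, 0 <= b + 2 * s * a + s ^+ 2 * c) -> 0 <= c -> a ^+ 2 <= c * b.
Proof.
move=> h; rewrite le_eqVlt => /predU1P[c0|c0].
  rewrite -c0 mul0r; have [->|a0] := eqVneq a 0; first by rewrite expr0n.
  have := h (- (b + 1) / (2 * a)); rewrite -c0 mulr0 addr0.
  have -> : b + 2 * (- (b + 1) / (2 * a)) * a = -1 by field; rewrite a0.
  by rewrite oppr_ge0 ler10.
have := h (- a / c).
have -> : b + 2 * (- a / c) * a + (- a / c) ^+ 2 * c = b - a ^+ 2 / c.
  by field; rewrite gt_eqF.
by rewrite subr_ge0 ler_pdivrMr// mulrC.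
Qed.

(** The form is nonnegative along the line through [v] in the direction of the [i]-th basis vector,
    so its discriminant is nonpositive. This version of Cauchy-Schwarz stands in for spectral theory
    below. *)
Lemma psd_CS x v i : psd x -> ((x *m v) i ord0) ^+ 2 <= x i i * qf x v.
Proof.
move=> px; apply: quadratic_ge0_discr; last exact: psd_diag_ge0.
by move=> s; rewrite -qf_shift ?psd_qf//; exact: px.1.
Qed.

Lemma psd_row0 x i j : psd x -> x i i = 0 -> x i j = 0.
Proof.
move=> px xi; have := psd_CS (delta_mx j ord0) i px.
rewrite xi mul0r -colE mxE => h; apply/eqP.
by rewrite -sqrf_eq0 eq_le h sqr_ge0.
Qed.

(* Symmetric Gaussian elimination, one row at a time. *)
Lemma psd_decomp x : psd x ->
  exists s : seq 'cV[R]_d, x = \sum_(v <- s) v *m v^T.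
Proof.
(* Induction on the number [k] of trailing rows that may be nonzero; the pivot is row [d - k.+1],
   the first of them. A zero pivot forces a zero row by [psd_row0]. *)
suff H (k : nat) : forall x, psd x ->
    (forall i j : 'I_d, (i < d - k)%N -> x i j = 0) ->
    exists s : seq 'cV[R]_d, x = \sum_(v <- s) v *m v^T.
  by move=> px; apply: (H d) => // i j; rewrite subnn.
elim: k => [|k IH] {}x px x0.
  exists [::]; rewrite big_nil; apply/matrixP => i j; rewrite mxE x0//.
  by rewrite subn0.
have [dk|kd] := leqP d k.
  apply: IH => // i j; rewrite (_ : d - k = 0)%N//.
  by apply/eqP; rewrite subn_eq0.
have iP : (d - k.+1 < d)%N.
  by rewrite ltn_subrL (leq_ltn_trans (leq0n k) kd).
pose i := Ordinal iP; have ival : (i : nat) = (d - k.+1)%N by [].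
move: i ival => i ival.
have dk : (d - k = (i : nat).+1)%N by rewrite ival subnSK.
have [xi0|xi0] := eqVneq (x i i) 0.
  apply: IH => // i' j; rewrite dk ltnS leq_eqVlt => /orP[/eqP e|ai]; last by rewrite x0// -ival.
  have -> : i' = i by exact/val_inj.
  exact: psd_row0.
have xi : 0 < x i i by rewrite lt_def xi0 psd_diag_ge0.
(* The scaling makes [w w^T] agree with [x] on the pivot row, so the difference is the Schur
   complement; [psd_CS] is exactly its positivity. *)
pose w : 'cV[R]_d := (Num.sqrt (x i i))^-1 *: col i x.
have wE a b : (w *m w^T) a b = x a i * x b i / x i i.
  rewrite mxE big_ord1 !mxE mulrACA -invfM -expr2 sqr_sqrtr ?ltW//.
  by rewrite mulrC.
have [|a b|s sE] := IH (x - w *m w^T).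
- apply: psdI; first by apply: symB; [exact: px.1|exact: sym_colmul].
  move=> v; rewrite qfB qf_colmul subr_ge0.
  have -> : ((w^T *m v) ord0 ord0) ^+ 2 = ((x *m v) i ord0) ^+ 2 / x i i.
    rewrite (_ : (w^T *m v) ord0 ord0 = (Num.sqrt (x i i))^-1 * (x *m v) i ord0).
      by rewrite exprMn exprVn sqr_sqrtr ?ltW// mulrC.
    rewrite linearZ /= -scalemxAl mxE; congr (_ * _).
    rewrite !mxE; apply: eq_bigr => j _; rewrite !mxE (symE _ _ px.1)//.
  by rewrite ler_pdivrMr// mulrC psd_CS.
- rewrite dk ltnS leq_eqVlt => /orP[/eqP e|ai].
    have -> : a = i by exact/val_inj.
    by rewrite mxE [X in _ + X]mxE wE mulrAC divff// mul1r (symE _ _ px.1) subrr.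
  have xa c : x a c = 0 by rewrite x0// -ival.
    by rewrite mxE [X in _ + X]mxE wE !xa !mul0r subrr.
- by exists (w :: s); rewrite big_cons -sE addrC subrK.
Qed.

(** Half of the self-duality of the cone: decompose [y] into rank-one terms, each of which pairs
    with [x] to a value of its quadratic form. *)
Lemma inner_psd_ge0 x y : psd x -> psd y -> 0 <= inner x y.
Proof.
move=> [_ px] /psd_decomp[s ->].
rewrite /inner mulmx_sumr linear_sum /=; apply: sumr_ge0 => v _.
by rewrite -/(inner _ _) inner_col; exact: px.
Qed.

Lemma psd_tr_ge0 x : psd x -> 0 <= \tr x.
Proof. by move=> px; apply: sumr_ge0 => i _; exact: psd_diag_ge0. Qed.

Lemma psd_diag_le_tr x i : psd x -> x i i <= \tr x.
Proof.
move=> px; rewrite /mxtrace (bigD1 i)//= lerDl; apply: sumr_ge0 => j _.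
exact: psd_diag_ge0.
Qed.

Lemma psd_entry_le_tr x i j : psd x -> `|x i j| <= \tr x.
Proof.
move=> px; rewrite -(@ler_pXn2r _ 2) ?nnegrE ?psd_tr_ge0// real_normK ?num_real//.
have := psd_CS (delta_mx j ord0) i px; rewrite -colE mxE qf_delta => /le_trans.
apply; rewrite expr2; apply: ler_pM; rewrite ?psd_diag_ge0 ?psd_diag_le_tr//.
Qed.

Lemma pd_psd A : pd A -> psd A.
Proof.
move=> [sA pA]; split=> // v; have [->|v0] := eqVneq v 0.
  by rewrite mulmx0 mxE.
exact/ltW/pA.
Qed.

(** Eigenvalues are avoided: [psd_CS] bounds the entries of [A v] by the square root of
    [\tr A * qf A v], and applying [invmx A] turns this into a bound on the entries of [v]. *)
Lemma psd_unit_coercive A : psd A -> A \in unitmx ->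
  exists2 l, 0 < l & psd (A - l%:M).
Proof.
move=> pA uA.
pose t := \tr A; pose K := \sum_i \sum_j `|invmx A i j|.
have t0 : 0 <= t by exact: psd_tr_ge0.
have K0 : 0 <= K by apply: sumr_ge0 => i _; apply: sumr_ge0.
have bnd v i : (v i ord0) ^+ 2 <= K ^+ 2 * (t * qf A v).
  have q0 : 0 <= qf A v by exact: psd_qf.
  have tq : 0 <= t * qf A v by rewrite mulr_ge0.
  have Av j : `|(A *m v) j ord0| <= Num.sqrt (t * qf A v).
    rewrite -sqrtr_sqr ler_sqrt//; apply: le_trans (psd_CS _ _ pA) _.
    by apply: ler_wpM2r => //; exact: psd_diag_le_tr.
  rewrite -[X in _ * X]sqr_sqrtr// -exprMn -[leLHS]real_normK ?num_real//.
  rewrite ler_pXn2r ?nnegrE ?mulr_ge0 ?sqrtr_ge0//.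
  rewrite -{1}(mulKmx uA v) mxE; apply: le_trans (ler_norm_sum _ _ _) _.
  have Ki : \sum_j `|invmx A i j| <= K.
    by rewrite /K [leRHS](bigD1 i)//= lerDl; apply: sumr_ge0 => k _; apply: sumr_ge0.
  apply: le_trans (ler_wpM2r (sqrtr_ge0 _) Ki).
  rewrite mulr_suml; apply: ler_sum => j _; rewrite normrM.
  by apply: ler_wpM2l.
(* Summing the [d] entry bounds gives the first term; the [+ 1] keeps [C] invertible when that term
   vanishes. *)
pose C := d%:R * K ^+ 2 * t + 1.
have C0 : 0 < C by rewrite ltr_wpDl// !mulr_ge0// sqr_ge0.
exists C^-1; first by rewrite invr_gt0.
apply: psdI; first by apply: symB; [exact: pA.1|exact: sym_scalar].
move=> v; rewrite qfB qf_scalar subr_ge0 ler_pdivrMl//.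
have q0 : 0 <= qf A v by exact: psd_qf.
apply: (@le_trans _ _ (\sum_(i < d) K ^+ 2 * (t * qf A v))).
  by apply: ler_sum.
rewrite sumr_const card_ord -mulr_natl /C mulrDl mul1r !mulrA lerDl//.
Qed.

Lemma pd_unit A : pd A -> A \in unitmx.
Proof.
move=> [sA pA]; rewrite -row_free_unit -kermx_eq0.
apply/eqP/row_matrixP => i; rewrite row0; apply/eqP; apply: contraT => r0.
have rA : row i (kermx A) *m A = 0 by apply/sub_kermxP; exact: row_sub.
have := pA (row i (kermx A))^T; rewrite trmxK rA mul0mx mxE ltxx.
apply; apply: contra r0 => /eqP/(congr1 trmx); rewrite trmxK trmx0 => ->.
by [].
Qed.

(** Later estimates use positive definiteness through the margin [l]: it yields exponential decay in
    the trace on the cone and survives small perturbations of [A]. *)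
Lemma pdP A : pd A <-> exists2 l, 0 < l & psd (A - l%:M).
Proof.
split=> [pA|[l l0 [sA pA]]].
  by apply: psd_unit_coercive; [exact: pd_psd|exact: pd_unit].
split; first by rewrite -(subrK l%:M A); apply: symD => //; exact: sym_scalar.
move=> v v0; have := pA v; rewrite -[X in 0 <= X]/(qf (A - l%:M) v) qfB subr_ge0.
rewrite -[X in 0 < X]/(qf A v); apply: lt_le_trans; rewrite qf_scalar mulr_gt0// sqnorm_gt0//.
Qed.

Lemma inner_coercive A l x : psd (A - l%:M) -> psd x -> l * \tr x <= inner A x.
Proof.
by move=> pA px; rewrite -subr_ge0 -inner_scalar -innerBl inner_psd_ge0.
Qed.

Lemma psd_det_pd A : psd A -> \det A != 0 -> pd A.
Proof.
by move=> pA dA; apply/pdP/psd_unit_coercive => //; rewrite unitmxE unitfE.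
Qed.

Lemma fnorm_sym x : sym x -> fnorm x = Num.sqrt (\sum_i \sum_j x i j ^+ 2).
Proof.
move=> sx; rewrite /fnorm innerE; congr Num.sqrt.
apply: eq_bigr => i _; apply: eq_bigr => j _; by rewrite (symE j i sx) expr2.
Qed.

Lemma fnorm_ge0 x : 0 <= fnorm x. Proof. exact: sqrtr_ge0. Qed.

Lemma entry_le_fnorm x i j : sym x -> `|x i j| <= fnorm x.
Proof.
move=> sx; rewrite fnorm_sym// -sqrtr_sqr ler_wsqrtr//.
rewrite (bigD1 i)//= (bigD1 j)//= -addrA lerDl addr_ge0// sumr_ge0// => k _.
  exact: sqr_ge0.
by apply: sumr_ge0 => l _; exact: sqr_ge0.
Qed.

(** The inequality [x_ij ^ 2 <= x_ii * x_jj], from [psd_CS] at a basis vector, sums to the square of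
    the trace. *)
Lemma fnorm_le_tr x : psd x -> fnorm x <= \tr x.
Proof.
move=> px; rewrite /fnorm -[leRHS]ger0_norm ?psd_tr_ge0// -sqrtr_sqr.
apply: ler_wsqrtr; rewrite innerE expr2.
rewrite {1}/mxtrace big_distrl /=; apply: ler_sum => i _.
rewrite {1}/mxtrace big_distrr /=; apply: ler_sum => j _.
have := psd_CS (delta_mx j ord0) i px; rewrite -colE mxE qf_delta.
by rewrite (symE j i px.1) -expr2.
Qed.

(** The entrywise l1 norm. It is submultiplicative and controls pairings without symmetry
    assumptions, so exponents are measured with it; [fnorm] is kept where the definitions prescribe
    it. *)
Definition mxsum x : R := \sum_i \sum_j `|x i j|.

Lemma mxsum_ge0 x : 0 <= mxsum x.
Proof. by apply: sumr_ge0 => i _; apply: sumr_ge0. Qed.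

Lemma inner_le_fnorm x y : sym y -> `|inner x y| <= mxsum x * fnorm y.
Proof.
move=> sy; rewrite innerE (le_trans (ler_norm_sum _ _ _))// /mxsum big_distrl /=.
apply: ler_sum => i _; rewrite (le_trans (ler_norm_sum _ _ _))// big_distrl /=.
by apply: ler_sum => j _; rewrite normrM ler_wpM2l// entry_le_fnorm.
Qed.

Lemma inner_le_tr x y : psd y -> `|inner x y| <= mxsum x * \tr y.
Proof.
move=> py; apply: le_trans (inner_le_fnorm _ py.1) _.
by rewrite ler_wpM2l ?mxsum_ge0 ?fnorm_le_tr.
Qed.

Lemma mxsumD x y : mxsum (x + y) <= mxsum x + mxsum y.
Proof.
rewrite /mxsum -big_split; apply: ler_sum => i _ /=; rewrite -big_split.
by apply: ler_sum => j _ /=; rewrite mxE ler_normD.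
Qed.

Lemma mxsumZ a x : mxsum (a *: x) = `|a| * mxsum x.
Proof.
rewrite /mxsum big_distrr; apply: eq_bigr => i _ /=; rewrite big_distrr.
by apply: eq_bigr => j _ /=; rewrite mxE normrM.
Qed.

Lemma mxsumN x : mxsum (- x) = mxsum x.
Proof. by rewrite -scaleN1r mxsumZ normrN1 mul1r. Qed.

Lemma entry_le_mxsum x i j : `|x i j| <= mxsum x.
Proof.
rewrite /mxsum (bigD1 i)//= (bigD1 j)//= -addrA lerDl addr_ge0// sumr_ge0//.
by move=> k _; apply: sumr_ge0.
Qed.

End PositiveSemidefinite.

(** * Continuity of real-valued functions *)

Section RealContinuity.
Variables (R : realType) (T : topologicalType).
Implicit Types (f g : T -> R) (c : R).

Lemma contD f g : continuous f -> continuous g -> continuous (fun t => f t + g t).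
Proof. by move=> cf cg x; apply: cvgD; [exact: cf|exact: cg]. Qed.

Lemma contN f : continuous f -> continuous (fun t => - f t).
Proof. by move=> cf x; apply: cvgN; exact: cf. Qed.

Lemma contB f g : continuous f -> continuous g -> continuous (fun t => f t - g t).
Proof. by move=> cf cg x; apply: cvgB; [exact: cf|exact: cg]. Qed.

Lemma contM f g : continuous f -> continuous g -> continuous (fun t => f t * g t).
Proof. by move=> cf cg x; apply: cvgM; [exact: cf|exact: cg]. Qed.

Lemma cont_cst c : continuous (fun _ : T => c).
Proof. by move=> x; exact: cvg_cst. Qed.

Lemma cont_sum (I : Type) (r : seq I) (F : I -> T -> R) :
  (forall i, continuous (F i)) -> continuous (fun s => \sum_(i <- r) F i s).
Proof.
move=> h; elim: r => [|i r IH].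
  rewrite (_ : (fun _ => _) = fun _ => 0); first exact: cont_cst.
  by apply/funext => s; rewrite big_nil.
rewrite (_ : (fun _ => _) = fun s => F i s + \sum_(i <- r) F i s).
  exact: contD.
by apply/funext => s; rewrite big_cons.
Qed.

Lemma cont_comp (f : R -> R) g : continuous f -> continuous g -> continuous (fun t => f (g t)).
Proof. by move=> cf cg x; apply: continuous_comp; [exact: cg|exact: cf]. Qed.

Lemma cont_expR f : continuous f -> continuous (fun t => expR (f t)).
Proof. exact: cont_comp (@continuous_expR R). Qed.

Lemma cont_cos f : continuous f -> continuous (fun t => cos (f t)).
Proof. exact: cont_comp (@continuous_cos R). Qed.

Lemma cont_maxr f g : continuous f -> continuous g ->
  continuous (fun t => Num.max (f t) (g t)).
Proof. by move=> cf cg t; apply: continuous_max; [exact: cf|exact: cg]. Qed.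

Lemma cont_minr f g : continuous f -> continuous g ->
  continuous (fun t => Num.min (f t) (g t)).
Proof. by move=> cf cg t; apply: continuous_min; [exact: cf|exact: cg]. Qed.

Lemma cont_norm f : continuous f -> continuous (fun t => `|f t|).
Proof. by apply: cont_comp => x; exact: norm_continuous. Qed.

Lemma cont_sqrt f : continuous f -> continuous (fun t => Num.sqrt (f t)).
Proof. by apply: cont_comp => x; exact: sqrt_continuous. Qed.

End RealContinuity.

(** * Derivatives, comparison arguments and primitives on the line *)

Section RealDerivatives.
Variable R : realType.
Implicit Types (f g : R -> R) (t a b c : R).

Lemma is_derive_ext f g t a : f =1 g -> is_derive t 1 f a -> is_derive t 1 g a.
Proof. by move=> /funext ->. Qed.

Lemma is_derive_val f t a b : a = b -> is_derive t 1 f a -> is_derive t 1 f b.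
Proof. by move=> ->. Qed.

Lemma derD f g t a b : is_derive t 1 f a -> is_derive t 1 g b ->
  is_derive t 1 (fun s => f s + g s) (a + b).
Proof. exact: is_deriveD. Qed.

Lemma derN f t a : is_derive t 1 f a -> is_derive t 1 (fun s => - f s) (- a).
Proof. exact: is_deriveN. Qed.

Lemma derB f g t a b : is_derive t 1 f a -> is_derive t 1 g b ->
  is_derive t 1 (fun s => f s - g s) (a - b).
Proof. exact: is_deriveB. Qed.

Lemma derM f g t a b : is_derive t 1 f a -> is_derive t 1 g b ->
  is_derive t 1 (fun s => f s * g s) (a * g t + f t * b).
Proof.
move=> df dg; have := is_deriveM df dg; apply: is_derive_val.
by rewrite /GRing.scale /= addrC mulrC.
Qed.

Lemma der_cst c t : is_derive t 1 (fun _ => c) 0.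
Proof. exact: is_derive_cst. Qed.

Lemma der_id t : is_derive t 1 (fun s => s) 1.
Proof. exact: is_derive_id. Qed.

Lemma derZ c f t a : is_derive t 1 f a -> is_derive t 1 (fun s => c * f s) (c * a).
Proof. exact: is_deriveZ. Qed.

Lemma der_sum (I : Type) (r : seq I) (F : I -> R -> R) (a : I -> R) t :
  (forall i, is_derive t 1 (F i) (a i)) ->
  is_derive t 1 (fun s => \sum_(i <- r) F i s) (\sum_(i <- r) a i).
Proof.
move=> h; elim: r => [|i r IH].
  by rewrite big_nil; apply: is_derive_ext (der_cst 0 t) => s; rewrite big_nil.
rewrite big_cons; apply: is_derive_ext (derD (h i) IH) => s.
by rewrite big_cons.
Qed.

Lemma der_comp f g t a b : is_derive (g t) 1 f a -> is_derive t 1 g b ->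
  is_derive t 1 (fun s => f (g s)) (a * b).
Proof. by move=> df dg; exact: (is_derive1_comp df dg). Qed.

Lemma der_expR g t b : is_derive t 1 g b ->
  is_derive t 1 (fun s => expR (g s)) (expR (g t) * b).
Proof. exact: der_comp. Qed.

Lemma der_cos g t b : is_derive t 1 g b ->
  is_derive t 1 (fun s => cos (g s)) (- sin (g t) * b).
Proof. exact: der_comp. Qed.

Lemma der_cont f t a : is_derive t 1 f a -> {for t, continuous f}.
Proof. by move=> df; apply/differentiable_continuous/derivable1_diffP. Qed.

Lemma cont_deriv_ge0 f f' (T : R) : continuous f ->
  (forall t, 0 < t < T -> is_derive t 1 f (f' t)) ->
  (forall t, 0 < t < T -> 0 <= f' t) ->
  forall s t, 0 <= s -> s <= t -> t <= T -> f s <= f t.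
Proof.
move=> cf df f0 s t s0 st tT.
apply: (@ger0_derive1_le_cc R f 0 T); rewrite ?in_itv/= ?s0 ?tT ?andbT//.
- by move=> x; rewrite in_itv /= => /df [].
- by move=> x; rewrite in_itv/= => xT; rewrite derive1E; case: (df x xT) => _ ->; exact: f0.
- exact: continuous_subspaceT.
- exact: le_trans st tT.
- exact: le_trans s0 st.
Qed.

Lemma der_expRM c t : is_derive t 1 (fun s : R => expR (c * s)) (expR (c * t) * c).
Proof.
by apply: is_derive_val (der_expR (derZ c (der_id t))); rewrite mulr1.
Qed.

Lemma cont_expRM c : continuous (fun t : R => expR (c * t)).
Proof. by move=> t; exact: der_cont (der_expRM c t). Qed.

(** [g + f] and [g - f] are nondecreasing. This comparison replaces integral estimates: to bound [f]
    one exhibits a majorant [g] with larger derivative. *)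
Lemma deriv_bound f f' g g' (T : R) : continuous f -> continuous g ->
  (forall t, 0 < t < T -> is_derive t 1 f (f' t)) ->
  (forall t, 0 < t < T -> is_derive t 1 g (g' t)) ->
  (forall t, 0 < t < T -> `|f' t| <= g' t) -> `|f 0| <= g 0 ->
  forall t, 0 <= t <= T -> `|f t| <= g t.
Proof.
move=> cf cg df dg fg fg0 t /andP[t0 tT]; rewrite ler_norml -subr_ge0 opprK.
move: fg0; rewrite ler_norml -subr_ge0 opprK => /andP[h1 h2].
apply/andP; split.
  apply: le_trans h1 _.
  apply: (@cont_deriv_ge0 (fun t => f t + g t) (fun t => f' t + g' t) T) => //.
  - exact: contD.
  - by move=> s sT; apply: derD; [exact: df|exact: dg].
  - by move=> s /fg; rewrite ler_norml -subr_ge0 opprK => /andP[].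
rewrite -subr_ge0; move: h2; rewrite -subr_ge0 => /le_trans; apply.
apply: (@cont_deriv_ge0 (fun t => g t - f t) (fun t => g' t - f' t) T) => //.
- exact: contB.
- by move=> s sT; apply: derB; [exact: dg|exact: df].
- by move=> s /fg; rewrite ler_norml subr_ge0 => /andP[].
Qed.

Lemma cont_max0 : continuous (fun t : R => Num.max t 0).
Proof. by move=> t; apply: (@continuous_max R R idfun (fun _ => 0)) => //; exact: cvg_cst. Qed.

Lemma der_max0 f t a : 0 < t -> is_derive t 1 f a ->
  is_derive t 1 (fun s => f (Num.max s 0)) a.
Proof.
move=> t0; apply: near_eq_is_derive; near=> s.
rewrite max_l//; near: s; exact: lt_le_nbhsr.
Unshelve. all: by end_near. Qed.

(** Freezing a half-line function at its value at 0 for negative times makes it continuous on the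
    whole line, so that paths need not carry a domain. *)
Lemma within_ge0_continuous (U : topologicalType) (f : R -> U) :
  {within [set t : R | 0 <= t], continuous f} ->
  continuous (fun t => f (Num.max t 0)).
Proof.
move=> cf t.
have m0 : [set t : R | 0 <= t] (Num.max t 0) by rewrite /= le_max lexx orbT.
move=> B nB; move: (cf (Num.max t 0) B nB); rewrite /nbhs /= -nbhs_subspace_in//.
move=> h.
have h2 : \forall s \near t, 0 <= Num.max s 0 -> B (f (Num.max s 0)).
  exact: (@cont_max0 t _ h).
suff : \forall s \near t, B (f (Num.max s 0)) by [].
near=> s; have hs : 0 <= Num.max s 0 by rewrite le_max lexx orbT.
by move: hs; near: s.
Unshelve. all: by end_near. Qed.

(** The base point -1 makes 0 an interior point of the domain of integration, so that continuity at
    0 also follows from the fundamental theorem of calculus; the maximum freezes the primitive at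
    negative times. *)
Definition prim g t : R :=
  \int[lebesgue_measure]_(s in [set` `[-1, Num.max t 0]]) g s
  - \int[lebesgue_measure]_(s in [set` `[-1, 0]]) g s.

Lemma prim0 g : prim g 0 = 0.
Proof. by rewrite /prim maxxx subrr. Qed.

Lemma prim_max0 g t : prim g (Num.max t 0) = prim g t.
Proof. by rewrite /prim -maxA maxxx. Qed.

Lemma prim_der_aux g t : continuous g -> -1 < t ->
  is_derive t 1 (fun t => \int[lebesgue_measure]_(s in [set` `[-1, t]]) g s) (g t).
Proof.
move=> cg t1.
have tt : t < t + 1 by rewrite ltrDl.
have ig : lebesgue_measure.-integrable `[-1, t + 1] (EFin \o g).
  apply: continuous_compact_integrable; first exact: segment_compact.
  exact: continuous_subspaceT.
have [d1 d2] := continuous_FTC1_closed tt ig t1 (cg t).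
by split; [exact: d1|rewrite -derive1E; exact: d2].
Qed.

Lemma prim_cont g : continuous g -> continuous (prim g).
Proof.
move=> cg t; rewrite /prim; apply: cvgB; last exact: cvg_cst.
apply: (@continuous_comp _ _ _ (fun t : R => Num.max t 0)
  (fun t => \int[lebesgue_measure]_(s in [set` `[-1, t]]) g s)).
  exact: cont_max0.
apply: der_cont (prim_der_aux cg _).
by rewrite lt_max ltrN10 orbT.
Qed.

Lemma prim_der g t : continuous g -> 0 < t -> is_derive t 1 (prim g) (g t).
Proof.
move=> cg t0; have t1 : -1 < t by apply: lt_trans t0; rewrite ltrN10.
have := derB (der_max0 t0 (prim_der_aux cg t1))
  (der_cst (\int[lebesgue_measure]_(s in [set` `[-1, 0]]) g s) t).
by rewrite subr0.
Qed.

(** With [c k] the sum of the tail of the bounds, [a - c] is nondecreasing, [a + c] is nonincreasing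
    and the former stays below the latter; the supremum of [a - c] is therefore a limit with an
    explicit rate. *)
Lemma geometric_limit (a : nat -> R) M : 
  (forall k, `|a k.+1 - a k| <= M / 2 ^+ k) ->
  exists l, forall k, `|l - a k| <= 2 * M / 2 ^+ k.
Proof.
move=> h; pose c k := 2 * M / 2 ^+ k.
have p2 k : 0 < 2 ^+ k :> R by rewrite exprn_gt0.
have M0 : 0 <= M by have := le_trans (normr_ge0 _) (h 0%N); rewrite expr0 divr1.
have c0 k : 0 <= c k by rewrite /c divr_ge0// ?mulr_ge0// ltW.
have cS k : c k = M / 2 ^+ k + c k.+1.
  by rewrite /c exprS; field; rewrite gt_eqF.
pose u k := a k - c k; pose v k := a k + c k.
have uS : {homo u : m n / (m <= n)%N >-> m <= n}.
  apply: homo_leq => [//|y x z|k]; first exact: le_trans.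
  by have := h k; rewrite ler_norml /u (cS k) => /andP[]; lra.
have vS : {homo v : m n / (m <= n)%N >-> n <= m}.
  apply: (@homo_leq _ v (fun x y => y <= x)) => [//|y x z|k].
    by move=> yx zy; exact: le_trans zy yx.
  by have := h k; rewrite ler_norml /v (cS k) => /andP[]; lra.
have uv m n : u m <= v n.
  apply: (@le_trans _ _ (u (maxn m n))); first by apply: uS; exact: leq_maxl.
  apply: (@le_trans _ _ (v (maxn m n))); last by apply: vS; exact: leq_maxr.
  by rewrite /u /v; have := c0 (maxn m n); lra.
have hs : has_sup (range u).
  split; first by exists (u 0%N), 0%N.
  by exists (v 0%N) => _ [m _ <-].
exists (sup (range u)) => k; rewrite ler_distl; apply/andP; split.
  by apply: (ub_le_sup hs.2); exists k.
by apply: ge_sup; [exact: hs.1|move=> _ [m _ <-]; exact: uv].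
Qed.

End RealDerivatives.

(** * Picard iteration and uniqueness for globally Lipschitz systems *)

Section PicardLindelof.
Variables (R : realType) (I : finType) (G : (I -> R) -> I -> R) (L : R).
Hypothesis L0 : 0 <= L.
Hypothesis Glip : forall y z i, `|G y i - G z i| <= L * \sum_j `|y j - z j|.

Lemma lipschitz_continuous (y : R -> I -> R) i : (forall j, continuous (y ^~ j)) ->
  continuous (fun t => G (y t) i).
Proof.
move=> cy t.
have h : L * \sum_j `|y s j - y t j| @[s --> t] --> 0.
  have : continuous (fun s => L * \sum_j `|y s j - y t j|).
    apply: contM; first exact: cont_cst.
    apply: cont_sum => j; apply: cont_norm.
    by apply: contB; [exact: cy|exact: cont_cst].
  move=> /(_ t); rewrite /continuous_at big1 ?mulr0// => j _.
  by rewrite subrr normr0.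
apply/cvgrPdist_le => e e0; near=> s.
rewrite distrC; apply: le_trans (Glip _ _ _) _.
near: s; move/cvgrPdist_le : h => /(_ e e0); apply: filterS => s.
by rewrite sub0r normrN; apply: le_trans; exact: ler_norm.
Unshelve. all: by end_near. Qed.

Variable y0 : I -> R.

Fixpoint picard_iter (k : nat) (t : R) (i : I) : R :=
  if k is k'.+1 then y0 i + prim (fun s => G (picard_iter k' s) i) t else y0 i.

Let n : R := #|I|%:R.
(** Exponent of the weight [exp (K * t)]: since [n * L <= K / 2], one Picard step halves weighted
    distances, so no restriction to short times is needed. The [+ 1] gives [1 <= K], used for the
    first increment. *)
Let K := 2 * n * L + 1.
Let M := \sum_i `|G y0 i|.

Let K1 : 1 <= K. Proof. by rewrite /K lerDr !mulr_ge0. Qed.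
Let M0 : 0 <= M. Proof. exact: sumr_ge0. Qed.

Lemma picard_iter_cont k i : continuous (picard_iter k ^~ i).
Proof.
elim: k i => [|k IH] i /=; first exact: cont_cst.
apply: contD; first exact: cont_cst.
by apply: prim_cont; exact: lipschitz_continuous.
Qed.

Lemma sum_le_const (F : I -> R) c : (forall i, F i <= c) -> \sum_i F i <= n * c.
Proof.
move=> h; apply: (@le_trans _ _ (\sum_(i : I) c)); first exact: ler_sum.
by rewrite sumr_const mulr_natl.
Qed.

(** The contraction estimate in the weighted norm: the difference of the integrands is at most
    [n * L * c * exp (K * t)], which does not exceed the derivative of [c / 2 * exp (K * t)]. *)
Lemma lip_prim (y z : R -> I -> R) (c : R) i : 0 <= c ->
  (forall j, continuous (y ^~ j)) -> (forall j, continuous (z ^~ j)) ->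
  (forall (t : R) j, 0 <= t -> `|y t j - z t j| <= c * expR (K * t)) ->
  forall t : R, 0 <= t ->
  `|prim (fun s => G (y s) i) t - prim (fun s => G (z s) i) t|
    <= c / 2 * expR (K * t).
Proof.
move=> c0 cy cz yz t t0.
have cGy := @lipschitz_continuous y i cy; have cGz := @lipschitz_continuous z i cz.
apply: (@deriv_bound R (fun t => prim (fun s => G (y s) i) t - prim (fun s => G (z s) i) t)
  (fun t => G (y t) i - G (z t) i) (fun t => c / 2 * expR (K * t))
  (fun t => c / 2 * (expR (K * t) * K)) t); rewrite ?t0 ?lexx//.
- by apply: contB; exact: prim_cont.
- by apply: contM; [exact: cont_cst|exact: cont_expRM].
- by move=> s /andP[s0 _]; apply: derB; exact: prim_der.
- by move=> s _; apply: derZ; exact: der_expRM.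
- move=> s /andP[s0 _]; apply: le_trans (Glip _ _ _) _.
  apply: (@le_trans _ _ (L * (n * (c * expR (K * s))))).
    by apply: ler_wpM2l => //; apply: sum_le_const => j; apply: yz; exact: ltW.
  have -> : c / 2 * (expR (K * s) * K)
    = L * (n * (c * expR (K * s))) + c / 2 * expR (K * s) by rewrite /K; field.
  by rewrite lerDl !mulr_ge0// expR_ge0.
- by rewrite !prim0 subrr normr0 !mulr_ge0// expR_ge0.
Qed.

Lemma picard_iter_step k i (t : R) : 0 <= t ->
  `|picard_iter k.+1 t i - picard_iter k t i| <= M * expR (K * t) / 2 ^+ k.
Proof.
elim: k i t => [|k IH] i t t0.
  rewrite /= addrAC subrr add0r expr0 divr1.
  apply: (@deriv_bound R (prim (fun=> G y0 i)) (fun=> G y0 i)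
    (fun t => M * expR (K * t)) (fun t => M * (expR (K * t) * K)) t);
    rewrite ?t0 ?lexx//.
  - by apply: prim_cont; exact: cont_cst.
  - by apply: contM; [exact: cont_cst|exact: cont_expRM].
  - by move=> s /andP[s0 _]; apply: prim_der => //; exact: cont_cst.
  - by move=> s _; apply: derZ; exact: der_expRM.
  - move=> s /andP[s0 _]; apply: (@le_trans _ _ M).
      by rewrite /M (bigD1 i)//= lerDl sumr_ge0.
    rewrite ler_peMr// -[1]mul1r ler_pM//.
    by rewrite -[1]expR0 ler_expR mulr_ge0// ltW// (lt_le_trans ltr01).
  - by rewrite prim0 normr0 mulr_ge0// expR_ge0.
have := @lip_prim (picard_iter k.+1) (picard_iter k) (M / 2 ^+ k) i _ _ _ _ t t0.
have cancel (a b c : R) : b - c = (a + b) - (a + c) by ring.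
rewrite (cancel (y0 i)) => h.
have -> : M * expR (K * t) / 2 ^+ k.+1 = M / 2 ^+ k / 2 * expR (K * t).
  by rewrite exprS; field; rewrite expf_neq0.
apply: h.
- by rewrite divr_ge0// exprn_ge0.
- by move=> j; exact: picard_iter_cont.
- by move=> j; exact: picard_iter_cont.
- by move=> s j s0; rewrite mulrAC; exact: IH.
Qed.

Lemma picard_iter_max0 k t i : picard_iter k (Num.max t 0) i = picard_iter k t i.
Proof. by case: k => //= k; rewrite prim_max0. Qed.

Theorem picard_lindelof : exists y : R -> I -> R,
  [/\ y 0 = y0, forall i, continuous (y ^~ i) &
      forall (t : R) i, 0 < t -> is_derive t 1 (y ^~ i) (G (y t) i)].
Proof.
have /choice[l0 hl0] : forall ti : R * I, exists l, forall k,
    `|l - picard_iter k ti.1 ti.2|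
      <= 2 * (M * expR (K * Num.max ti.1 0)) / 2 ^+ k.
  move=> [t i] /=; apply: geometric_limit => k.
  rewrite -!(picard_iter_max0 _ t); apply: picard_iter_step.
  by rewrite le_max lexx orbT.
pose y t i := l0 (t, i).
have hy t i k : `|y t i - picard_iter k t i|
    <= 2 * (M * expR (K * Num.max t 0)) / 2 ^+ k by exact: (hl0 (t, i)).
have small (c e : R) : 0 < e -> exists k : nat, c / 2 ^+ k <= e.
  move=> e0; have : c / 2 ^+ k @[k --> \oo] --> 0.
    rewrite -(mulr0 c); apply: cvgM; first exact: cvg_cst.
    have := @cvg_expr R (2^-1); rewrite ger0_norm// invf_lt1// ltr1n => /(_ isT).
    have -> : (fun k => (2 ^+ k)^-1) = (fun k => 2^-1 ^+ k) :> (nat -> R).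
      by apply/funext => k; rewrite exprVn.
    by [].
  move=> /cvgrPdist_le/(_ e e0) [k _ /(_ k (leqnn k))] /=.
  by rewrite sub0r normrN => h; exists k; apply: le_trans h; exact: ler_norm.
(* The error of the [k]-th iterate is uniform over times at most [max t 0 + 1], so continuity passes
   to the limit. *)
have cy i : continuous (y ^~ i).
  move=> t; apply/cvgrPdist_le => e e0.
  have e3 : 0 < e / 3 by rewrite divr_gt0.
  have [k hk] := small (2 * (M * expR (K * (Num.max t 0 + 1)))) _ e3.
  have bnd s : Num.max s 0 <= Num.max t 0 + 1 ->
      `|y s i - picard_iter k s i| <= e / 3.
    move=> st; apply: le_trans (hy s i k) _; apply: le_trans hk.
    rewrite ler_pM2r ?invr_gt0 ?exprn_gt0// !ler_wpM2l// ler_expR ler_wpM2l//.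
    exact: le_trans ler01 K1.
  near=> s.
  have b1 : `|y t i - picard_iter k t i| <= e / 3 by apply: bnd; rewrite lerDl.
  have b2 : `|y s i - picard_iter k s i| <= e / 3.
    apply: bnd; near: s; have := @cont_max0 R t.
    move=> /cvgrPdist_lt/(_ 1 ltr01); apply: filterS => s.
    by rewrite ltr_distlC => /andP[_ /ltW].
  have b3 : `|picard_iter k t i - picard_iter k s i| <= e / 3.
    near: s; have := @picard_iter_cont k i t.
    by move=> /cvgrPdist_le/(_ _ e3).
  move: b1 b2 b3; rewrite !ler_norml => /andP[? ?] /andP[? ?] /andP[? ?].
  by apply/andP; split; lra.
(* Fixed-point equation up to any [e]: [y] is compared with iterate [k.+1], and the primitives of
   the field along iterate [k] and along [y] are compared by [lip_prim]. *)
have fix_ t i : 0 <= t -> y t i = y0 i + prim (fun s => G (y s) i) t.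
  move=> t0; apply/eqP; rewrite -subr_eq0 -normr_le0; apply/ler_addgt0Pr => e e0.
  rewrite add0r.
  have [k hk] := small (2 * (2 * (M * expR (K * t)))) _ e0.
  apply: le_trans hk.
  have h1 := hy t i k.+1; rewrite (max_l t0) exprS in h1.
  have h2 : `|prim (fun s => G (picard_iter k s) i) t - prim (fun s => G (y s) i) t|
      <= 2 * M / 2 ^+ k / 2 * expR (K * t).
    apply: lip_prim => //.
    - by rewrite divr_ge0 ?mulr_ge0// exprn_ge0.
    - by move=> j; exact: picard_iter_cont.
    - move=> s j s0; rewrite distrC; have := hy s j k; rewrite (max_l s0).
      by move=> /le_trans; apply; rewrite le_eqVlt; apply/orP; left; apply/eqP; ring.
  have -> : y t i - (y0 i + prim (fun s => G (y s) i) t)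
    = (y t i - picard_iter k.+1 t i)
    + (prim (fun s => G (picard_iter k s) i) t - prim (fun s => G (y s) i) t).
    by rewrite /=; ring.
  apply: le_trans (ler_normD _ _) _; apply: le_trans (lerD h1 h2) _.
  have p2 : 2 ^+ k != 0 :> R by rewrite expf_neq0.
  have -> : 2 * (M * expR (K * t)) / (2 * 2 ^+ k)
     + 2 * M / 2 ^+ k / 2 * expR (K * t) = 2 * (M * expR (K * t)) / 2 ^+ k.
    by field.
  rewrite ler_pM2r ?invr_gt0 ?exprn_gt0// ler_peMl ?ler1n//.
  by rewrite !mulr_ge0// expR_ge0.
exists y; split=> //.
- by apply/funext => i; rewrite fix_// prim0 addr0.
- move=> t i t0.
  have := derD (der_cst (y0 i) t) (prim_der (@lipschitz_continuous y i cy) t0).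
  rewrite add0r; apply: near_eq_is_derive; near=> s.
  by rewrite fix_//; near: s; exact: lt_le_nbhsr.
Unshelve. all: by end_near. Qed.

(* Gronwall on the squared distance. *)
Theorem lipschitz_ode_unique (y z : R -> I -> R) (T : R) :
  (forall i, continuous (y ^~ i)) -> (forall i, continuous (z ^~ i)) ->
  (forall (t : R) i, 0 < t < T -> is_derive t 1 (y ^~ i) (G (y t) i)) ->
  (forall (t : R) i, 0 < t < T -> is_derive t 1 (z ^~ i) (G (z t) i)) ->
  y 0 = z 0 -> forall t : R, 0 <= t <= T -> y t = z t.
Proof.
move=> cy cz dy dz yz0 t /andP[t0 tT].
pose u t := \sum_i (y t i - z t i) ^+ 2.
pose C := 2 * L * n.
pose u' t := \sum_i 2 * (y t i - z t i) * (G (y t) i - G (z t) i).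
have u0 s : 0 <= u s by apply: sumr_ge0 => i _; exact: sqr_ge0.
have du s : 0 < s < T -> is_derive s 1 u (u' s).
  move=> sT; apply: der_sum => i.
  have h := derB (dy s i sT) (dz s i sT).
  have := derM h h; apply: is_derive_val.
  by ring.
have cu : continuous u.
  apply: cont_sum => i; under [X in continuous X]eq_fun do rewrite expr2.
  by apply: contM; apply: contB.
have u'le s : u' s <= C * u s.
  pose a i := `|y s i - z s i|.
  apply: (@le_trans _ _ (\sum_i 2 * a i * (L * \sum_j a j))).
    apply: ler_sum => i _; apply: le_trans (ler_norm _) _.
    by rewrite !normrM ger0_norm// ler_wpM2l// mulr_ge0.
  have -> : \sum_i 2 * a i * (L * \sum_j a j) = L * \sum_i \sum_j 2 * a i * a j.
    rewrite [RHS]mulr_sumr; apply: eq_bigr => i _.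
    by rewrite -[in RHS]mulr_sumr; ring.
  (* This double sum is [2 * n * u s]; together with [2 a_i a_j <= a_i^2 + a_j^2] it explains the
     constant [C = 2 * L * n]. *)
  have -> : C * u s = L * \sum_(i : I) \sum_(j : I) (a i ^+ 2 + a j ^+ 2).
    have -> : u s = \sum_i a i ^+ 2.
      by apply: eq_bigr => i _; rewrite /a real_normK// num_real.
    have -> : \sum_(i : I) \sum_(j : I) (a i ^+ 2 + a j ^+ 2)
       = \sum_(i : I) (n * a i ^+ 2 + \sum_j a j ^+ 2).
      apply: eq_bigr => i _; rewrite big_split /=; congr (_ + _).
      by rewrite sumr_const mulr_natl.
    rewrite big_split /= sumr_const -mulr_sumr -mulr_natl /C -/n; ring.
  apply: ler_wpM2l => //; apply: ler_sum => i _; apply: ler_sum => j _.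
  by have := sqr_ge0 (a i - a j); rewrite sqrrB; lra.
pose w s := - (expR (- C * s) * u s).
pose w' s := - (expR (- C * s) * (- C) * u s + expR (- C * s) * u' s).
have cw : continuous w by apply: contN; apply: contM cu; exact: cont_expRM.
have dw s : 0 < s < T -> is_derive s 1 w (w' s).
  by move=> sT; exact: derN (derM (der_expRM _ _) (du s sT)).
have w'0 s : 0 < s < T -> 0 <= w' s.
  move=> _; have -> : w' s = expR (- C * s) * (C * u s - u' s) by rewrite /w'; ring.
  by rewrite mulr_ge0 ?expR_ge0// subr_ge0.
have := cont_deriv_ge0 cw dw w'0 (lexx 0) t0 tT; rewrite /w lerN2.
have -> : u 0 = 0 by rewrite /u big1// => i _; rewrite yz0 subrr expr0n.
rewrite mulr0 pmulr_rle0 ?expR_gt0// => ut0.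
have ut : u t = 0 by apply/eqP; rewrite eq_le ut0 u0.
apply/funext => i; apply/eqP; rewrite -subr_eq0 -sqrf_eq0.
have := psumr_eq0P (fun i _ => sqr_ge0 (y t i - z t i)) ut.
by move=> ->.
Qed.

End PicardLindelof.

(** * Lipschitz estimates for exponentials and cosines *)

Section ScalarBounds.
Variable R : realType.
Implicit Types a b c k th : R.

Lemma cos_lipschitz a b : `|cos a - cos b| <= `|a - b|.
Proof.
wlog ab : a b / b <= a.
  move=> h; have [/h//|/ltW/h] := leP b a.
  by rewrite distrC [X in _ <= X -> _]distrC.
rewrite [leRHS]ger0_norm ?subr_ge0//.
have -> : cos a - cos b = cos (b + (a - b)) - cos b.
  by congr (cos _ - _); ring.
apply: (@deriv_bound R (fun s => cos (b + s) - cos b)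
  (fun s => - sin (b + s) * (0 + 1) - 0) (fun s => s) (fun=> 1) (a - b));
  last by rewrite subr_ge0 ab lexx.
- apply: contB; last exact: cont_cst.
  by apply: cont_cos; apply: contD; [exact: cont_cst|move=> t; exact: cvg_id].
- by move=> t; exact: cvg_id.
- move=> t _; rewrite subr0 add0r mulr1 normrN ler_norml.
  by rewrite sin_geN1 sin_le1.
- by rewrite addr0 subrr normr0.
Qed.

Lemma cos_norm_le1 a : `|cos a| <= 1.
Proof. by rewrite ler_norml cos_geN1 cos_le1. Qed.

Lemma expRN_lipschitz k a b : k <= a -> k <= b ->
  `|expR (- a) - expR (- b)| <= expR (- k) * `|a - b|.
Proof.
move=> ka kb; wlog ab : a b ka kb / a <= b.
  move=> h; have [/(h _ _ ka kb)//|/ltW/(h _ _ kb ka)] := leP a b.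
  by rewrite distrC [X in _ <= _ * X -> _]distrC.
rewrite ger0_norm ?subr_ge0 ?ler_expR ?lerN2// distrC ger0_norm ?subr_ge0//.
have -> : expR (- b) = expR (- a) * expR (- (b - a)) by rewrite -expRD; congr expR; ring.
rewrite -[X in X - _]mulr1 -mulrBr; apply: ler_pM; rewrite ?expR_ge0//.
- by rewrite subr_ge0 expR_le1 oppr_le0 subr_ge0.
- by rewrite ler_expR lerN2.
- by have := expR_ge1Dx (- (b - a)); lra.
Qed.

Lemma expcos_lipschitz k a a' b b' : k <= a -> k <= a' ->
  `|expR (- a) * cos b - expR (- a') * cos b'|
    <= expR (- k) * (`|a - a'| + `|b - b'|).
Proof.
move=> ka ka'.
have -> : expR (- a) * cos b - expR (- a') * cos b'
  = (expR (- a) - expR (- a')) * cos b + expR (- a') * (cos b - cos b') by ring.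
rewrite [leRHS]mulrDr (le_trans (ler_normD _ _))// lerD// normrM.
  apply: le_trans (expRN_lipschitz ka ka').
  by rewrite ler_piMr// cos_norm_le1.
rewrite ger0_norm ?expR_ge0// ler_pM ?expR_ge0 ?cos_lipschitz//.
by rewrite ler_expR lerN2.
Qed.

(** The factor [r] produced by a Lipschitz bound on an exponential is traded for [Num.min r 1], the
    weight that the jump measures integrate. For [r > 1] this is [k * r <= exp (k * r)]. *)
Lemma exp_mulr_le k r : 0 < k <= 1 -> 0 <= r ->
  expR (- (k * r)) * r <= k^-1 * Num.min r 1.
Proof.
move=> /andP[k0 k1] r0; have [r1|r1] := leP r 1.
  rewrite ler_pM ?expR_ge0//; apply: le_trans (_ : 1 <= _).
    by rewrite expR_le1 oppr_le0 mulr_ge0// ltW.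
  by rewrite invf_ge1.
rewrite mulr1 expRN ler_pdivrMl ?expR_gt0// ler_pdivlMr//.
by have := expR_ge1Dx (k * r); lra.
Qed.

End ScalarBounds.

(** * Measurability of the cone and of continuous functions on matrices *)

Section MatrixMeasurability.
Variables (R : realType) (d : nat).

Lemma cont_entry (i j : 'I_d) : continuous (fun x : 'M[R]_d => x i j).
Proof. by move=> x; exact: coord_continuous. Qed.

Lemma cont_innerr (A : 'M[R]_d) : continuous (inner A).
Proof.
rewrite (_ : inner A = fun x => \sum_i \sum_j A i j * x j i).
  apply: cont_sum => i; apply: cont_sum => j.
  by apply: contM; [exact: cont_cst|exact: cont_entry].
by apply/funext => x; rewrite innerE.
Qed.

Lemma cont_fnorm : continuous (@fnorm R d).
Proof.
apply: cont_sqrt; rewrite (_ : (fun x => _) = fun x : 'M[R]_d => \sum_i \sum_j x i j * x j i).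
  apply: cont_sum => i; apply: cont_sum => j.
  by apply: contM; exact: cont_entry.
by apply/funext => x; rewrite innerE.
Qed.

Lemma cont_measurable (f : 'M[R]_d -> R) (D : set (Mx R d)) : measurable D ->
  continuous f -> measurable_fun D (f : Mx R d -> R).
Proof.
move=> mD /continuousP cf; apply: (measurability _ (RGenOpens.measurableE R)).
move=> _ [_ [a [b ->] <-]]; apply: measurableI => //.
by apply: sub_sigma_algebra; exact/cf/interval_open.
Qed.

Lemma closed_psdset : closed (@psdset R d : set 'M[R]_d).
Proof.
have -> : @psdset R d = \bigcap_(i in [set: 'I_d]) \bigcap_(j in [set: 'I_d])
      (fun x : 'M[R]_d => x i j - x j i) @^-1` [set 0]
   `&` \bigcap_(v in [set: 'cV[R]_d]) (fun x : 'M[R]_d => qf x v) @^-1` [set r | 0 <= r].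
  apply/seteqP; split=> [x [sx px]|x [sx px]].
    split=> [i _ j _|v _]; last exact: px.
    by rewrite /= (symE i j sx) subrr.
  apply: psdI => [|v]; last exact: px.
  apply/matrixP => i j; rewrite mxE; apply/eqP; rewrite -subr_eq0; apply/eqP.
  exact: sx.
apply: closedI; last first.
  apply: closed_bigI => v _; apply: preimage_closed; last exact: closed_ge.
  have -> : (fun x : 'M[R]_d => qf x v) = inner (v *m v^T).
    by apply/funext => y; rewrite innerC inner_col.
  by move=> x _; exact: cont_innerr.
apply: closed_bigI => i _; apply: closed_bigI => j _.
apply: preimage_closed; last exact: closed_eq.
by move=> x _; apply: contB; exact: cont_entry.
Qed.

Lemma measurable_closed (D : set 'M[R]_d) : closed D -> measurable (D : set (Mx R d)).
Proof.
move=> cD; rewrite -[D]setCK; apply: measurableC; apply: sub_sigma_algebra.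
exact: closed_openC.
Qed.

Lemma measurable_psdset : measurable (@psdset R d).
Proof. by apply: measurable_closed; exact: closed_psdset. Qed.

Lemma measurable_psdset0 : measurable (@psdset0 R d).
Proof.
(* Intersecting with the cone matters: [fnorm] can also vanish at nonsymmetric matrices, but among
   symmetric ones only at 0. *)
have -> : @psdset0 R d = @psdset R d `\` (@fnorm R d @^-1` [set 0] `&` @psdset R d).
  apply/seteqP; split=> [x [px x0]|x [px hx]].
    split=> // -[/= n0 _]; apply: x0; apply/matrixP => i j; rewrite mxE.
    by apply/eqP; rewrite -normr_le0 -n0; exact: entry_le_fnorm px.1.
  split=> // x0; apply: hx; split=> //=.
  by rewrite x0 /fnorm inner0l sqrtr0.
apply: measurableD; first exact: measurable_psdset.
apply: measurableI; last exact: measurable_psdset.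
apply: measurable_closed; apply: preimage_closed; last exact: closed_eq.
by move=> x _; exact: cont_fnorm.
Qed.

Lemma Rintegral_sum (mu : {measure set (Mx R d) -> \bar R}) (D : set (Mx R d))
    (I : Type) (r : seq I) (F : I -> Mx R d -> R) : measurable D ->
  (forall i, mu.-integrable D (EFin \o F i)) ->
  mu.-integrable D (EFin \o fun x => \sum_(i <- r) F i x) /\
  \int[mu]_(x in D) \sum_(i <- r) F i x = \sum_(i <- r) \int[mu]_(x in D) F i x.
Proof.
move=> mD iF; elim: r => [|i r [IH1 IH2]].
  rewrite big_nil; split.
    rewrite (_ : _ \o _ = cst 0%E); first exact: integrable0.
    by apply/funext => x /=; rewrite big_nil.
  by under eq_Rintegral do rewrite big_nil; rewrite Rintegral_cst// mul0r.
have e : (fun x => \sum_(j <- i :: r) F j x) = (fun x => F i x + \sum_(j <- r) F j x).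
  by apply/funext => x; rewrite big_cons.
rewrite e big_cons -IH2 -RintegralD//; split=> //.
exact: (integrableD mD (iF i) IH1).
Qed.

End MatrixMeasurability.

(** * Integrals of truncated exponentials against the jump measures *)

Section LevyIntegrals.
Variables (R : realType) (d : nat) (nu : {measure set (Mx R d) -> \bar R}).
Variables (h hb : 'M[R]_d -> R).
Notation D := (@psdset0 R d).
Notation M := 'M[R]_d.
Implicit Types (A C : M) (e th : R).

(* The maximum makes this function globally Lipschitz in [A]; it is inactive as
   long as [A - e%:M] is positive semidefinite. *)
Definition trunc_exp e th A C (xi : M) : R :=
  expR (- Num.max (inner A xi) (e * fnorm xi)) * cos (th + inner C xi) - cos th.

(** One set of estimates serves both measures: [m] with [h = hb = 1], and each entry of [mu] with
    [h] an entry of [H] and [hb] its trace, which dominates all entries and is the quantity that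
    admissibility makes integrable. *)
Definition levy_weight (xi : M) : R := Num.min (fnorm xi) 1 * hb xi.

(** For [fnorm xi <= 1] the value is compared with the one at zero exponents by the Lipschitz bound;
    for larger [xi] it is at most 2 in absolute value. *)
Lemma trunc_exp_bound e th A C xi : 0 <= e <= 1 -> psd xi ->
  `|trunc_exp e th A C xi| <= 2 * (mxsum A + mxsum C + 1) * Num.min (fnorm xi) 1.
Proof.
move=> /andP[e0 e1] px; set r := fnorm xi; have r0 : 0 <= r by exact: fnorm_ge0.
have sA := mxsum_ge0 A; have sC := mxsum_ge0 C.
have er : 0 <= e * r by rewrite mulr_ge0.
rewrite /trunc_exp -/r; set m := Num.max (inner A xi) (e * r); have m0 : 0 <= m by rewrite /m le_max er orbT.
have [r1|r1] := leP r 1.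
  have := @expcos_lipschitz R 0 m 0 (th + inner C xi) th m0 (lexx 0).
  rewrite oppr0 expR0 !mul1r addr0 (addrC th) addrK => /le_trans; apply.
  rewrite (ger0_norm m0).
  apply: (@le_trans _ _ ((mxsum A + mxsum C + 1) * r)); last first.
    by rewrite -mulrA ler_peMl ?ler1n// mulr_ge0// !addr_ge0.
  have hA := inner_le_fnorm A px.1; have hC := inner_le_fnorm C px.1.
  rewrite -/r in hA hC.
  have : m <= mxsum A * r + r.
    rewrite /m ge_max; apply/andP; split.
      by apply: le_trans (ler_norm _) _; apply: le_trans hA _; rewrite lerDl.
    by rewrite -[leLHS]add0r lerD ?mulr_ge0// ler_piMl.
  lra.
rewrite mulr1.
apply: le_trans (ler_normB _ _) _; rewrite normrM (ger0_norm (expR_ge0 _)).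
have h1 : expR (- m) * `|cos (th + inner C xi)| <= 1.
  by rewrite mulr_ile1 ?expR_ge0// ?cos_norm_le1// expR_le1 oppr_le0.
have := cos_norm_le1 th; lra.
Qed.

(** The floor [e * fnorm xi] leaves a factor [exp (- (e * fnorm xi))] even where [<A, xi>] is
    negative; it absorbs the factor [fnorm xi] of the Lipschitz estimate at the price of [1 / e]. *)
Lemma trunc_exp_lipschitz e th A C A' C' xi : 0 < e <= 1 -> psd xi ->
  `|trunc_exp e th A C xi - trunc_exp e th A' C' xi|
    <= e^-1 * (mxsum (A - A') + mxsum (C - C')) * Num.min (fnorm xi) 1.
Proof.
move=> e01 px; set r := fnorm xi; have r0 : 0 <= r by exact: fnorm_ge0.
rewrite /trunc_exp -/r opprB addrA subrK.
have kA B : e * r <= Num.max (inner B xi) (e * r) by rewrite le_max lexx orbT.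
apply: le_trans (expcos_lipschitz _ _ (kA A) (kA A')) _.
(* Taking the maximum with a fixed number is nonexpansive. *)
have hmax : `|Num.max (inner A xi) (e * r) - Num.max (inner A' xi) (e * r)|
    <= `|inner A xi - inner A' xi|.
  have [a1|a1] := leP (inner A xi) (e * r); have [a2|a2] := leP (inner A' xi) (e * r);
    rewrite ?subrr ?normr0 ?normr_ge0// ?ler_norml; apply/andP; split;
    have := ler_norm (inner A xi - inner A' xi);
    have := ler_norm (- (inner A xi - inner A' xi)); rewrite normrN; lra.
apply: (@le_trans _ _ (expR (- (e * r)) * r * (mxsum (A - A') + mxsum (C - C')))).
  rewrite -mulrA ler_wpM2l ?expR_ge0// mulrDr lerD//.
    apply: le_trans hmax _; rewrite -innerBl mulrC.
    exact: inner_le_fnorm px.1.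
  have -> : th + inner C xi - (th + inner C' xi) = inner (C - C') xi.
    by rewrite innerBl; ring.
  by rewrite mulrC; exact: inner_le_fnorm px.1.
rewrite -[leRHS]mulrA [leRHS]mulrCA [leLHS]mulrC ler_wpM2l ?addr_ge0 ?mxsum_ge0//.
exact: exp_mulr_le.
Qed.

(** This sign makes the jumps push the real part of [psi] into the cone; [C] enters only through a
    cosine, which is at most 1. *)
Lemma trunc_exp_le0 e A C xi : 0 <= e -> trunc_exp e 0 A C xi <= 0.
Proof.
move=> e0; rewrite /trunc_exp cos0 subr_le0 -[leRHS]mulr1.
apply: (@le_trans _ _ (expR (- Num.max (inner A xi) (e * fnorm xi)) * 1)).
  by rewrite ler_wpM2l ?expR_ge0// cos_le1.
rewrite ler_wpM2r// expR_le1 oppr_le0 le_max.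
by rewrite [X in _ || X]mulr_ge0 ?orbT ?fnorm_ge0.
Qed.

(** [psd (A - e%:M)] gives [<A, xi> >= e * \tr xi], and the trace dominates [fnorm] on the cone, so
    the maximum is inactive. *)
Lemma trunc_expE e th A C xi : 0 <= e -> psd (A - e%:M) -> psd xi ->
  trunc_exp e th A C xi = expR (- inner A xi) * cos (th + inner C xi) - cos th.
Proof.
move=> e0 pA px; rewrite /trunc_exp max_l//.
apply: le_trans (inner_coercive pA px); rewrite ler_wpM2l//.
exact: fnorm_le_tr.
Qed.

Lemma cont_trunc_exp e th A C : continuous (trunc_exp e th A C).
Proof.
apply: contB; last exact: cont_cst.
apply: contM.
  apply: cont_expR; apply: contN; apply: cont_maxr; first exact: cont_innerr.
  by apply: contM; [exact: cont_cst|exact: cont_fnorm].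
apply: cont_cos; apply: contD; [exact: cont_cst|exact: cont_innerr].
Qed.

Hypothesis mh : measurable_fun D (h : Mx R d -> R).
Hypothesis h_le : forall xi, D xi -> `|h xi| <= hb xi.
Hypothesis iW : nu.-integrable D (EFin \o levy_weight).

Definition levy_mass : R := \int[nu]_(xi in D) levy_weight xi.

Lemma levy_weight_ge0 xi : D xi -> 0 <= levy_weight xi.
Proof.
move=> Dxi; rewrite mulr_ge0 ?le_min ?fnorm_ge0 ?ler01//.
by apply: le_trans (h_le Dxi).
Qed.

Lemma levy_mass_ge0 : 0 <= levy_mass.
Proof. by apply: Rintegral_ge0 => xi; exact: levy_weight_ge0. Qed.

Lemma levy_integrable (g : M -> R) K : measurable_fun D (g : Mx R d -> R) ->
  (forall xi, D xi -> `|g xi| <= K * Num.min (fnorm xi) 1) ->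
  nu.-integrable D (EFin \o fun xi => g xi * h xi).
Proof.
move=> mg gK; have mD := @measurable_psdset0 R d.
apply: (@le_integrable _ _ _ nu D mD _ (fun xi => K%:E * (EFin \o levy_weight) xi)%E).
- by apply/measurable_EFinP; exact: measurable_funM.
- move=> xi Dxi /=; rewrite lee_fin normrM /levy_weight mulrA normrM ler_pM//.
    by apply: le_trans (gK _ Dxi) _; exact: ler_norm.
  by apply: le_trans (h_le Dxi) _; exact: ler_norm.
- exact: integrableZl.
Qed.

Lemma levy_integral_bound (g : M -> R) K : measurable_fun D (g : Mx R d -> R) ->
  (forall xi, D xi -> `|g xi| <= K * Num.min (fnorm xi) 1) ->
  `|\int[nu]_(xi in D) (g xi * h xi)| <= K * levy_mass.
Proof.
move=> mg gK; have mD := @measurable_psdset0 R d.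
have ig := levy_integrable mg gK.
apply: le_trans (le_normr_Rintegral mD ig) _.
rewrite /levy_mass -RintegralZl//; apply: le_Rintegral => //.
- exact: (integrable_abse ig).
- exact: (integrableZl mD K iW).
move=> xi Dxi; rewrite normrM /levy_weight mulrA ler_pM//.
- exact: gK.
- exact: h_le.
Qed.

Definition levy_integral e th A C : R :=
  \int[nu]_(xi in D) (trunc_exp e th A C xi * h xi).

Lemma trunc_exp_measurable e th A C :
  measurable_fun D (trunc_exp e th A C : Mx R d -> R).
Proof. by apply: cont_measurable; [exact: measurable_psdset0|exact: cont_trunc_exp]. Qed.

Lemma trunc_exp_integrable e th A C : 0 <= e <= 1 ->
  nu.-integrable D (EFin \o fun xi => trunc_exp e th A C xi * h xi).
Proof.
move=> e01; apply: levy_integrable; first exact: trunc_exp_measurable.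
by move=> xi [px _]; exact: trunc_exp_bound.
Qed.

Lemma levy_integral_le e th A C : 0 <= e <= 1 ->
  `|levy_integral e th A C| <= 2 * (mxsum A + mxsum C + 1) * levy_mass.
Proof.
move=> e01; apply: levy_integral_bound; first exact: trunc_exp_measurable.
by move=> xi [px _]; exact: trunc_exp_bound.
Qed.

Lemma levy_integral_lipschitz e th A C A' C' : 0 < e <= 1 ->
  `|levy_integral e th A C - levy_integral e th A' C'|
    <= e^-1 * (mxsum (A - A') + mxsum (C - C')) * levy_mass.
Proof.
move=> e01; have e01' : 0 <= e <= 1 by case/andP: e01 => /ltW -> ->.
rewrite /levy_integral -RintegralB//; last 3 first.
- exact: measurable_psdset0.
- exact: trunc_exp_integrable.
- exact: trunc_exp_integrable.
under eq_Rintegral do rewrite -mulrBl.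
apply: (@levy_integral_bound (fun xi => trunc_exp e th A C xi - trunc_exp e th A' C' xi)).
  by apply: measurable_funB; exact: trunc_exp_measurable.
by move=> xi [px _]; exact: trunc_exp_lipschitz.
Qed.

End LevyIntegrals.

(** * Consequences of admissibility: integrability and duality *)

Section Admissible.
Variables (R : realType) (d : nat) (alpha b : 'M[R]_d) (B : 'M[R]_d -> 'M[R]_d).
Variables (c : R) (gamma : 'M[R]_d) (m nu : {measure set (Mx R d) -> \bar R}).
Variable H : 'M[R]_d -> 'M[R]_d.
Hypothesis adm : admissible alpha b B c gamma m nu H.
Notation M := 'M[R]_d.
Notation D := (@psdset0 R d).
Implicit Types (A C x u : M).

Lemma adm_alpha : psd alpha. Proof. by case: adm => -[]. Qed.
Lemma adm_b : psd b. Proof. by case: adm => -[]. Qed.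
Lemma adm_c : 0 <= c. Proof. by case: adm => -[]. Qed.
Lemma adm_gamma : psd gamma. Proof. by case: adm => -[]. Qed.

Lemma adm_H xi : D xi -> psd (H xi).
Proof. by case: adm => _ [_ [[_ _ h _] _]]; exact: h. Qed.

Lemma adm_mH i j : measurable_fun D (fun xi : Mx R d => H xi i j).
Proof. by case: adm => _ [_ [[_ h _ _] _]]; exact: h. Qed.

Lemma adm_Hle i j xi : D xi -> `|H xi i j| <= \tr (H xi).
Proof. by move=> Dxi; apply: psd_entry_le_tr; exact: adm_H. Qed.

Lemma adm_BL a x y : sym x -> sym y -> B (a *: x + y) = a *: B x + B y.
Proof. by case: adm => _ [_ [_ [h _ _]]]; exact: h. Qed.

Lemma adm_Bpos x u : psd x -> psd u -> inner x u = 0 -> 0 <= inner (B x) u.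
Proof. by case: adm => _ [_ [_ [_ _ h]]]; exact: h. Qed.

Lemma integrable_of_ge0 (mu : {measure set (Mx R d) -> \bar R}) (f : M -> R) :
  measurable_fun D (f : Mx R d -> R) -> (forall xi, D xi -> 0 <= f xi) ->
  (\int[mu]_(xi in D) (f xi)%:E < +oo)%E -> mu.-integrable D (EFin \o f).
Proof.
move=> mf f0 foo; apply/integrableP; split; first exact/measurable_EFinP.
apply: le_lt_trans foo; rewrite le_eqVlt; apply/orP; left; apply/eqP.
by apply: eq_integral => xi /set_mem Dxi /=; rewrite ger0_norm// f0.
Qed.

Lemma min_fnorm_ge0 x : 0 <= Num.min (fnorm x) 1.
Proof. by rewrite le_min fnorm_ge0 ler01. Qed.

Lemma min_fnorm_measurable : measurable_fun D (fun xi : Mx R d => Num.min (fnorm xi) 1).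
Proof.
apply: (@cont_measurable R d (fun xi => Num.min (fnorm xi) 1)).
  exact: measurable_psdset0.
by apply: cont_minr; [exact: cont_fnorm|exact: cont_cst].
Qed.

Lemma adm_iWm : m.-integrable D (EFin \o levy_weight (fun=> 1)).
Proof.
case: adm => _ [[_ h] _]; apply: integrable_of_ge0.
- by apply: measurable_funM; [exact: min_fnorm_measurable|exact: measurable_cst].
- by move=> xi _; rewrite /levy_weight mulr1 min_fnorm_ge0.
- by under eq_integral do rewrite /levy_weight mulr1.
Qed.

Lemma adm_iWnu : nu.-integrable D (EFin \o levy_weight (fun xi => \tr (H xi))).
Proof.
case: adm => _ [_ [[_ _ _ h] _]]; apply: integrable_of_ge0 => //.
- apply: measurable_funM; first exact: min_fnorm_measurable.
  by apply: measurable_sum => i; exact: adm_mH.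
- by move=> xi Dxi; rewrite mulr_ge0 ?min_fnorm_ge0 ?psd_tr_ge0//; exact: adm_H.
Qed.

Lemma mcst1 : measurable_fun D ((fun=> 1) : Mx R d -> R).
Proof. exact: measurable_cst. Qed.

Lemma cst1_le (xi : M) : D xi -> `|1 : R| <= 1. Proof. by rewrite normr1. Qed.

(** [mu_integral] is defined entry by entry; the bound by [Num.min (fnorm xi) 1] makes every entry
    integrable, so finite sums can be exchanged with the integral. *)
Lemma inner_levy (g : M -> R) K x : measurable_fun D (g : Mx R d -> R) ->
  (forall xi, D xi -> `|g xi| <= K * Num.min (fnorm xi) 1) ->
  nu.-integrable D (EFin \o fun xi => g xi * inner (H xi) x) /\
  inner (mu_integral nu H g) x = \int[nu]_(xi in D) (g xi * inner (H xi) x).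
Proof.
move=> mg gK; have mD := @measurable_psdset0 R d.
have i1 i j : nu.-integrable D (EFin \o fun xi => g xi * H xi i j).
  exact: (levy_integrable (@adm_mH i j) (@adm_Hle i j) adm_iWnu mg gK).
have i2 i j : nu.-integrable D (EFin \o fun xi => g xi * H xi i j * x j i).
  exact: (integrableZr mD (x j i) (i1 i j)).
have e : (fun xi => g xi * inner (H xi) x)
    = fun xi => \sum_i \sum_j g xi * H xi i j * x j i.
  apply/funext => xi; rewrite innerE mulr_sumr; apply: eq_bigr => i _.
  by rewrite mulr_sumr; apply: eq_bigr => j _; rewrite mulrA.
have [i3 e3] : (forall i, nu.-integrable D (EFin \o fun xi => \sum_j g xi * H xi i j * x j i))
    /\ (forall i, \int[nu]_(xi in D) (\sum_j g xi * H xi i j * x j i)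
         = \sum_j \int[nu]_(xi in D) (g xi * H xi i j * x j i)).
  by split=> i; have [] := @Rintegral_sum R d nu D _ (index_enum 'I_d)
    (fun j xi => g xi * H xi i j * x j i) mD (i2 i).
have [i4 e4] := @Rintegral_sum R d nu D _ (index_enum 'I_d)
    (fun i xi => \sum_j g xi * H xi i j * x j i) mD i3.
rewrite e; split=> //; rewrite e4 innerE; apply: eq_bigr => i _.
rewrite e3; apply: eq_bigr => j _; rewrite mxE RintegralZr//.
Qed.

Lemma sym_mu_integral g : sym (mu_integral nu H g).
Proof.
apply/matrixP => i j; rewrite !mxE; apply: eq_Rintegral => xi /set_mem Dxi.
by rewrite (symE j i (adm_H Dxi).1).
Qed.

Lemma inner_Sij x (i j : 'I_d) : sym x -> inner x (Sij R i j) = x i j.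
Proof.
move=> sx; rewrite /Sij innerZr innerDr.
have E k l : inner x (delta_mx k l) = x l k.
  rewrite innerE (bigD1 l)//= (bigD1 k)//= !mxE !eqxx mulr1.
  rewrite big1 ?addr0; last by move=> k' /negbTE kk; rewrite mxE kk mulr0.
  rewrite big1 ?addr0// => l' ll; rewrite big1// => k' _.
  by rewrite mxE (negbTE ll) andbF mulr0.
by rewrite !E (symE j i sx); field.
Qed.

Lemma sym_SijE x : sym x -> x = \sum_i \sum_j x i j *: Sij R i j.
Proof.
move=> sx; rewrite -[LHS](_ : 2^-1 *: (x + x^T) = x); last first.
  by apply/matrixP => i j; rewrite !mxE (symE j i sx); field.
rewrite {1}[x]matrix_sum_delta [X in _ + X](_ : _ = \sum_i \sum_j x i j *: delta_mx j i); last first.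
  rewrite {1}[x]matrix_sum_delta linear_sum; apply: eq_bigr => i _.
  by rewrite linear_sum; apply: eq_bigr => j _; rewrite linearZ /= trmx_delta.
rewrite -big_split scaler_sumr; apply: eq_bigr => i _ /=.
rewrite -big_split scaler_sumr; apply: eq_bigr => j _ /=.
by rewrite -scalerDr !scalerA mulrC.
Qed.

Lemma B0 : B 0 = 0.
Proof.
have := adm_BL 1 (sym0 R d) (sym0 R d); rewrite scaler0 add0r scale1r => /eqP.
by rewrite -subr_eq0 opprD addrA subrr sub0r oppr_eq0 => /eqP.
Qed.

Lemma B_sum (I : Type) (r : seq I) (a : I -> R) (F : I -> M) :
  (forall i, sym (F i)) -> sym (\sum_(i <- r) a i *: F i) /\
  B (\sum_(i <- r) a i *: F i) = \sum_(i <- r) a i *: B (F i).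
Proof.
move=> sF; elim: r => [|i r [IH1 IH2]]; first by rewrite !big_nil B0; split=> //; exact: sym0.
rewrite !big_cons; split; first by apply: symD => //; exact: symZ.
by rewrite adm_BL// IH2.
Qed.

(** [B] is linear only on symmetric matrices, so [x] is expanded in the symmetric matrices [Sij], on
    which [adjoint] realises the duality by definition. *)
Lemma adjointP u x : sym x -> inner (adjoint B u) x = inner u (B x).
Proof.
move=> sx; rewrite [in RHS](sym_SijE sx).
have hs i : sym (\sum_j x i j *: Sij R i j).
  by have [] := @B_sum _ (index_enum 'I_d) (x i) (Sij R i) (@sym_Sij R d i).
have [_ e] := @B_sum _ (index_enum 'I_d) (fun=> 1) (fun i => \sum_j x i j *: Sij R i j) hs.
have e' : B (\sum_i \sum_j x i j *: Sij R i j) = \sum_i \sum_j x i j *: B (Sij R i j).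
  transitivity (B (\sum_i 1 *: \sum_j x i j *: Sij R i j)).
    by congr B; apply: eq_bigr => i _; rewrite scale1r.
  rewrite e; apply: eq_bigr => i _; rewrite scale1r.
  by have [] := @B_sum _ (index_enum 'I_d) (x i) (Sij R i) (@sym_Sij R d i).
rewrite e' innerE /inner mulmx_sumr linear_sum; apply: eq_bigr => i _ /=.
rewrite mulmx_sumr linear_sum; apply: eq_bigr => j _ /=.
by rewrite -/(inner _ _) innerZr mxE (symE j i sx) mulrC.
Qed.

Lemma sym_adjoint u : sym (adjoint B u).
Proof.
apply/matrixP => i j; rewrite !mxE; congr (inner _ (B _)).
by rewrite /Sij addrC.
Qed.

End Admissible.

(** * The truncated Riccati field and its Lipschitz estimates *)

Section RiccatiField.
Variables (R : realType) (d : nat) (alpha b : 'M[R]_d) (B : 'M[R]_d -> 'M[R]_d).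
Variables (c : R) (gamma : 'M[R]_d) (m nu : {measure set (Mx R d) -> \bar R}).
Variable H : 'M[R]_d -> 'M[R]_d.
Hypothesis adm : admissible alpha b B c gamma m nu H.
Notation M := 'M[R]_d.
Notation D := (@psdset0 R d).
Implicit Types (A C x u : M) (e th rho : R).

Definition mu_levy e th A C : M := mu_integral nu H (trunc_exp e th A C).
Definition m_levy e th A C : R := levy_integral m (fun=> 1) e th A C.

(* Scaling factor of the radial retraction onto the ball of radius [rho]. *)
Definition retr rho A C : R := (Num.max 1 ((mxsum A + mxsum C) / rho))^-1.

(** [quad1] and [quad2] are the real and imaginary parts of [(A + i C) alpha (A + i C)]. *)
Definition quad1 A C : M := A *m alpha *m A - C *m alpha *m C.
Definition quad2 A C : M := A *m alpha *m C + C *m alpha *m A.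

(** The factor [retr ^+ 2] evaluates the quadratic term at the retracted point, as in [quad_retr],
    and leaves the linear terms alone. Phase 0 selects the real part of the jump exponential and
    [pi / 2] the imaginary part, since [cos (pi / 2 + z) = - sin z]. *)
Definition fieldR1 rho e A C : M :=
  (-2) *: (retr rho A C ^+ 2 *: quad1 A C) + adjoint B A + gamma - mu_levy e 0 A C.
Definition fieldR2 rho e A C : M :=
  (-2) *: (retr rho A C ^+ 2 *: quad2 A C) + adjoint B C - mu_levy e (pi / 2) A C.
Definition fieldF1 e A C : R := inner b A + c - m_levy e 0 A C.
Definition fieldF2 e A C : R := inner b C - m_levy e (pi / 2) A C.

Definition lip2 (f : M -> M -> R) : Prop := exists2 L, 0 <= L &
  forall A C A' C', `|f A C - f A' C'| <= L * (mxsum (A - A') + mxsum (C - C')).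

Definition mlip (f : M -> M -> M) : Prop := exists2 L, 0 <= L &
  forall A C A' C', mxsum (f A C - f A' C') <= L * (mxsum (A - A') + mxsum (C - C')).

Lemma dist_ge0 A C : 0 <= mxsum A + mxsum C.
Proof. by rewrite addr_ge0 ?mxsum_ge0. Qed.

Lemma mlip_lip2 f i j : mlip f -> lip2 (fun A C => f A C i j).
Proof.
move=> [L L0 h]; exists L => // A C A' C'; apply: le_trans (h _ _ _ _).
by have := entry_le_mxsum (f A C - f A' C') i j; rewrite !mxE.
Qed.

Lemma lip2_mlip (f : M -> M -> M) : (forall i j, lip2 (fun A C => f A C i j)) -> mlip f.
Proof.
move=> h; have /choice[L hL] : forall ij : 'I_d * 'I_d, exists L, 0 <= L /\
    forall A C A' C', `|f A C ij.1 ij.2 - f A' C' ij.1 ij.2|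
      <= L * (mxsum (A - A') + mxsum (C - C')).
  by move=> [i j]; have [L L0 hL] := h i j; exists L.
exists (\sum_i \sum_j L (i, j)).
  by apply: sumr_ge0 => i _; apply: sumr_ge0 => j _; case: (hL (i, j)).
move=> A C A' C'; rewrite /mxsum mulr_suml; apply: ler_sum => i _.
rewrite mulr_suml; apply: ler_sum => j _; rewrite !mxE.
by case: (hL (i, j)) => _; exact.
Qed.

Lemma lip2_cst (k : R) : lip2 (fun _ _ => k).
Proof. by exists 0 => // A C A' C'; rewrite subrr normr0 mul0r. Qed.

Lemma lip2D f g : lip2 f -> lip2 g -> lip2 (fun A C => f A C + g A C).
Proof.
move=> [L L0 hf] [K K0 hg]; exists (L + K); first exact: addr_ge0.
move=> A C A' C'; rewrite mulrDl opprD addrACA.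
by rewrite (le_trans (ler_normD _ _))// lerD.
Qed.

Lemma lip2Z a f : lip2 f -> lip2 (fun A C => a * f A C).
Proof.
move=> [L L0 hf]; exists (`|a| * L); first exact: mulr_ge0.
by move=> A C A' C'; rewrite -mulrBr normrM -mulrA ler_wpM2l.
Qed.

Lemma lip2N f : lip2 f -> lip2 (fun A C => - f A C).
Proof.
move=> /(lip2Z (-1)) [L L0 h]; exists L => // A C A' C'.
by have := h A C A' C'; rewrite !mulN1r.
Qed.

Lemma inner_le_mxsum x u : `|inner x u| <= mxsum x * mxsum u.
Proof.
rewrite innerE (le_trans (ler_norm_sum _ _ _))// /mxsum mulr_suml.
apply: ler_sum => i _; rewrite (le_trans (ler_norm_sum _ _ _))// mulr_suml.
apply: ler_sum => j _; rewrite normrM ler_wpM2l//.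
exact: entry_le_mxsum.
Qed.

Lemma lip2_innerl x : lip2 (fun A C => inner A x).
Proof.
exists (mxsum x); first exact: mxsum_ge0.
move=> A C A' C'; rewrite -innerBl (le_trans (inner_le_mxsum _ _))// mulrC.
by rewrite ler_wpM2l ?mxsum_ge0// lerDl mxsum_ge0.
Qed.

Lemma lip2_swap f : lip2 f -> lip2 (fun A C => f C A).
Proof.
move=> [L L0 h]; exists L => // A C A' C'.
by rewrite [X in _ * X]addrC; exact: h.
Qed.

Lemma mlipD f g : mlip f -> mlip g -> mlip (fun A C => f A C + g A C).
Proof.
move=> hf hg; apply: lip2_mlip => i j.
under [X in lip2 X]eq_fun do under eq_fun do rewrite mxE.
by apply: lip2D; exact: mlip_lip2.
Qed.

Lemma mlipZ a f : mlip f -> mlip (fun A C => a *: f A C).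
Proof.
move=> hf; apply: lip2_mlip => i j.
under [X in lip2 X]eq_fun do under eq_fun do rewrite mxE.
by apply: lip2Z; exact: mlip_lip2.
Qed.

Lemma mlipN f : mlip f -> mlip (fun A C => - f A C).
Proof.
move=> hf; apply: lip2_mlip => i j.
under [X in lip2 X]eq_fun do under eq_fun do rewrite mxE.
by apply: lip2N; exact: mlip_lip2.
Qed.

Lemma mlip_cst x : mlip (fun _ _ => x).
Proof. by apply: lip2_mlip => i j; exact: lip2_cst. Qed.

Lemma mxsumM x y : mxsum (x *m y) <= mxsum x * mxsum y.
Proof.
rewrite /mxsum mulr_suml; apply: ler_sum => i _.
apply: (@le_trans _ _ (\sum_k \sum_j `|x i j| * `|y j k|)).
  apply: ler_sum => k _; rewrite mxE (le_trans (ler_norm_sum _ _ _))//.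
  by apply: ler_sum => j _; rewrite normrM.
rewrite exchange_big /= mulr_suml; apply: ler_sum => j _.
rewrite -mulr_sumr ler_wpM2l// [leRHS](bigD1 j)//= lerDl.
by apply: sumr_ge0 => k _; apply: sumr_ge0.
Qed.

Lemma mlipM f g K : mlip f -> mlip g -> (forall A C, mxsum (f A C) <= K) ->
  (forall A C, mxsum (g A C) <= K) -> mlip (fun A C => f A C *m g A C).
Proof.
move=> [L L0 hf] [L' L0' hg] bf bg.
have K0 : 0 <= K by apply: le_trans (bf 0 0); exact: mxsum_ge0.
exists (L * K + K * L'); first by rewrite addr_ge0// mulr_ge0.
move=> A C A' C'.
have -> : f A C *m g A C - f A' C' *m g A' C'
  = (f A C - f A' C') *m g A C + f A' C' *m (g A C - g A' C').
  by rewrite mulmxBl mulmxBr addrA subrK.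
apply: le_trans (mxsumD _ _) _; rewrite mulrDl; apply: lerD.
  apply: le_trans (mxsumM _ _) _; rewrite mulrAC.
  by apply: ler_pM; rewrite ?mxsum_ge0.
apply: le_trans (mxsumM _ _) _; rewrite -mulrA.
by apply: ler_pM; rewrite ?mxsum_ge0.
Qed.

Lemma retr_ge0 rho A C : 0 <= retr rho A C.
Proof. by rewrite invr_ge0 le_max ler01. Qed.

Lemma retr_le1 rho A C : retr rho A C <= 1.
Proof. by rewrite invf_le1 ?lt_max ?ltr01// le_max lexx. Qed.

Lemma retr_eq1 rho A C : 0 < rho -> mxsum A + mxsum C <= rho -> retr rho A C = 1.
Proof. by move=> r0 h; rewrite /retr max_l ?invr1// ler_pdivrMr// mul1r. Qed.

Lemma retr_bound rho A C : 0 < rho -> retr rho A C * (mxsum A + mxsum C) <= rho.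
Proof.
move=> r0; rewrite /retr mulrC ler_pdivrMr ?lt_max ?ltr01//.
by rewrite mulrC -ler_pdivrMr// le_max lexx orbT.
Qed.

(** The variation of the factor is multiplied by the size of the point it will scale. As
    [N' <= rho * y], this size cancels the [1 / rho] in the variation of [x] and [y], so the
    retraction gets a constant independent of [rho]. *)
Lemma retr_lip rho A C A' C' : 0 < rho ->
  `|retr rho A C - retr rho A' C'| * (mxsum A' + mxsum C')
    <= mxsum (A - A') + mxsum (C - C').
Proof.
move=> r0; rewrite /retr; set N := mxsum A + mxsum C; set N' := mxsum A' + mxsum C'.
set x := Num.max 1 (N / rho); set y := Num.max 1 (N' / rho).
have N0 : 0 <= N by exact: dist_ge0.
have N0' : 0 <= N' by exact: dist_ge0.
have x1 : 1 <= x by rewrite le_max lexx.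
have y1 : 1 <= y by rewrite le_max lexx.
have x0 : 0 < x by exact: lt_le_trans ltr01 x1.
have y0 : 0 < y by exact: lt_le_trans ltr01 y1.
set dd := mxsum (A - A') + mxsum (C - C').
have NN : `|N - N'| <= dd.
  have hA := mxsumD (A - A') A'; rewrite subrK in hA.
  have hC := mxsumD (C - C') C'; rewrite subrK in hC.
  have hA' := mxsumD (A' - A) A; rewrite subrK -(opprB A) mxsumN in hA'.
  have hC' := mxsumD (C' - C) C; rewrite subrK -(opprB C) mxsumN in hC'.
  by rewrite ler_norml /N /N' /dd; apply/andP; split; lra.
have xy : `|x - y| <= dd / rho.
  apply: (@le_trans _ _ (`|N - N'| / rho)); last by rewrite ler_pM2r ?invr_gt0.
  have -> : `|N - N'| / rho = `|N / rho - N' / rho|.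
    by rewrite -mulrBl normrM (ger0_norm (_ : 0 <= rho^-1))// invr_ge0 ltW.
  rewrite /x /y; have [a1|a1] := leP 1 (N / rho); have [a2|a2] := leP 1 (N' / rho);
    rewrite ?subrr ?normr0 ?normr_ge0// ?ler_norml; apply/andP; split;
    have := ler_norm (N / rho - N' / rho);
    have := ler_norm (- (N / rho - N' / rho)); rewrite normrN; lra.
have Ny : N' <= rho * y by rewrite mulrC -ler_pdivrMr// le_max lexx orbT.
have -> : x^-1 - y^-1 = - (x - y) / (x * y) by field; rewrite !gt_eqF.
have xy0 : 0 < x * y by rewrite mulr_gt0.
rewrite normrM normrN (gtr0_norm (_ : 0 < (x * y)^-1)) ?invr_gt0//.
rewrite mulrAC ler_pdivrMr//.
apply: (@le_trans _ _ (dd / rho * (rho * y))).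
  by apply: ler_pM.
have -> : dd / rho * (rho * y) = dd * y by field; rewrite gt_eqF.
by apply: ler_wpM2l; [exact: dist_ge0|rewrite ler_peMl// ltW].
Qed.

Lemma mlip_retr rho : 0 < rho -> mlip (fun A C => retr rho A C *: A).
Proof.
move=> r0; exists 2 => // A C A' C'.
have -> : retr rho A C *: A - retr rho A' C' *: A'
  = retr rho A C *: (A - A') + (retr rho A C - retr rho A' C') *: A'.
  by rewrite scalerBr scalerBl addrA subrK.
apply: le_trans (mxsumD _ _) _; rewrite !mxsumZ mulr_natl mulr2n.
apply: lerD.
  rewrite ger0_norm ?retr_ge0// (le_trans (ler_piMl _ (retr_le1 _ _ _)))//.
    exact: mxsum_ge0.
  by rewrite lerDl mxsum_ge0.
apply: le_trans (retr_lip A C A' C' r0).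
by rewrite ler_wpM2l// lerDl mxsum_ge0.
Qed.

Lemma retrC rho A C : retr rho A C = retr rho C A.
Proof. by rewrite /retr addrC. Qed.

Lemma mlip_swap f : mlip f -> mlip (fun A C => f C A).
Proof.
move=> h; apply: lip2_mlip => i j.
exact: (@lip2_swap (fun A C => f A C i j) (mlip_lip2 i j h)).
Qed.

Lemma mlip_retr2 rho : 0 < rho -> mlip (fun A C => retr rho A C *: C).
Proof.
move=> /mlip_retr/mlip_swap [L L0 h]; exists L => // A C A' C'.
by have := h A C A' C'; rewrite !(retrC rho C) !(retrC rho C').
Qed.

(** A quadratic map is Lipschitz only on bounded sets; [f] and [g] stand for the retracted
    arguments, and [K] is one bound for all partial products. *)
Lemma mlip_quad rho (f g : M -> M -> M) : 0 < rho -> mlip f -> mlip g ->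
  (forall A C, mxsum (f A C) <= rho) -> (forall A C, mxsum (g A C) <= rho) ->
  mlip (fun A C => f A C *m alpha *m g A C).
Proof.
move=> r0 hf hg bf bg; have a0 := mxsum_ge0 alpha.
pose K := rho + mxsum alpha + rho * mxsum alpha.
have K1 : rho <= K by rewrite /K -addrA lerDl addr_ge0// mulr_ge0// ltW.
have K2 : mxsum alpha <= K by rewrite /K addrAC lerDr addr_ge0 ?mulr_ge0// ltW.
have K3 : rho * mxsum alpha <= K by rewrite /K lerDr addr_ge0// ltW.
apply: (@mlipM _ _ K) => //.
- apply: (@mlipM _ _ K) => //; first exact: mlip_cst.
  by move=> A C; exact: le_trans (bf _ _) K1.
- move=> A C; apply: le_trans (mxsumM _ _) _; apply: le_trans K3.
  by rewrite ler_wpM2r.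
- by move=> A C; exact: le_trans (bg _ _) K1.
Qed.

Lemma quad_retr s (A C : M) :
  s ^+ 2 *: (A *m alpha *m C) = (s *: A) *m alpha *m (s *: C).
Proof. by rewrite -scalemxAr -!scalemxAl scalerA expr2. Qed.

Lemma retr_A rho A C : 0 < rho -> mxsum (retr rho A C *: A) <= rho.
Proof.
move=> r0; rewrite mxsumZ ger0_norm ?retr_ge0//; apply: le_trans (retr_bound A C r0).
by rewrite ler_wpM2l ?retr_ge0// lerDl mxsum_ge0.
Qed.

Lemma retr_C rho A C : 0 < rho -> mxsum (retr rho A C *: C) <= rho.
Proof. by move=> r0; rewrite retrC retr_A. Qed.

Lemma mlip_quad1 rho : 0 < rho ->
  mlip (fun A C => retr rho A C ^+ 2 *: quad1 A C).
Proof.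
move=> r0; rewrite (_ : (fun _ => _) = fun A C =>
    (retr rho A C *: A) *m alpha *m (retr rho A C *: A)
    + - ((retr rho A C *: C) *m alpha *m (retr rho A C *: C))).
  apply: mlipD; last apply: mlipN; apply: (mlip_quad r0).
  - exact: mlip_retr.
  - exact: mlip_retr.
  - by move=> *; exact: retr_A.
  - by move=> *; exact: retr_A.
  - exact: mlip_retr2.
  - exact: mlip_retr2.
  - by move=> *; exact: retr_C.
  - by move=> *; exact: retr_C.
by apply/funext => A; apply/funext => C; rewrite /quad1 scalerBr !quad_retr.
Qed.

Lemma mlip_quad2 rho : 0 < rho ->
  mlip (fun A C => retr rho A C ^+ 2 *: quad2 A C).
Proof.
move=> r0; rewrite (_ : (fun _ => _) = fun A C =>
    (retr rho A C *: A) *m alpha *m (retr rho A C *: C)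
    + (retr rho A C *: C) *m alpha *m (retr rho A C *: A)).
  apply: mlipD; apply: (mlip_quad r0).
  - exact: mlip_retr.
  - exact: mlip_retr2.
  - by move=> *; exact: retr_A.
  - by move=> *; exact: retr_C.
  - exact: mlip_retr2.
  - exact: mlip_retr.
  - by move=> *; exact: retr_C.
  - by move=> *; exact: retr_A.
by apply/funext => A; apply/funext => C; rewrite /quad2 scalerDr !quad_retr.
Qed.

Lemma mlip_adjoint : mlip (fun A _ => adjoint B A).
Proof.
apply: lip2_mlip => i j; under [X in lip2 X]eq_fun do under eq_fun do rewrite mxE.
exact: lip2_innerl.
Qed.

Lemma lip2_m_levy e th : 0 < e <= 1 -> lip2 (m_levy e th).
Proof.
move=> e01; exists (e^-1 * levy_mass m (fun=> 1)).
  rewrite mulr_ge0 ?(levy_mass_ge0 _ (@cst1_le R d))// invr_ge0.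
  by case/andP: e01 => /ltW.
move=> A C A' C'; rewrite mulrAC.
exact: (@levy_integral_lipschitz R d m (fun=> 1) (fun=> 1) (@mcst1 R d)
  (@cst1_le R d) (adm_iWm adm)).
Qed.

Lemma mlip_mu_levy e th : 0 < e <= 1 -> mlip (mu_levy e th).
Proof.
move=> e01; apply: lip2_mlip => i j.
under [X in lip2 X]eq_fun do under eq_fun do rewrite mxE.
exists (e^-1 * levy_mass nu (fun xi => \tr (H xi))).
  rewrite mulr_ge0 ?(levy_mass_ge0 _ (adm_Hle adm i j))// invr_ge0.
  by case/andP: e01 => /ltW.
move=> A C A' C'; rewrite mulrAC.
apply: (levy_integral_lipschitz (h := fun xi => H xi i j)
  (hb := fun xi => \tr (H xi))) => //.
- exact: adm_mH adm i j.
- exact: adm_Hle adm i j.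
- exact: adm_iWnu adm.
Qed.

Lemma mlip_fieldR1 rho e : 0 < rho -> 0 < e <= 1 -> mlip (fieldR1 rho e).
Proof.
move=> r0 e01; apply: mlipD; last by apply: mlipN; exact: mlip_mu_levy.
apply: mlipD; last exact: mlip_cst.
by apply: mlipD; [apply: mlipZ; exact: mlip_quad1|exact: mlip_adjoint].
Qed.

Lemma mlip_fieldR2 rho e : 0 < rho -> 0 < e <= 1 -> mlip (fieldR2 rho e).
Proof.
move=> r0 e01; apply: mlipD; last by apply: mlipN; exact: mlip_mu_levy.
by apply: mlipD; [apply: mlipZ; exact: mlip_quad2|apply: mlip_swap; exact: mlip_adjoint].
Qed.

Lemma lip2_fieldF1 e : 0 < e <= 1 -> lip2 (fieldF1 e).
Proof.
move=> e01; apply: lip2D; last by apply: lip2N; exact: lip2_m_levy.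
apply: lip2D; last exact: lip2_cst.
under [X in lip2 X]eq_fun do under eq_fun do rewrite innerC.
exact: lip2_innerl.
Qed.

Lemma lip2_fieldF2 e : 0 < e <= 1 -> lip2 (fieldF2 e).
Proof.
move=> e01; apply: lip2D; last by apply: lip2N; exact: lip2_m_levy.
under [X in lip2 X]eq_fun do under eq_fun do rewrite innerC.
exact: lip2_swap (lip2_innerl _).
Qed.

Lemma sym_fieldR1 rho e A C : sym A -> sym C -> sym (fieldR1 rho e A C).
Proof.
move=> sA sC; have sa := (adm_alpha adm).1.
apply: symD; last by apply: symN; exact: sym_mu_integral adm _.
apply: symD; last exact: (adm_gamma adm).1.
apply: symD; last exact: sym_adjoint.
apply: symZ; apply: symZ; apply: symB;
  by rewrite /sym !trmx_mul ?sA ?sC sa mulmxA.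
Qed.

Lemma sym_fieldR2 rho e A C : sym A -> sym C -> sym (fieldR2 rho e A C).
Proof.
move=> sA sC; have sa := (adm_alpha adm).1.
apply: symD; last by apply: symN; exact: sym_mu_integral adm _.
apply: symD; last exact: sym_adjoint.
apply: symZ; apply: symZ.
by rewrite /sym linearD /= !trmx_mul sA sC sa !mulmxA addrC.
Qed.

End RiccatiField.

(** * Matrix-valued paths and invariance of the open cone *)

Section MatrixPaths.
Variables (R : realType) (d : nat).
Notation M := 'M[R]_d.
Implicit Types (X Y : R -> M) (x y g : M) (t : R).

(** Entrywise notions, so that arguments on paths reduce to scalar calculus; the normed structure on
    matrices is met when translating to and from [riccati_solution]. *)
Definition mcont X : Prop := forall i j, continuous (fun t => X t i j).
Definition mder t X x : Prop := forall i j, is_derive t 1 (fun s => X s i j) (x i j).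

Lemma mder_inner t X Y x y : mder t X x -> mder t Y y ->
  is_derive t 1 (fun s => inner (X s) (Y s)) (inner x (Y t) + inner (X t) y).
Proof.
move=> dX dY.
have h : is_derive t 1 (fun s => \sum_i \sum_j X s i j * Y s j i)
    (\sum_i \sum_j (x i j * Y t j i + X t i j * y j i)).
  by apply: der_sum => i; apply: der_sum => j; apply: derM.
apply: is_derive_val (is_derive_ext _ h) => [|s]; last by rewrite innerE.
rewrite !innerE -big_split; apply: eq_bigr => i _.
by rewrite -big_split.
Qed.

Lemma mder_cst t x : mder t (fun=> x) 0.
Proof. by move=> i j; rewrite mxE; exact: der_cst. Qed.

Lemma mder_innerr t X x y : mder t X x ->
  is_derive t 1 (fun s => inner (X s) y) (inner x y).
Proof.
by move=> dX; have := mder_inner dX (mder_cst t y); rewrite inner0r addr0.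
Qed.

Lemma mder_mulr t X x y : mder t X x -> mder t (fun s => X s *m y) (x *m y).
Proof.
move=> dX i j.
have h : is_derive t 1 (fun s => \sum_k y k j * X s i k) (\sum_k y k j * x i k).
  by apply: der_sum => k; apply: derZ.
apply: is_derive_val (is_derive_ext _ h) => [|s]; rewrite mxE;
  by apply: eq_bigr => k _; rewrite mulrC.
Qed.

Lemma mcont_mxsum X x : mcont X -> continuous (fun t => mxsum (X t - x)).
Proof.
move=> cX; apply: cont_sum => i; apply: cont_sum => j.
rewrite (_ : (fun _ => _) = fun t => `|X t i j - x i j|).
  by apply: cont_norm; apply: contB => //; exact: cont_cst.
by apply/funext => t; rewrite !mxE.
Qed.

Lemma mcont_innerr X x : mcont X -> continuous (fun t => inner (X t) x).
Proof.
move=> cX; rewrite (_ : (fun _ => _) = fun t => \sum_i \sum_j X t i j * x j i).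
  apply: cont_sum => i; apply: cont_sum => j.
  by apply: contM => //; exact: cont_cst.
by apply/funext => t; rewrite innerE.
Qed.

Lemma qf_scale x (v : 'cV[R]_d) (k : R) : qf x (k *: v) = k ^+ 2 * qf x v.
Proof.
rewrite !qfE mulr_sumr; apply: eq_bigr => i _; rewrite mulr_sumr.
by apply: eq_bigr => j _; rewrite !mxE; ring.
Qed.

(** At [v] the form of [x] is at least [- mxsum x] times the squared length of [v]. *)
Lemma psd_perturb x l : sym x -> mxsum x <= l -> psd (x + l%:M).
Proof.
move=> sx xl; apply: psdI => [|v]; first by apply: symD => //; exact: sym_scalar.
rewrite qfD qf_scalar -tr_colmul -inner_col.
have := inner_le_tr x (psd_colmul v); rewrite ler_norml => /andP[h _].
have := psd_tr_ge0 (psd_colmul v); set tt := \tr _ in h * => t0.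
have : mxsum x * tt <= l * tt by rewrite ler_wpM2r.
lra.
Qed.

(** Half of the margin of [X t] absorbs the variation of the path; the other half remains, uniformly
    near [t]. *)
Lemma near_pd X t : mcont X -> (forall s, sym (X s)) -> pd (X t) ->
  exists2 l, 0 < l & \forall s \near t, psd (X s - l%:M).
Proof.
move=> cX sX /pdP[l l0 pl]; exists (l / 2); first by rewrite divr_gt0.
have h := @mcont_mxsum X (X t) cX t.
near=> s.
have -> : X s - (l / 2)%:M = (X t - l%:M) + ((X s - X t) + (l / 2)%:M).
  apply/matrixP => i j; rewrite !mxE; case: (i == j);
    rewrite ?mulr1n ?mulr0n; lra.
apply: psdD => //; apply: psd_perturb; first exact: symB.
near: s; have l2 : mxsum (X t - X t) < l / 2.
  rewrite subrr /mxsum big1 ?divr_gt0// => i _; rewrite big1// => j _.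
  by rewrite mxE normr0.
by apply: filterS (cvgr_lt _ h _ l2) => s /ltW.
Unshelve. all: by end_near. Qed.

Lemma der_gt0_left (q : R -> R) t a : is_derive t 1 q a -> 0 < a ->
  \forall s \near t, s < t -> q s < q t.
Proof.
move=> [/cvg_ex[/= l ql] qa] a0.
have la : l = a by rewrite -qa; exact/esym/cvg_lim.
rewrite la in ql.
have [e /= e0 he] := cvgr_gt _ ql _ a0.
exists e => //= s ts st.
have := he (s - t); rewrite /ball_/= sub0r normrN -normrN opprB.
move=> /(_ ts); rewrite subr_eq0 lt_eqF// => /(_ isT).
rewrite /GRing.scale /= mulr1 subrK => h.
have st0 : (s - t)^-1 < 0 by rewrite invr_lt0 subr_lt0.
by move: h; rewrite nmulr_rgt0// subr_lt0.
Qed.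

(* A positive definite matrix path can only leave the cone through a null
   direction along which its quadratic form is decreasing. *)
Lemma pd_path X : mcont X -> (forall s, sym (X s)) -> pd (X 0) ->
  (forall t v, 0 < t -> psd (X t) -> v != 0 -> qf (X t) v = 0 ->
     exists2 a, 0 < a & is_derive t 1 (fun s => qf (X s) v) a) ->
  forall t, 0 <= t -> pd (X t).
Proof.
move=> cX sX pX0 hX t0 t00; apply: contrapT => nX0.
pose S := [set t | 0 <= t /\ ~ pd (X t)].
have hS : has_inf S by split; [exists t0|exists 0 => s []].
(* The first exit time. Openness of the cone excludes [pd (X t)], in particular [t = 0]; closedness
   gives [psd (X t)], hence a null direction, and the positive derivative along it makes the form
   negative just before [t]. *)
pose t := inf S.
have tS s : S s -> t <= s by move=> Ss; apply: ge_inf => //; exact: hS.2.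
have t_ge0 : 0 <= t by apply: lb_le_inf => [|s []]//; exact: hS.1.
have below s : 0 <= s -> s < t -> pd (X s).
  by move=> s0 st; apply: contrapT => ns; have := tS s (conj s0 ns); rewrite leNgt st.
have nXt : ~ pd (X t).
  move=> /(near_pd cX sX)[l l0 [e /= e0 he]].
  have [s Ss st] := inf_adherent e0 hS.
  have := tS s Ss => ts; case: Ss => _; apply; apply/pdP; exists l => //.
  by apply: he; rewrite /ball_ /= distrC ger0_norm ?subr_ge0// ltrBlDl.
have tpos : 0 < t.
  by rewrite lt_def t_ge0 andbT; apply/eqP => t0E; apply: nXt; rewrite t0E.
have cq v : continuous (fun s => qf (X s) v).
  rewrite (_ : (fun _ => _) = fun s => inner (X s) (v *m v^T)).
    exact: mcont_innerr.
  by apply/funext => s; rewrite inner_col.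
have left_close (P : R -> Prop) : (\forall s \near t, P s) ->
    exists s, [/\ 0 <= s, s < t & P s].
  move=> [e /= e0 he]; pose h := Num.min (e / 2) t.
  have h0 : 0 < h by rewrite lt_min tpos divr_gt0.
  have ht : h <= t by rewrite /h ge_min lexx orbT.
  exists (t - h); split; first by rewrite subr_ge0.
    by rewrite ltrBlDr ltrDl.
  apply: he; rewrite /ball_/= opprB addrC subrK gtr0_norm//.
  rewrite /h gt_min; apply/orP; left.
  by rewrite ltr_pdivrMr// mulr_natr mulr2n ltrDl.
have pXt : psd (X t).
  apply: psdI => // v; rewrite leNgt; apply/negP => q0.
  have [s [s0 st sq]] := left_close _ (cvgr_lt _ (cq v t) _ q0).
  by have := psd_qf v (pd_psd (below s s0 st)); rewrite leNgt sq.
have [v v0 qv] : exists2 v, v != 0 & qf (X t) v = 0.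
  apply: contrapT => hv; apply: nXt; split=> // v v0.
  rewrite -[X in 0 < X]/(qf (X t) v) lt_def psd_qf// andbT.
  by apply/eqP => q0; apply: hv; exists v.
have [a a0 da] := hX t v tpos pXt v0 qv.
have [s [s0 st sq]] := left_close _ (der_gt0_left da a0).
by have := pd_qf (below s s0 st) v0; rewrite ltNge -qv ltW// sq.
Qed.

Lemma psd_congr x (g : M) : psd x -> psd (g^T *m x *m g).
Proof.
move=> px; apply: psdI => [|v].
  by rewrite /sym !trmx_mul trmxK px.1 mulmxA.
by rewrite /qf !mulmxA -trmx_mul -!mulmxA mulmxA -/(qf _ _) psd_qf.
Qed.

Lemma gronwall (z z' : R -> R) K : continuous z ->
  (forall t, 0 < t -> is_derive t 1 z (z' t)) ->
  (forall t, 0 < t -> z' t <= K * z t) ->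
  forall t, 0 <= t -> z t <= z 0 * expR (K * t).
Proof.
move=> cz dz hz t t0.
pose w s := - (expR (- K * s) * z s).
pose w' s := - (expR (- K * s) * (- K) * z s + expR (- K * s) * z' s).
have cw : continuous w by apply: contN; apply: contM cz; exact: cont_expRM.
have dw s : 0 < s < t -> is_derive s 1 w (w' s).
  by move=> /andP[s0 _]; exact: derN (derM (der_expRM _ _) (dz s s0)).
have w'0 s : 0 < s < t -> 0 <= w' s.
  move=> /andP[s0 _]; have -> : w' s = expR (- K * s) * (K * z s - z' s).
    by rewrite /w'; ring.
  by rewrite mulr_ge0 ?expR_ge0// subr_ge0 hz.
have := cont_deriv_ge0 cw dw w'0 (lexx 0) t0 (lexx t).
rewrite /w lerN2 mulr0 expR0 mul1r mulNr expRN => h.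
by rewrite -ler_pdivrMr ?expR_gt0// mulrC.
Qed.

Lemma mxsum_le x (k : R) : (forall i j, `|x i j| <= k) -> mxsum x <= (d * d)%:R * k.
Proof.
move=> h; apply: (@le_trans _ _ (\sum_(i < d) \sum_(j < d) k)).
  by apply: ler_sum => i _; apply: ler_sum => j _.
under eq_bigr do rewrite sumr_const card_ord -mulr_natl.
by rewrite sumr_const card_ord -[leLHS]mulr_natl natrM mulrA.
Qed.

Lemma sqr_mxsum_le x : sym x -> mxsum x ^+ 2 <= (d * d)%:R ^+ 2 * inner x x.
Proof.
move=> sx; have n0 : 0 <= inner x x.
  by rewrite innerE; apply: sumr_ge0 => i _; apply: sumr_ge0 => j _;
    rewrite (symE j i sx) -expr2 sqr_ge0.
rewrite -[X in _ * X](sqr_sqrtr n0) -exprMn.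
rewrite ler_pXn2r ?nnegrE ?mxsum_ge0 ?mulr_ge0 ?sqrtr_ge0//.
by apply: mxsum_le => i j; exact: entry_le_fnorm.
Qed.

(** Coercivity is used twice: [<a, x a x> >= l * \tr (x a x)], and
    [\tr (x a x) = <a, x x> >= l * \tr (x x)]. This is how the energy controls the solution. *)
Lemma inner_sandwich_ge (a x : M) l : 0 <= l -> psd a -> psd (a - l%:M) -> sym x ->
  l ^+ 2 * inner x x <= inner (x *m a) (x *m a).
Proof.
move=> l0 pa pal sx.
have p1 : psd (x *m a *m x) by have := psd_congr x pa; rewrite sx.
have p2 : psd (x *m x).
  by have := psd_congr x (psd_scalar d (@ler01 R)); rewrite sx mulmx1.
have h1 := inner_coercive pal p1; have h2 := inner_coercive pal p2.
have e1 : inner (x *m a) (x *m a) = inner a (x *m a *m x).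
  by rewrite /inner mulmxA mxtrace_mulC.
have e2 : \tr (x *m a *m x) = inner a (x *m x).
  by rewrite /inner mulmxA mxtrace_mulC mulmxA mxtrace_mulC -mulmxA.
rewrite e1; apply: le_trans h1; rewrite e2 expr2 -mulrA ler_wpM2l//.
Qed.

End MatrixPaths.

(** * Solutions of the truncated equations: existence, positivity, energy *)

Section TruncatedSolutions.
Variables (R : realType) (d : nat) (alpha b : 'M[R]_d) (B : 'M[R]_d -> 'M[R]_d).
Variables (c : R) (gamma : 'M[R]_d) (m nu : {measure set (Mx R d) -> \bar R}).
Variable H : 'M[R]_d -> 'M[R]_d.
Hypothesis adm : admissible alpha b B c gamma m nu H.
Notation M := 'M[R]_d.
Notation D := (@psdset0 R d).
Notation fR1 := (fieldR1 alpha B gamma nu H).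
Notation fR2 := (fieldR2 alpha B nu H).
Notation fF1 := (fieldF1 b c m).
Notation fF2 := (fieldF2 b m).
Implicit Types (A C : R -> M) (f g : R -> R) (u : M) (e rho T : R).

Definition path_init u1 u2 f1 f2 A C : Prop :=
  [/\ f1 0 = 0, f2 0 = 0, A 0 = u1 & C 0 = u2] /\
  [/\ continuous f1, continuous f2, mcont A & mcont C] /\
  forall t, sym (A t) /\ sym (C t).

Definition solves (F1 F2 : M -> M -> R) (R1 R2 : M -> M -> M) T f1 f2 A C : Prop :=
  forall t : R, 0 < t < T ->
  [/\ is_derive t 1 f1 (F1 (A t) (C t)), is_derive t 1 f2 (F2 (A t) (C t)),
      mder t A (R1 (A t) (C t)) & mder t C (R2 (A t) (C t))].

Definition trunc_solves rho e T f1 f2 A C : Prop :=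
  solves (fF1 e) (fF2 e) (fR1 rho e) (fR2 rho e) T f1 f2 A C.

(** Coordinates of the scalar system: [inl] for the two components of [phi], [inr] for the matrix
    entries of those of [psi]; [false] marks the real part and [true] the imaginary part. *)
Definition idx : finType := (bool + bool * ('I_d * 'I_d))%type.

Definition pack f1 f2 A C (t : R) (i : idx) : R :=
  match i with
  | inl false => f1 t | inl true => f2 t
  | inr (false, (i, j)) => A t i j | inr (true, (i, j)) => C t i j
  end.

(** Symmetrisation lets the field be defined on all coordinate vectors while only symmetric matrices
    are fed into it; solutions read back through [unpack] are then symmetric at all times. *)
Definition unpack (k : bool) (y : idx -> R) : M :=
  2^-1 *: ((\matrix_(i, j) y (inr (k, (i, j)))) + (\matrix_(i, j) y (inr (k, (i, j))))^T).

Lemma sym_unpack k y : sym (unpack k y).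
Proof. by apply: symZ; rewrite /sym linearD /= trmxK addrC. Qed.

Lemma unpackB k y z : unpack k y - unpack k z = unpack k (fun i => y i - z i).
Proof. by apply/matrixP => i j; rewrite !mxE; ring. Qed.

Lemma unpack_sym k (y : idx -> R) (x : M) : sym x ->
  (forall i j, y (inr (k, (i, j))) = x i j) -> unpack k y = x.
Proof.
move=> sx h; apply/matrixP => i j; rewrite !mxE !h (symE j i sx).
by field.
Qed.

Lemma mxsum_unpack k y : mxsum (unpack k y) <= \sum_i \sum_j `|y (inr (k, (i, j)))|.
Proof.
rewrite /unpack mxsumZ ger0_norm ?invr_ge0//; set x := \matrix_(_, _) _.
have -> : \sum_i \sum_j `|y (inr (k, (i, j)))| = mxsum x.
  by apply: eq_bigr => i _; apply: eq_bigr => j _; rewrite mxE.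
have -> : mxsum x = 2^-1 * (mxsum x + mxsum x) by field.
rewrite ler_pM2l ?invr_gt0//; apply: le_trans (mxsumD _ _) _.
rewrite lerD2l le_eqVlt; apply/orP; left; apply/eqP.
rewrite /mxsum exchange_big; apply: eq_bigr => i _; apply: eq_bigr => j _.
by rewrite mxE.
Qed.

Lemma sum_pair (I J : finType) (F : I * J -> R) :
  \sum_p F p = \sum_i \sum_j F (i, j).
Proof. by rewrite pair_bigA; apply: eq_bigr => -[]. Qed.

Lemma unpack_dist y z :
  mxsum (unpack false y - unpack false z) + mxsum (unpack true y - unpack true z)
    <= \sum_i `|y i - z i|.
Proof.
rewrite !unpackB big_sumType /=.
apply: (@le_trans _ _ (\sum_(i : bool * ('I_d * 'I_d)) `|y (inr i) - z (inr i)|)).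
  rewrite sum_pair big_bool addrC !sum_pair.
  by apply: lerD; exact: mxsum_unpack.
by rewrite lerDr; apply: sumr_ge0.
Qed.

Definition packed_field rho e (y : idx -> R) (i : idx) : R :=
  let A := unpack false y in let C := unpack true y in
  match i with
  | inl false => fF1 e A C | inl true => fF2 e A C
  | inr (false, (i, j)) => fR1 rho e A C i j | inr (true, (i, j)) => fR2 rho e A C i j
  end.

Lemma packed_field_lip rho e : 0 < rho -> 0 < e <= 1 -> exists2 L, 0 <= L &
  forall y z i, `|packed_field rho e y i - packed_field rho e z i|
    <= L * \sum_j `|y j - z j|.
Proof.
move=> r0 e01.
have /choice[L hL] : forall i : idx, exists L, 0 <= L /\ forall y z,
    `|packed_field rho e y i - packed_field rho e z i| <= L * \sum_j `|y j - z j|.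
  have key (f : M -> M -> R) : lip2 f -> exists L, 0 <= L /\ forall y z,
      `|f (unpack false y) (unpack true y) - f (unpack false z) (unpack true z)|
        <= L * \sum_j `|y j - z j|.
    move=> [L L0 h]; exists L; split=> // y z; apply: le_trans (h _ _ _ _) _.
    by rewrite ler_wpM2l// unpack_dist.
  move=> [[|]|[[|] [i j]]].
  - exact: (key _ (lip2_fieldF2 adm e01)).
  - exact: (key _ (lip2_fieldF1 adm e01)).
  - exact: (key _ (mlip_lip2 i j (mlip_fieldR2 adm r0 e01))).
  - exact: (key _ (mlip_lip2 i j (mlip_fieldR1 adm r0 e01))).
exists (\sum_i L i); first by apply: sumr_ge0 => i _; case: (hL i).
move=> y z i; apply: le_trans ((hL i).2 y z) _; rewrite ler_wpM2r ?sumr_ge0//.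
by rewrite (bigD1 i)//= lerDl; apply: sumr_ge0 => j _; case: (hL j).
Qed.

Lemma trunc_exists rho e u1 u2 : 0 < rho -> 0 < e <= 1 -> sym u1 -> sym u2 ->
  exists f1 f2 A C, path_init u1 u2 f1 f2 A C /\
    forall T, trunc_solves rho e T f1 f2 A C.
Proof.
move=> r0 e01 s1 s2; have [L L0 hL] := packed_field_lip r0 e01.
have [y [y0 cy dy]] := picard_lindelof L0 hL
  (pack (fun=> 0) (fun=> 0) (fun=> u1) (fun=> u2) 0).
have cU k : mcont (fun t => unpack k (y t)).
  move=> i j; rewrite (_ : (fun _ => _) =
      fun t => 2^-1 * (y t (inr (k, (i, j))) + y t (inr (k, (j, i))))).
    by apply: contM; [exact: cont_cst|apply: contD].
  by apply/funext => t; rewrite !mxE.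
exists (fun t => y t (inl false)), (fun t => y t (inl true)),
  (fun t => unpack false (y t)), (fun t => unpack true (y t)); split.
  split; first by rewrite y0; split=> //; apply: unpack_sym.
  by split=> // t; split; exact: sym_unpack.
move=> T t /andP[t0 _]; split.
- exact: (dy t (inl false) t0).
- exact: (dy t (inl true) t0).
- set A := unpack false (y t); set C := unpack true (y t).
  have sR : sym (fR1 rho e A C) by apply: (sym_fieldR1 adm); exact: sym_unpack.
  move=> i j; have := derZ 2^-1 (derD (dy t (inr (false, (i, j))) t0)
    (dy t (inr (false, (j, i))) t0)).
  rewrite /= -/A -/C (symE j i sR) => h.
  by apply: is_derive_val (is_derive_ext _ h) => [|s]; [field|rewrite !mxE].
- set A := unpack false (y t); set C := unpack true (y t).
  have sR : sym (fR2 rho e A C) by apply: (sym_fieldR2 adm); exact: sym_unpack.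
  move=> i j; have := derZ 2^-1 (derD (dy t (inr (true, (i, j))) t0)
    (dy t (inr (true, (j, i))) t0)).
  rewrite /= -/A -/C (symE j i sR) => h.
  by apply: is_derive_val (is_derive_ext _ h) => [|s]; [field|rewrite !mxE].
Qed.

Lemma trunc_unique rho e T u1 u2 f1 f2 A C g1 g2 A' C' : 0 < rho -> 0 < e <= 1 ->
  path_init u1 u2 f1 f2 A C -> path_init u1 u2 g1 g2 A' C' ->
  trunc_solves rho e T f1 f2 A C -> trunc_solves rho e T g1 g2 A' C' ->
  forall t, 0 <= t <= T -> [/\ f1 t = g1 t, f2 t = g2 t, A t = A' t & C t = C' t].
Proof.
move=> r0 e01 pf pg sf sg t tT; have [L L0 hL] := packed_field_lip r0 e01.
have upA h1 h2 X Y s : (forall t, sym (X t) /\ sym (Y t)) ->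
    unpack false (pack h1 h2 X Y s) = X s /\ unpack true (pack h1 h2 X Y s) = Y s.
  by move=> sXY; split; apply: unpack_sym => //; case: (sXY s).
have cP h1 h2 X Y : path_init u1 u2 h1 h2 X Y -> forall i, continuous (pack h1 h2 X Y ^~ i).
  by move=> [_ [[c1 c2 c3 c4] _]] [[|]|[[|] [i j]]] /=; [exact: c2|exact: c1|exact: c4|exact: c3].
have dP h1 h2 X Y : path_init u1 u2 h1 h2 X Y -> trunc_solves rho e T h1 h2 X Y ->
    forall s i, 0 < s < T ->
    is_derive s 1 (pack h1 h2 X Y ^~ i) (packed_field rho e (pack h1 h2 X Y s) i).
  move=> [_ [_ sXY]] sol s i sT; have [d1 d2 d3 d4] := sol s sT.
  have [e1 e2] := upA h1 h2 X Y s sXY.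
  case: i => [[|]|[[|] [i j]]]; rewrite /packed_field e1 e2;
    [exact: d2|exact: d1|exact: d4|exact: d3].
have init : pack f1 f2 A C 0 = pack g1 g2 A' C' 0.
  case: pf => -[a1 a2 a3 a4] _; case: pg => -[b1 b2 b3 b4] _.
  apply/funext => -[[|]|[[|] [i j]]] /=; [by rewrite a2 b2|by rewrite a1 b1| |].
    by rewrite a4 b4.
  by rewrite a3 b3.
have E := lipschitz_ode_unique L0 hL (cP _ _ _ _ pf) (cP _ _ _ _ pg)
  (dP _ _ _ _ pf sf) (dP _ _ _ _ pg sg) init tT.
split.
- exact: (congr1 (fun y => y (inl false)) E).
- exact: (congr1 (fun y => y (inl true)) E).
- by apply/matrixP => i j; exact: (congr1 (fun y => y (inr (false, (i, j)))) E).
- by apply/matrixP => i j; exact: (congr1 (fun y => y (inr (true, (i, j)))) E).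
Qed.

Lemma Rintegral_le0 (mu : {measure set (Mx R d) -> \bar R}) (f : M -> R) :
  mu.-integrable D (EFin \o f) -> (forall xi, D xi -> f xi <= 0) ->
  \int[mu]_(xi in D) f xi <= 0.
Proof.
move=> fi f0; rewrite -oppr_ge0 -mulN1r -RintegralZl//; last exact: measurable_psdset0.
by apply: Rintegral_ge0 => xi Dxi; rewrite mulN1r oppr_ge0 f0.
Qed.

Lemma qf_mu_levy_le0 e (x y : M) v : 0 <= e <= 1 -> qf (mu_levy nu H e 0 x y) v <= 0.
Proof.
move=> e01; rewrite -inner_col.
have [i1 ->] := inner_levy adm (v *m v^T) (trunc_exp_measurable e 0 x y)
  (fun xi Dxi => trunc_exp_bound 0 x y e01 Dxi.1).
apply: Rintegral_le0 => // xi Dxi; rewrite mulr_le0_ge0//.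
  by apply: trunc_exp_le0; case/andP: e01.
by rewrite inner_col; apply: psd_qf; exact: (adm_H adm).
Qed.

Lemma m_levy_le0 e (x y : M) : 0 <= e <= 1 -> m_levy m e 0 x y <= 0.
Proof.
move=> e01; apply: Rintegral_le0.
  exact: (trunc_exp_integrable (@mcst1 R d) (@cst1_le R d) (adm_iWm adm)).
by move=> xi _; rewrite mulr1; apply: trunc_exp_le0; case/andP: e01.
Qed.

(** Decay rate of the barrier [eps * exp (- K * t)]: the three terms pay, respectively, for the
    quadratic term on an eigenvector with eigenvalue at most [eps], for the linear drift applied to
    the scalar part, and for strictness. *)
Definition pos_rate (eps : R) : R :=
  2 * eps * mxsum alpha + mxsum (adjoint B 1%:M) + 1.

(** A moving barrier [l]: in a null direction of [A - l] the matrix [A] acts as the scalar [l], the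
    terms from [C], [gamma] and the jumps have a favourable sign, and the rest is of order [l],
    hence beaten by the decay of the barrier. The bound involves neither [rho] nor [e]. *)
Lemma trunc_lower_bound rho e u1 u2 f1 f2 A C eps : 0 < eps -> 0 <= e <= 1 ->
  psd (u1 - (2 * eps)%:M) -> path_init u1 u2 f1 f2 A C ->
  (forall T, trunc_solves rho e T f1 f2 A C) ->
  forall t, 0 <= t -> psd (A t - (eps * expR (- pos_rate eps * t))%:M).
Proof.
move=> eps0 e01 pu [[_ _ A0 _] [[_ _ cA _] sAC]] sol t t0; apply: pd_psd.
pose K := pos_rate eps; pose l (s : R) := eps * expR (- K * s).
have K0 : 0 <= K by rewrite /K /pos_rate !addr_ge0 ?mulr_ge0 ?mxsum_ge0// ltW.
have l0 s : 0 < l s by rewrite mulr_gt0 ?expR_gt0.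
have dl (s : R) : is_derive s 1 l (- (K * l s)).
  apply: is_derive_val (derZ eps (der_expRM (- K) s)); rewrite /l; ring.
have scalar_entry (k : R) (i j : 'I_d) : (k%:M : M) i j = (i == j)%:R * k.
  by rewrite mxE mulr_natl.
pose X (s : R) := A s - (l s)%:M.
rewrite -/(l t) -/(X t); apply: pd_path t0.
- move=> i j; rewrite (_ : (fun _ => _) = fun s => A s i j - (i == j)%:R * l s).
    apply: contB; first exact: cA.
    apply: contM; first exact: cont_cst.
    by apply: contM; [exact: cont_cst|exact: cont_expRM].
  by apply/funext => s; rewrite /X !mxE mulr_natl.
- by move=> s; apply: symB; [exact: (sAC s).1|exact: sym_scalar].
(* The factor 2 in the hypothesis on [u1] leaves a margin [eps], so that [X 0] is positive definite
   and not just semidefinite. *)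
- rewrite /X A0 /l mulr0 expR0 mulr1; apply/pdP; exists eps => //.
  by rewrite -addrA -opprD -raddfD /= (_ : eps + eps = 2 * eps)//; ring.
move=> s v s0 pX v0 qv.
have [|_ _ dA _] := sol (s + 1) s; first by rewrite s0 ltrDl ltr01.
pose n2 := \sum_i v i ord0 ^+ 2; have n20 : 0 < n2 by exact: sqnorm_gt0.
set A' := fR1 _ _ _ _ in dA.
exists (qf A' v + K * l s * n2).
  (* A null direction of the semidefinite [X s] lies in its kernel, so [v] is an eigenvector of
     [A s] with eigenvalue [l s]. *)
  have Av : A s *m v = l s *: v.
    have Xv : X s *m v = 0.
      apply/matrixP => i j; rewrite ord1 [RHS]mxE; apply/eqP.
      rewrite -sqrf_eq0 eq_le sqr_ge0 andbT; apply: le_trans (psd_CS v i pX) _.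
      by rewrite qv mulr0.
    by rewrite -[A s](subrK (l s)%:M) mulmxDl -/(X s) Xv add0r mul_scalar_mx.
  have ls_le : l s <= eps.
    by rewrite /l ler_piMr ?(ltW eps0)// expR_le1 mulNr oppr_le0 mulr_ge0// ltW.
  have sA := (sAC s).1; have sC := (sAC s).2.
  have pa := adm_alpha adm.
  (* The retraction enters as a factor in [[0, 1]]: it weakens the harmful part of the quadratic
     term and keeps the sign of the helpful one, so the bound is uniform in [rho]. *)
  set k := retr rho (A s) (C s).
  have k0 : 0 <= k ^+ 2 by exact: sqr_ge0.
  have k1 : k ^+ 2 <= 1 by rewrite expr_le1 ?retr_le1// retr_ge0.
  have qA : qf (A s *m alpha *m A s) v = l s ^+ 2 * qf alpha v.
    have -> : qf (A s *m alpha *m A s) v = qf alpha (A s *m v).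
      by rewrite /qf trmx_mul sA !mulmxA.
    by rewrite Av qf_scale.
  have qC : 0 <= qf (C s *m alpha *m C s) v.
    by have := psd_qf v (psd_congr (C s) pa); rewrite sC.
  have qa : qf alpha v <= mxsum alpha * n2.
    rewrite -inner_col /n2 -tr_colmul.
    exact: le_trans (ler_norm _) (inner_le_tr alpha (psd_colmul v)).
  have qa0 : 0 <= qf alpha v by exact: psd_qf.
  (* Split [A s] as [X s] plus the scalar [l s]: [X s] is orthogonal to [v v^T], so the
     admissibility condition on [B] gives a nonnegative term, and the scalar part costs at most a
     multiple of [l s]. *)
  have qB : - (l s * mxsum (adjoint B 1%:M) * n2) <= qf (adjoint B (A s)) v.
    rewrite -inner_col (adjointP adm)//; last exact: sym_colmul.
    rewrite -[A s](subrK (l s)%:M) -/(X s) innerDl.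
    have h1 : 0 <= inner (X s) (B (v *m v^T)).
      rewrite innerC; apply: (adm_Bpos adm) => //; first exact: psd_colmul.
      by rewrite innerC inner_col.
    have h2 : `|inner 1%:M (B (v *m v^T))| <= mxsum (adjoint B 1%:M) * n2.
      rewrite -(adjointP adm); last exact: sym_colmul.
      by rewrite /n2 -tr_colmul; exact: inner_le_tr (psd_colmul v).
    have h3 : inner (l s)%:M (B (v *m v^T)) = l s * inner 1%:M (B (v *m v^T)).
      by rewrite !inner_scalar mul1r.
    rewrite h3; move: h2; rewrite ler_norml => /andP[h2 _].
    have : l s * - (mxsum (adjoint B 1%:M) * n2) <= l s * inner 1%:M (B (v *m v^T)).
      by rewrite ler_pM2l.
    lra.
  have qg : 0 <= qf gamma v by apply: psd_qf; exact: (adm_gamma adm).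
  have qJ := qf_mu_levy_le0 (A s) (C s) v e01.
  have qA' : qf A' v = -2 * (k ^+ 2 * (l s ^+ 2 * qf alpha v - qf (C s *m alpha *m C s) v))
      + qf (adjoint B (A s)) v + qf gamma v - qf (mu_levy nu H e 0 (A s) (C s)) v.
    by rewrite /A' /fieldR1 /quad1 qfB !qfD !qfZ qfB qA.
  have main : k ^+ 2 * (l s ^+ 2 * qf alpha v) <= l s * (eps * (mxsum alpha * n2)).
    apply: (@le_trans _ _ (l s ^+ 2 * qf alpha v)).
      by rewrite ler_piMl// mulr_ge0// sqr_ge0.
    rewrite expr2 -mulrA ler_pM2l//; apply: ler_pM => //; exact: ltW.
  have kC : 0 <= k ^+ 2 * qf (C s *m alpha *m C s) v by exact: mulr_ge0.
  have fin : 0 < l s * n2 by exact: mulr_gt0.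
  rewrite qA' /K /pos_rate; lra.
rewrite (_ : (fun s => qf (X s) v) = fun s => inner (A s) (v *m v^T) - n2 * l s).
  rewrite -inner_col (_ : _ + _ = inner A' (v *m v^T) - n2 * (- (K * l s))); last by ring.
  by apply: derB (mder_innerr _ dA) _; exact: derZ (dl s).
apply/funext => r; rewrite -inner_col /X innerBl; congr (_ - _).
by rewrite inner_scalar tr_colmul mulrC.
Qed.

Lemma mxsum_adjoint (x : M) : mxsum (adjoint B x) <= mxsum x * \sum_i \sum_j mxsum (B (Sij R i j)).
Proof.
rewrite /mxsum mulr_sumr; apply: ler_sum => i _; rewrite mulr_sumr.
by apply: ler_sum => j _; rewrite mxE; exact: inner_le_mxsum.
Qed.

Lemma mxsum_mu_levy e th (x y : M) : 0 <= e <= 1 ->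
  mxsum (mu_levy nu H e th x y)
    <= (d * d)%:R * (2 * (mxsum x + mxsum y + 1) * levy_mass nu (fun xi => \tr (H xi))).
Proof.
move=> e01; apply: mxsum_le => i j; rewrite mxE.
exact: (levy_integral_le (adm_mH adm i j) (adm_Hle adm i j) (adm_iWnu adm)).
Qed.

(** In the derivative of the energy the quadratic terms contribute [-4 * k] times a nonnegative
    number, with [k >= 0] the truncation factor; only terms of linear growth remain, and Gronwall
    applies. Positive definiteness of [alpha] bounds the solution by its energy. Note that [rho0] is
    chosen before [rho] and [e]. *)
Lemma energy_bound T u1 u2 : pd alpha -> sym u1 -> sym u2 -> 0 <= T ->
  exists2 rho0, 0 < rho0 & forall rho e f1 f2 A C, 0 < rho -> 0 <= e <= 1 ->
    path_init u1 u2 f1 f2 A C -> (forall T, trunc_solves rho e T f1 f2 A C) ->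
    (forall t, 0 <= t -> psd (A t)) ->
    forall t, 0 <= t <= T -> mxsum (A t) + mxsum (C t) <= rho0.
Proof.
move=> pda s1 s2 T0; have pa := pd_psd pda; have [l l0 pal] := (pdP alpha).1 pda.
pose SB := \sum_i \sum_j mxsum (B (Sij R i j)).
pose W := levy_mass nu (fun xi => \tr (H xi)).
pose n : R := (d * d)%:R.
have SB0 : 0 <= SB by apply: sumr_ge0 => i _; apply: sumr_ge0 => j _; exact: mxsum_ge0.
have W0 : 0 <= W.
  by apply: Rintegral_ge0 => xi Dxi; rewrite mulr_ge0 ?min_fnorm_ge0 ?psd_tr_ge0//; exact: (adm_H adm).
have n0 : 0 <= n by [].
pose K1 := SB + mxsum gamma + n * (2 * W).
have K10 : 0 <= K1 by rewrite !addr_ge0 ?mxsum_ge0 ?mulr_ge0.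
pose a2 := mxsum alpha ^+ 2.
have a20 : 0 <= a2 by exact: sqr_ge0.
pose Q := n ^+ 2 / l ^+ 2.
have Q0 : 0 <= Q by rewrite divr_ge0 ?sqr_ge0.
(* Each of the two linear parts occurs twice in the derivative and contributes at most
   [K1 * a2 * (1 + N) ^ 2], whence the 4; the factor [2 + 4 * Q] converts [(1 + N) ^ 2] into the
   energy [E]. *)
pose K := 4 * K1 * a2 * (2 + 4 * Q).
have Q24 : 0 <= 2 + 4 * Q by apply: addr_ge0 => //; exact: mulr_ge0.
have K0 : 0 <= K by do 3! [apply: mulr_ge0 => //].
pose E0 := 1 + inner (u1 *m alpha) (u1 *m alpha) + inner (u2 *m alpha) (u2 *m alpha).
have sand_ge0 (z : M) : sym z -> 0 <= inner (z *m alpha) (z *m alpha).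
  move=> sz; apply: le_trans (inner_sandwich_ge (ltW l0) pa pal sz).
  rewrite mulr_ge0 ?sqr_ge0// innerE.
  apply: sumr_ge0 => i _; apply: sumr_ge0 => j _.
  by rewrite (symE j i sz) -expr2 sqr_ge0.
have E00 : 0 <= E0 by rewrite /E0 !addr_ge0// sand_ge0.
pose bd := E0 * expR (K * T).
have bd0 : 0 <= bd by rewrite mulr_ge0// expR_ge0.
exists (2 + 4 * Q * bd).
  by apply: ltr_wpDr => //; do 2! [apply: mulr_ge0 => //].
move=> rho e f1 f2 A C r0 e01 [[_ _ A0 C0] [[_ _ cA cC] sAC]] sol pA t /andP[t0 tT].
pose N s := mxsum (A s) + mxsum (C s).
have N0 s : 0 <= N s by rewrite addr_ge0 ?mxsum_ge0.
(* The constant 1 absorbs the inhomogeneous part of the field, so that a multiple of [E] dominates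
   [(1 + N) ^ 2]. *)
pose E s := 1 + inner (A s *m alpha) (A s *m alpha) + inner (C s *m alpha) (C s *m alpha).
pose E' s := 0 + (inner (fR1 rho e (A s) (C s) *m alpha) (A s *m alpha)
               + inner (A s *m alpha) (fR1 rho e (A s) (C s) *m alpha))
            + (inner (fR2 rho e (A s) (C s) *m alpha) (C s *m alpha)
               + inner (C s *m alpha) (fR2 rho e (A s) (C s) *m alpha)).
have NE s : N s ^+ 2 <= 2 * Q * (E s - 1).
  have h1 := inner_sandwich_ge (ltW l0) pa pal (sAC s).1.
  have h2 := inner_sandwich_ge (ltW l0) pa pal (sAC s).2.
  have h3 := sqr_mxsum_le (sAC s).1; have h4 := sqr_mxsum_le (sAC s).2.
  rewrite -/n in h3 h4.
  have l2 : 0 < l ^+ 2 by rewrite exprn_gt0.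
  have h5 : n ^+ 2 * inner (A s) (A s) <= Q * inner (A s *m alpha) (A s *m alpha).
    by rewrite /Q -mulrA ler_wpM2l ?sqr_ge0// ler_pdivlMl.
  have h6 : n ^+ 2 * inner (C s) (C s) <= Q * inner (C s *m alpha) (C s *m alpha).
    by rewrite /Q -mulrA ler_wpM2l ?sqr_ge0// ler_pdivlMl.
  have -> : E s - 1 = inner (A s *m alpha) (A s *m alpha) + inner (C s *m alpha) (C s *m alpha).
    by rewrite /E; ring.
  have := sqr_ge0 (mxsum (A s) - mxsum (C s)).
  rewrite /N; nra.
have cE : continuous E.
  have cM (X : R -> M) : mcont X -> continuous (fun s => inner (X s *m alpha) (X s *m alpha)).
    move=> cX; rewrite (_ : (fun _ => _) = fun s =>
        \sum_i \sum_j (\sum_k X s i k * alpha k j) * (\sum_k X s j k * alpha k i)).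
      apply: cont_sum => i; apply: cont_sum => j.
      by apply: contM; apply: cont_sum => k; apply: contM => //; exact: cont_cst.
    apply/funext => s; rewrite innerE; apply: eq_bigr => i _; apply: eq_bigr => j _.
    by rewrite !mxE.
  by apply: contD; [apply: contD; [exact: cont_cst|exact: cM]|exact: cM].
have dE (s : R) : 0 < s -> is_derive s 1 E (E' s).
  move=> s0; have [|_ _ dA dC] := sol (s + 1) s; first by rewrite s0 ltrDl ltr01.
  have dAa := mder_mulr alpha dA; have dCa := mder_mulr alpha dC.
  exact: derD (derD (der_cst 1 s) (mder_inner dAa dAa)) (mder_inner dCa dCa).
have E'le (s : R) : 0 < s -> E' s <= K * E s.
  move=> s0; set x := A s; set y := C s; set k := retr rho x y ^+ 2.
  have k0 : 0 <= k by exact: sqr_ge0.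
  have px : psd x by apply: pA; exact: ltW.
  have sx : sym x by exact: (sAC s).1.
  have sy : sym y by exact: (sAC s).2.
  pose L1 := adjoint B x + gamma - mu_levy nu H e 0 x y.
  pose L2 := adjoint B y - mu_levy nu H e (pi / 2) x y.
  have R1E : fR1 rho e x y = (-2 * k) *: quad1 alpha x y + L1.
    by rewrite /fieldR1 scalerA /L1 !addrA.
  have R2E : fR2 rho e x y = (-2 * k) *: quad2 alpha x y + L2.
    by rewrite /fieldR2 scalerA /L2 !addrA.
  (* By cyclicity all mixed terms equal [\tr (x alpha y alpha y alpha)]; they occur once with a
     minus sign and twice with a plus sign. What is left pairs [x] with two congruences of
     [alpha]. *)
  have quadE : inner (quad1 alpha x y *m alpha) (x *m alpha)
      + inner (quad2 alpha x y *m alpha) (y *m alpha)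
     = inner x (alpha *m x *m alpha *m (x *m alpha))
       + inner x (alpha *m y *m alpha *m (y *m alpha)).
    rewrite /quad1 /quad2 mulmxBl mulmxDl innerBl innerDl /inner !mulmxA.
    have c1 : \tr (y *m alpha *m y *m alpha *m x *m alpha)
       = \tr (x *m alpha *m y *m alpha *m y *m alpha).
      by have := mxtrace_mulC (y *m alpha *m y *m alpha) (x *m alpha); rewrite !mulmxA.
    have c2 : \tr (y *m alpha *m x *m alpha *m y *m alpha)
       = \tr (x *m alpha *m y *m alpha *m y *m alpha).
      by have := mxtrace_mulC (y *m alpha) (x *m alpha *m y *m alpha); rewrite !mulmxA.
    rewrite c1 c2; ring.
  have sa := pa.1.
  have quad_ge0 : 0 <= inner (quad1 alpha x y *m alpha) (x *m alpha)
      + inner (quad2 alpha x y *m alpha) (y *m alpha).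
    rewrite quadE addr_ge0// inner_psd_ge0//.
      by have := psd_congr (x *m alpha) pa; rewrite trmx_mul sx sa.
    by have := psd_congr (y *m alpha) pa; rewrite trmx_mul sy sa.
  have L1le : mxsum L1 <= K1 * (1 + N s).
    rewrite /L1 /K1; apply: le_trans (mxsumD _ _) _; rewrite mxsumN.
    have h1 := mxsumD (adjoint B x) gamma; have h2 := mxsum_adjoint x.
    have h3 := mxsum_mu_levy 0 x y e01; rewrite -/SB -/W -/n in h2 h3.
    have h4 : mxsum x * SB <= SB * (1 + N s).
      by rewrite mulrC ler_wpM2l// /N -/x -/y addrCA lerDl addr_ge0 ?mxsum_ge0.
    have h5 : mxsum gamma <= mxsum gamma * (1 + N s).
      by rewrite ler_peMr ?mxsum_ge0// lerDl.
    have h6 : n * (2 * (mxsum x + mxsum y + 1) * W) = n * (2 * W) * (1 + N s).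
      by rewrite /N; ring.
    by rewrite h6 in h3; rewrite !mulrDl; lra.
  have L2le : mxsum L2 <= K1 * (1 + N s).
    rewrite /L2 /K1; apply: le_trans (mxsumD _ _) _; rewrite mxsumN.
    have h2 := mxsum_adjoint y.
    have h3 := mxsum_mu_levy (pi / 2) x y e01; rewrite -/SB -/W -/n in h2 h3.
    have h4 : mxsum y * SB <= SB * (1 + N s).
      by rewrite mulrC ler_wpM2l// /N -/x -/y addrA lerDr addr_ge0 ?mxsum_ge0.
    have h5 : 0 <= mxsum gamma * (1 + N s).
      by apply: mulr_ge0; [exact: mxsum_ge0|exact: addr_ge0].
    have h6 : n * (2 * (mxsum x + mxsum y + 1) * W) = n * (2 * W) * (1 + N s).
      by rewrite /N; ring.
    by apply: le_trans (lerD h2 h3) _; rewrite h6 !mulrDl; lra.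
  have lin (L z : M) : mxsum L <= K1 * (1 + N s) -> mxsum z <= N s ->
      inner (L *m alpha) (z *m alpha) <= K1 * a2 * (1 + N s) ^+ 2.
    move=> hL hz; apply: le_trans (ler_norm _) _.
    apply: le_trans (inner_le_mxsum _ _) _.
    apply: (@le_trans _ _ ((mxsum L * mxsum alpha) * (mxsum z * mxsum alpha))).
      by apply: ler_pM; rewrite ?mxsum_ge0// mxsumM.
    have -> : mxsum L * mxsum alpha * (mxsum z * mxsum alpha) = a2 * (mxsum L * mxsum z).
      by rewrite /a2; ring.
    have -> : K1 * a2 * (1 + N s) ^+ 2 = a2 * (K1 * (1 + N s) * (1 + N s)) by ring.
    rewrite ler_wpM2l//; apply: ler_pM; rewrite ?mxsum_ge0//.
    by apply: le_trans hz _; rewrite lerDr.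
  have i1 := lin L1 x L1le _; rewrite lerDl mxsum_ge0 in i1; have {}i1 := i1 isT.
  have i2 := lin L2 y L2le _; rewrite lerDr mxsum_ge0 in i2; have {}i2 := i2 isT.
  have -> : E' s = -4 * k * (inner (quad1 alpha x y *m alpha) (x *m alpha)
      + inner (quad2 alpha x y *m alpha) (y *m alpha))
      + 2 * inner (L1 *m alpha) (x *m alpha) + 2 * inner (L2 *m alpha) (y *m alpha).
    rewrite /E' -/x -/y R1E R2E !(innerC (_ *m alpha) (( _ + _) *m alpha)).
    have aux (r : R) (q z w : M) : inner ((r *: q + z) *m alpha) w
        = r * inner (q *m alpha) w + inner (z *m alpha) w.
      by rewrite mulmxDl -scalemxAl innerDl innerZl.
    have idt (r p1 q1 p2 q2 : R) : 0 + (-2 * r * p1 + q1 + (-2 * r * p1 + q1))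
        + (-2 * r * p2 + q2 + (-2 * r * p2 + q2))
        = -4 * r * (p1 + p2) + 2 * q1 + 2 * q2 by ring.
    rewrite !aux; exact: idt.
  have hk := mulr_ge0 k0 quad_ge0.
  have N2 : (1 + N s) ^+ 2 <= 2 + 2 * N s ^+ 2.
    by have := sqr_ge0 (1 - N s); rewrite !expr2; lra.
  have EN := NE s.
  have E1 : 0 <= E s - 1.
    by have := sand_ge0 x sx; have := sand_ge0 y sy; rewrite /E -/x -/y; lra.
  have N3 : (1 + N s) ^+ 2 <= (2 + 4 * Q) * E s.
    have -> : (2 + 4 * Q) * E s = 2 + 2 * (2 * Q * (E s - 1)) + 4 * Q + 2 * (E s - 1).
      by ring.
    lra.
  have : 4 * K1 * a2 * (1 + N s) ^+ 2 <= K * E s.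
    rewrite /K -[leRHS]mulrA; apply: ler_wpM2l => //.
    by do 2! [apply: mulr_ge0 => //].
  lra.
have Ebd : E t <= bd.
  apply: le_trans (gronwall cE dE E'le t0) _; rewrite /E A0 C0 -/E0 /bd.

  by rewrite ler_wpM2l// ler_expR ler_wpM2l.
have := NE t; have := N0 t; have := mulr_ge0 Q0 (normr_ge0 (bd - E t)).
rewrite -/(N t) ger0_norm ?subr_ge0//; have := sqr_ge0 (N t - 1); rewrite !expr2; nra.
Qed.

End TruncatedSolutions.

(** * Matrix-valued calculus and compactness in time *)

Section MatrixCalculus.
Variables (R : realType) (d : nat).
Notation M := 'M[R]_d.

Lemma mcont_continuous (X : R -> M) : mcont X -> continuous X.
Proof.
move=> cX t; apply/cvgrPdist_le => e e0; near=> s.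
rewrite /Num.Def.normr /= mx_normrE; apply: bigmax_le => [|ij _ /=]; first exact: ltW.
rewrite !mxE; move: ij; near: s; apply: filter_forall => ij.
by have := cX ij.1 ij.2 t => /cvgrPdist_le /(_ _ e0).
Unshelve. all: by end_near. Qed.

Lemma continuous_mcont (X : R -> M) : continuous X -> mcont X.
Proof.
move=> cX i j t; apply: (@continuous_comp _ _ _ X (fun x : M => x i j)); first exact: cX.
exact: coord_continuous.
Qed.

Lemma mder_is_derive (X : R -> M) (t : R) x : mder t X x -> is_derive t 1 X x.
Proof.
move=> dX; have dvX : derivable X t 1 by apply/derivable_mxP => i j; case: (dX i j).
split=> //; rewrite derive_mx//; apply/matrixP => i j; rewrite mxE.
by case: (dX i j).
Qed.

Lemma is_derive_mder (X : R -> M) (t : R) (x : M) : is_derive t 1 X x -> mder t X x.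
Proof.
move=> [dX eX] i j; split; first by move/derivable_mxP: dX.
by rewrite -eX derive_mx// mxE.
Qed.

(** [near_pd] gives a margin near each time, and compactness of [[0, T]] makes it uniform. *)
Lemma pd_uniform (X : R -> M) (T : R) : mcont X -> (forall s, sym (X s)) ->
  (forall t, 0 <= t <= T -> pd (X t)) ->
  exists2 l, 0 < l & forall t, 0 <= t <= T -> psd (X t - l%:M).
Proof.
move=> cX sX pX.
have cpt : near_covering (`[0, T]%classic : set R).
  by apply/compact_near_coveringP; exact: segment_compact.
have := cpt R (0^'+) (fun l t => psd (X t - l%:M)) _ _.
move=> h; have {h} : \forall l \near (0 : R)^'+, forall t, `[0, T]%classic t -> psd (X t - l%:M).
  apply: h => t; rewrite /= in_itv /= => tT.
  have [l l0 hl] := near_pd cX sX (pX t tT).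
  near=> s i => /=.
  have pl : psd (X s - l%:M) by near: s.
  have il : i <= l by near: i; exact: nbhs_right_le.
  rewrite (_ : X s - i%:M = (X s - l%:M) + (l - i)%:M); last by rewrite raddfB /= addrA subrK.
  by apply: psdD => //; apply: psd_scalar; rewrite subr_ge0.
move=> h; have : \forall l \near (0 : R)^'+, 0 < l /\ forall t, `[0, T]%classic t -> psd (X t - l%:M).
  by apply: filterI h; exact: nbhs_right_gt.
move=> /filter_ex [l [l0 hl]]; exists l => // t tT; exact: hl.
Unshelve. all: by end_near. Qed.

Lemma path_bounded (f : R -> R) (T : R) : continuous f ->
  exists2 k, 0 < k & forall t, 0 <= t <= T -> f t <= k.
Proof.
move=> cf; have [T0|T0] := leP 0 T; last first.
  by exists 1 => // t /andP[t0 tT]; move: T0; rewrite ltNge (le_trans t0 tT).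
have [t0 _ h] := @EVT_max R f 0 T T0 (continuous_subspaceT cf).
exists (Num.max 1 (f t0)); first by rewrite lt_max ltr01.
by move=> t tT; rewrite le_max h ?orbT// in_itv.
Qed.

End MatrixCalculus.

(** * Global existence and uniqueness for the Riccati equations *)

Section RiccatiSolutions.
Variables (R : realType) (d : nat) (alpha b : 'M[R]_d) (B : 'M[R]_d -> 'M[R]_d).
Variables (c : R) (gamma : 'M[R]_d) (m nu : {measure set (Mx R d) -> \bar R}).
Variable H : 'M[R]_d -> 'M[R]_d.
Hypothesis adm : admissible alpha b B c gamma m nu H.
Hypothesis alpha_cases : \det alpha != 0 \/ alpha = 0.
Notation M := 'M[R]_d.
Notation D := (@psdset0 R d).
Implicit Types (A C : R -> M) (f g : R -> R) (u x y : M) (e rho T t : R).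

Definition ricF1 x y : R :=
  inner b x + c - \int[m]_(xi in D) (cexp_re (inner x xi) (inner y xi) - 1).
Definition ricF2 x y : R :=
  inner b y - \int[m]_(xi in D) cexp_im (inner x xi) (inner y xi).
Definition ricR1 x y : M :=
  (-2) *: quad1 alpha x y + adjoint B x + gamma
  - mu_integral nu H (fun xi => cexp_re (inner x xi) (inner y xi) - 1).
Definition ricR2 x y : M :=
  (-2) *: quad2 alpha x y + adjoint B y
  - mu_integral nu H (fun xi => cexp_im (inner x xi) (inner y xi)).

Definition ric_solves : R -> (R -> R) -> (R -> R) -> (R -> M) -> (R -> M) -> Prop :=
  solves ricF1 ricF2 ricR1 ricR2.

Lemma trunc_exp_re e x y xi : 0 <= e -> psd (x - e%:M) -> psd xi ->
  trunc_exp e 0 x y xi = cexp_re (inner x xi) (inner y xi) - 1.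
Proof. by move=> e0 pe pxi; rewrite trunc_expE// add0r cos0. Qed.

Lemma trunc_exp_im e x y xi : 0 <= e -> psd (x - e%:M) -> psd xi ->
  trunc_exp e (pi / 2) x y xi = cexp_im (inner x xi) (inner y xi).
Proof.
move=> e0 pe pxi; rewrite trunc_expE// cos_pihalf subr0 (addrC (pi / 2)).
by rewrite cosDpihalf mulrN.
Qed.

Lemma field_eq rho e x y : 0 <= e -> psd (x - e%:M) ->
  (0 < rho /\ mxsum x + mxsum y <= rho) \/ alpha = 0 ->
  [/\ fieldF1 b c m e x y = ricF1 x y, fieldF2 b m e x y = ricF2 x y,
      fieldR1 alpha B gamma nu H rho e x y = ricR1 x y &
      fieldR2 alpha B nu H rho e x y = ricR2 x y].
Proof.
move=> e0 pe cases.
have quadE (q : M) : (alpha = 0 -> q = 0) -> retr rho x y ^+ 2 *: q = q.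
  case: cases => [[r0 hr] _|a0 /(_ a0) ->]; last by rewrite scaler0.
  by rewrite retr_eq1// expr1n scale1r.
have q1 : retr rho x y ^+ 2 *: quad1 alpha x y = quad1 alpha x y.
  by apply: quadE => a0; rewrite /quad1 a0 !mulmx0 !mul0mx subrr.
have q2 : retr rho x y ^+ 2 *: quad2 alpha x y = quad2 alpha x y.
  by apply: quadE => a0; rewrite /quad2 a0 !mulmx0 !mul0mx addr0.
split.
- congr (_ - _); apply: eq_Rintegral => xi /set_mem [pxi _].
  by rewrite mulr1 trunc_exp_re.
- congr (_ - _); apply: eq_Rintegral => xi /set_mem [pxi _].
  by rewrite mulr1 trunc_exp_im.
- rewrite /fieldR1 q1; congr (_ - _); apply/matrixP => i j; rewrite !mxE.
  by apply: eq_Rintegral => xi /set_mem [pxi _]; rewrite trunc_exp_re.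
- rewrite /fieldR2 q2; congr (_ - _); apply/matrixP => i j; rewrite !mxE.
  by apply: eq_Rintegral => xi /set_mem [pxi _]; rewrite trunc_exp_im.
Qed.

Lemma psd_scalar_le x (k l : R) : k <= l -> psd (x - l%:M) -> psd (x - k%:M).
Proof.
move=> kl px; rewrite (_ : x - k%:M = (x - l%:M) + (l - k)%:M); last by rewrite raddfB /= addrA subrK.
by apply: psdD => //; apply: psd_scalar; rewrite subr_ge0.
Qed.

Lemma riccati_local T u1 u2 : 0 <= T -> pd u1 -> sym u2 ->
  exists f1 f2 A C, [/\ path_init u1 u2 f1 f2 A C, ric_solves T f1 f2 A C &
    forall t, 0 <= t <= T -> 0 <= f1 t /\ pd (A t)].
Proof.
move=> T0 pu su; have [l l0 pl] := (pdP u1).1 pu.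
pose eps := l / 2; have eps0 : 0 < eps by rewrite divr_gt0.
have pu2 : psd (u1 - (2 * eps)%:M) by rewrite (_ : 2 * eps = l)// /eps; field.
pose K := pos_rate alpha B eps.
have K0 : 0 <= K by rewrite /K /pos_rate !addr_ge0 ?mulr_ge0 ?mxsum_ge0// ltW.
(* The least value of the barrier on [[0, T]], capped at 1 as the Lipschitz estimates require: with
   this [e] the truncation of the exponent is inactive up to time [T]. *)
pose e := Num.min 1 (eps * expR (- K * T)).
have e0 : 0 < e by rewrite lt_min ltr01 mulr_gt0// expR_gt0.
have e1 : 0 < e <= 1 by rewrite e0 ge_min lexx.
have e1' : 0 <= e <= 1 by case/andP: e1 => /ltW -> ->.
(* The radius is the a priori bound itself, which holds for solutions truncated at any radius, so
   the retraction is inactive. For [alpha = 0] there is no quadratic term and any radius works. *)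
have [rho r0 hrho] : exists2 rho, 0 < rho & alpha = 0 \/
    forall f1 f2 A C, path_init u1 u2 f1 f2 A C ->
     (forall T, trunc_solves alpha b B c gamma m nu H rho e T f1 f2 A C) ->
     (forall t, 0 <= t -> psd (A t)) ->
     forall t, 0 <= t <= T -> mxsum (A t) + mxsum (C t) <= rho.
  case: alpha_cases => [da|a0]; last by exists 1 => //; left.
  have pda := psd_det_pd (adm_alpha adm) da.
  have [rho r0 h] := energy_bound adm pda pu.1 su T0.
  exists rho => //; right => f1 f2 A C init sol pA t tT.
  exact: (h rho e f1 f2 A C r0 e1' init sol pA t tT).
have [f1 [f2 [A [C [init sol]]]]] := trunc_exists adm r0 e1 pu.1 su.
have low t : 0 <= t -> psd (A t - (eps * expR (- K * t))%:M).
  by move=> t0; exact: (trunc_lower_bound adm eps0 e1' pu2 init sol t0).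
have lowT t : 0 <= t <= T -> psd (A t - e%:M).
  move=> /andP[t0 tT]; apply: psd_scalar_le (low t t0).
  rewrite /e ge_min; apply/orP; right; rewrite ler_pM2l// ler_expR.
  by rewrite ler_wnM2l// oppr_le0.
have pA t : 0 <= t -> psd (A t).
  move=> t0; have := psd_scalar_le _ (low t t0) => /(_ 0); rewrite raddf0 subr0; apply.
  by rewrite mulr_ge0 ?expR_ge0// ltW.
exists f1, f2, A, C; split=> //.
- move=> t /andP[t0 tT]; have tT' : 0 <= t <= T by rewrite !ltW.
  have cases : (0 < rho /\ mxsum (A t) + mxsum (C t) <= rho) \/ alpha = 0.
    case: hrho => [a0|h]; [by right|left; split=> //].
    exact: (h f1 f2 A C init sol pA).
  have [E1 E2 E3 E4] := field_eq (ltW e0) (lowT t tT') cases.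
  by rewrite -E1 -E2 -E3 -E4; apply: (sol T); rewrite t0 tT.
- move=> t /andP[t0 tT]; split; last first.
    by apply/pdP; exists e => //; apply: lowT; rewrite t0.
  have [[f10 _ _ _] [[cf1 _ _ _] _]] := init; rewrite -f10.
  apply: (@cont_deriv_ge0 _ _ (fun s => fieldF1 b c m e (A s) (C s)) T cf1) => //.
    by move=> s sT; have [] := sol T s sT.
  move=> s /andP[s0 _]; rewrite /fieldF1 subr_ge0.
  apply: le_trans (m_levy_le0 adm (A s) (C s) e1') _.
  apply: addr_ge0; last exact: (adm_c adm).
  by apply: inner_psd_ge0; [exact: (adm_b adm)|apply: pA; exact: ltW].
Qed.

(** On a compact interval both solutions are bounded and keep a margin from the boundary of the
    cone, so both solve one truncated system with common [e] and [rho], where Lipschitz uniqueness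
    applies. *)
Lemma riccati_path_unique T u1 u2 f1 f2 A C g1 g2 A' C' : 0 <= T ->
  path_init u1 u2 f1 f2 A C -> path_init u1 u2 g1 g2 A' C' ->
  ric_solves T f1 f2 A C -> ric_solves T g1 g2 A' C' ->
  (forall t, 0 <= t <= T -> pd (A t)) -> (forall t, 0 <= t <= T -> pd (A' t)) ->
  forall t, 0 <= t <= T -> [/\ f1 t = g1 t, f2 t = g2 t, A t = A' t & C t = C' t].
Proof.
move=> T0 pf pg sf sg pA pA'.
have bnds h1 h2 X Y : path_init u1 u2 h1 h2 X Y -> (forall t, 0 <= t <= T -> pd (X t)) ->
    exists l k, [/\ 0 < l, 0 < k, forall t, 0 <= t <= T -> psd (X t - l%:M) &
      forall t, 0 <= t <= T -> mxsum (X t) + mxsum (Y t) <= k].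
  move=> [_ [[_ _ cX cY] sXY]] pX.
  have [l l0 hl] := pd_uniform cX (fun s => (sXY s).1) pX.
  have cN : continuous (fun t => mxsum (X t) + mxsum (Y t)).
    have cZ (Z : R -> M) : mcont Z -> continuous (fun t => mxsum (Z t)).
      move=> /(@mcont_mxsum R d Z 0); rewrite (_ : (fun _ => _) = fun t => mxsum (Z t))//.
      by apply/funext => t; rewrite subr0.
    by apply: contD; exact: cZ.
  have [k k0 hk] := path_bounded T cN.
  by exists l, k.
have [l [k [l0 k0 hl hk]]] := bnds _ _ _ _ pf pA.
have [l' [k' [l0' k0' hl' hk']]] := bnds _ _ _ _ pg pA'.
pose e := Num.min 1 (Num.min l l'); pose rho := Num.max k k'.
have e0 : 0 < e by rewrite !lt_min ltr01 l0.
have e01 : 0 < e <= 1 by rewrite e0 ge_min lexx.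
have r0 : 0 < rho by rewrite lt_max k0.
have el : e <= l by rewrite /e !ge_min lexx orbT.
have el' : e <= l' by rewrite /e !ge_min lexx !orbT.
have tr h1 h2 X Y : ric_solves T h1 h2 X Y ->
    (forall t, 0 <= t <= T -> psd (X t - e%:M)) ->
    (forall t, 0 <= t <= T -> mxsum (X t) + mxsum (Y t) <= rho) ->
    trunc_solves alpha b B c gamma m nu H rho e T h1 h2 X Y.
  move=> sol pe hr t /andP[t0 tT]; have tT' : 0 <= t <= T by rewrite !ltW.
  have [E1 E2 E3 E4] := field_eq (ltW e0) (pe t tT') (or_introl (conj r0 (hr t tT'))).
  by rewrite E1 E2 E3 E4; apply: sol; rewrite t0.
apply: (trunc_unique adm r0 e01 pf pg); apply: tr => // t tT.
- exact: psd_scalar_le el (hl t tT).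
- by rewrite le_max hk.
- exact: psd_scalar_le el' (hl' t tT).
- by rewrite le_max hk' ?orbT.
Qed.

Lemma solves_near (F1 F2 : M -> M -> R) (R1 R2 : M -> M -> M) t f1 f2 A C g1 g2 A' C' :
  (\forall s \near t, [/\ f1 s = g1 s, f2 s = g2 s, A s = A' s & C s = C' s]) ->
  [/\ is_derive t 1 f1 (F1 (A t) (C t)), is_derive t 1 f2 (F2 (A t) (C t)),
      mder t A (R1 (A t) (C t)) & mder t C (R2 (A t) (C t))] ->
  [/\ is_derive t 1 g1 (F1 (A' t) (C' t)), is_derive t 1 g2 (F2 (A' t) (C' t)),
      mder t A' (R1 (A' t) (C' t)) & mder t C' (R2 (A' t) (C' t))].
Proof.
move=> near_eq [d1 d2 d3 d4]; have [_ _ eA eC] := nbhs_singleton near_eq.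
rewrite -eA -eC; split.
- by apply: near_eq_is_derive d1; apply: filterS near_eq => s [].
- by apply: near_eq_is_derive d2; apply: filterS near_eq => s [].
- by move=> i j; apply: near_eq_is_derive (d3 i j); apply: filterS near_eq => s [_ _ ->].
- by move=> i j; apply: near_eq_is_derive (d4 i j); apply: filterS near_eq => s [_ _ _ ->].
Qed.

(** The solutions on [[0, n]] agree by uniqueness and are glued; continuity and the equations are
    local, and near each time a single [n] represents the glued path. *)
Lemma riccati_global u1 u2 : pd u1 -> sym u2 ->
  exists f1 f2 A C, [/\ path_init u1 u2 f1 f2 A C, forall T, ric_solves T f1 f2 A C &
    forall t, 0 <= t -> 0 <= f1 t /\ pd (A t)].
Proof.
move=> pu su.
have /choice[S hS] : forall n : nat, exists S : (R -> R) * (R -> R) * (R -> M) * (R -> M),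
    let: (f1, f2, A, C) := S in
    [/\ path_init u1 u2 f1 f2 A C, ric_solves n%:R f1 f2 A C &
        forall t, 0 <= t <= n%:R -> 0 <= f1 t /\ pd (A t)].
  move=> n; have [f1 [f2 [A [C h]]]] := @riccati_local n%:R u1 u2 (ler0n _ _) pu su.
  by exists (f1, f2, A, C).
pose s1 n := (S n).1.1.1; pose s2 n := (S n).1.1.2.
pose sA n := (S n).1.2; pose sC n := (S n).2.
have {}hS n : [/\ path_init u1 u2 (s1 n) (s2 n) (sA n) (sC n),
    ric_solves n%:R (s1 n) (s2 n) (sA n) (sC n) &
    forall t, 0 <= t <= n%:R -> 0 <= s1 n t /\ pd (sA n t)].
  by have := hS n; rewrite /s1 /s2 /sA /sC; case: (S n) => -[[? ?] ?] ?.
(* [p] freezes negative times, and [N t] is an index whose interval [[0, N t]] contains [p t]. *)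
pose p t := Num.max t 0; pose N t := Num.bound (p t).
have p0 t : 0 <= p t by rewrite /p le_max lexx orbT.
have pN t : p t <= (N t)%:R by apply/ltW/archi_boundP.
pose f1 t := s1 (N t) (p t); pose f2 t := s2 (N t) (p t).
pose A t := sA (N t) (p t); pose C t := sC (N t) (p t).
have agree (n k : nat) t : 0 <= t -> t <= n%:R -> t <= k%:R ->
    [/\ s1 n t = s1 k t, s2 n t = s2 k t, sA n t = sA k t & sC n t = sC k t].
  wlog nk : n k / (n <= k)%N.
    move=> h t0 tn tk; have [nk|/ltnW kn] := leqP n k; first exact: h.
    by have [-> -> -> ->] := h k n kn t0 tk tn.
  move=> t0 tn _; have [i1 e1 g1] := hS n; have [i2 e2 g2] := hS k.
  have nk' : n%:R <= k%:R :> R by rewrite ler_nat.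
  have e2' : ric_solves n%:R (s1 k) (s2 k) (sA k) (sC k).
    by move=> s /andP[s0 sn]; apply: e2; rewrite s0 (lt_le_trans sn nk').
  have g2' s : 0 <= s <= n%:R -> pd (sA k s).
    move=> /andP[s0 sn]; have sk : 0 <= s <= k%:R by rewrite s0 (le_trans sn nk').
    exact: (g2 s sk).2.
  have tn' : 0 <= t <= n%:R by rewrite t0.
  exact: (riccati_path_unique (ler0n R n) i1 i2 e1 e2' (fun s sn => (g1 s sn).2) g2' tn').
have E (n : nat) t : p t <= n%:R ->
    [/\ f1 t = s1 n (p t), f2 t = s2 n (p t), A t = sA n (p t) & C t = sC n (p t)].
  by move=> tn; exact: agree.
have near_p t : exists n : nat, \forall s \near t, p s <= n%:R.
  exists (Num.bound (p t + 1)); near=> s.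
  apply: (@le_trans _ _ (p t + 1)); last first.
    by apply/ltW/archi_boundP; rewrite addr_ge0.
  near: s; have := @cont_max0 R t => /cvgrPdist_le /(_ 1 ltr01).
  by apply: filterS => s; rewrite ler_distlC => /andP[].
exists f1, f2, A, C; split.
- split; last split.
  + have pz : p 0 = 0 by rewrite /p maxxx.
    have [[[i1 i2 i3 i4] _] _ _] := hS (N 0).
    by rewrite /f1 /f2 /A /C pz.
  + have cN (Y : Type) (F : R -> R) (G : nat -> R -> R) :
        (forall n, continuous (G n)) -> (forall (n : nat) t, p t <= n%:R -> F t = G n (p t)) ->
        continuous F.
      move=> cG FG t; have [n hn] := near_p t.
      have cGp : continuous (fun s => G n (p s)).
        by apply: cont_comp => //; exact: cont_max0.
      have Ft : F t = G n (p t) by apply: FG; exact: nbhs_singleton hn.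
      rewrite /continuous_at Ft; apply: cvg_trans (cGp t); apply: near_eq_cvg.
      by apply: filterS hn => s /FG ->.
    split.
    * apply: (cN R f1 s1) => [n|n t /E[]//].
      by have [[_ [[]]]] := hS n.
    * apply: (cN R f2 s2) => [n|n t /E[]//].
      by have [[_ [[]]]] := hS n.
    * move=> i j; apply: (cN R _ (fun n s => sA n s i j)) => [n|n t /E[_ _ -> _]//].
      by have [[_ [[_ _ h _]]] _ _ _] := hS n; exact: h.
    * move=> i j; apply: (cN R _ (fun n s => sC n s i j)) => [n|n t /E[_ _ _ ->]//].
      by have [[_ [[_ _ _ h]]] _ _ _] := hS n; exact: h.
  + move=> t; have [[_ [_ h]] _ _] := hS (N t); exact: h.
- move=> T t /andP[t0 _]; have [n hn] := near_p t.
  have [k hk] : exists k : nat, t < k%:R by exists (Num.bound t); apply/archi_boundP/ltW.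
  pose q := maxn n k.
  have [_ sol _] := hS q.
  have tq : 0 < t < q%:R by rewrite t0 (lt_le_trans hk)// ler_nat leq_maxr.
  apply: solves_near (sol t tq); near=> s.
  have ps : p s = s by rewrite /p max_l//; near: s; exact: lt_le_nbhsr.
  have sq : p s <= q%:R.
    apply: (@le_trans _ _ n%:R); last by rewrite ler_nat leq_maxl.
    by near: s.
  by have [-> -> -> ->] := E q s sq; rewrite ps.
- move=> t t0; have [_ _ h] := hS (N t); apply: h.
  by rewrite p0 pN.
Unshelve. all: by end_near. Qed.

Lemma riccati_solutionP u1 u2 f1 f2 A C : path_init u1 u2 f1 f2 A C ->
  (forall T, ric_solves T f1 f2 A C) -> (forall t, 0 <= t -> 0 <= f1 t /\ pd (A t)) ->
  riccati_solution alpha b B c gamma m nu H u1 u2 f1 f2 A C.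
Proof.
move=> [init [[c1 c2 cA cC] sAC]] sol good; split=> //; split; last split.
- by move=> t t0; have [? ?] := good t t0; split=> //; exact: (sAC t).2.
- by split; apply: continuous_subspaceT => //; exact: mcont_continuous.
- move=> t t0; have [|d1 d2 d3 d4] := sol (t + 1) t; first by rewrite t0 ltrDl ltr01.
  by split=> //; exact: mder_is_derive.
Qed.

(** [riccati_solution] constrains only times [t >= 0]; precomposing with the positive part gives
    paths on the whole line, to which the uniqueness result applies. *)
Lemma riccati_solution_path u1 u2 f1 f2 A C :
  riccati_solution alpha b B c gamma m nu H u1 u2 f1 f2 A C ->
  let p t := Num.max t 0 in
  [/\ path_init u1 u2 (f1 \o p) (f2 \o p) (A \o p) (C \o p),
      forall T, ric_solves T (f1 \o p) (f2 \o p) (A \o p) (C \o p) &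
      forall t, 0 <= t -> 0 <= f1 t /\ pd (A t)].
Proof.
move=> [init [good [[c1 c2 cA cC] sol]]] p.
have p0 t : 0 <= p t by rewrite /p le_max lexx orbT.
split.
- split; first by rewrite /= /p maxxx.
  split; last by move=> t; have [_ [sA _] sC] := good (p t) (p0 t).
  split; [exact: within_ge0_continuous|exact: within_ge0_continuous| |].
    by apply: continuous_mcont; exact: within_ge0_continuous.
  by apply: continuous_mcont; exact: within_ge0_continuous.
- move=> T t /andP[t0 _]; have [d1 d2 d3 d4] := sol t t0.
  have pt : p t = t by rewrite /p max_l// ltW.
  rewrite /= pt; split.
  + exact: (der_max0 t0 d1).
  + exact: (der_max0 t0 d2).
  + by move=> i j; exact: (der_max0 t0 (is_derive_mder d3 i j)).
  + by move=> i j; exact: (der_max0 t0 (is_derive_mder d4 i j)).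
- by move=> t t0; have [] := good t t0.
Qed.

Lemma riccati_unique u1 u2 f1 f2 A C g1 g2 A' C' :
  riccati_solution alpha b B c gamma m nu H u1 u2 f1 f2 A C ->
  riccati_solution alpha b B c gamma m nu H u1 u2 g1 g2 A' C' ->
  forall t, 0 <= t -> [/\ f1 t = g1 t, f2 t = g2 t, A t = A' t & C t = C' t].
Proof.
move=> /riccati_solution_path[i1 e1 h1] /riccati_solution_path[i2 e2 h2] t t0.
have := riccati_path_unique t0 i1 i2 (e1 t) (e2 t) => /(_ _ _ t).
rewrite /= (max_l t0); apply; last by rewrite t0 lexx.
- by move=> s /andP[s0 _]; rewrite /= (max_l s0); exact: (h1 s s0).2.
- by move=> s /andP[s0 _]; rewrite /= (max_l s0); exact: (h2 s s0).2.
Qed.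

End RiccatiSolutions.

(** * Damped waves and their derivatives *)

Section DampedWaves.
Variables (R : realType) (d : nat).
Notation M := 'M[R]_d.
Implicit Types (a th : R) (A C x v : M).

(* Real part of [exp (- (a - i th) - <A + i C, x>)] up to the sign of [th];
   shifting [th] by [pi / 2] gives the imaginary part. *)
Definition wave a th A C x : R := expR (- (a + inner A x)) * cos (th + inner C x).

Lemma wave_norm a th A C x : `|wave a th A C x| <= expR (- (a + inner A x)).
Proof.
by rewrite /wave normrM ger0_norm ?expR_ge0// ler_piMr ?expR_ge0// cos_norm_le1.
Qed.

Lemma wave_shift a th A C x :
  wave a (th + pi / 2) A C x = - (expR (- (a + inner A x)) * sin (th + inner C x)).
Proof.
rewrite /wave (_ : th + pi / 2 + inner C x = th + inner C x + pi / 2); last by ring.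
by rewrite cosDpihalf mulrN.
Qed.

Lemma wave_shift2 a th A C x :
  wave a (th + pi / 2 + pi / 2) A C x = - wave a th A C x.
Proof.
rewrite wave_shift /wave (_ : th + pi / 2 + inner C x = th + inner C x + pi / 2); last by ring.
by rewrite sinDpihalf.
Qed.

Lemma cont_wave a th A C : continuous (wave a th A C).
Proof.
apply: contM.
  by apply: cont_expR; apply: contN; apply: contD; [exact: cont_cst|exact: cont_innerr].
by apply: cont_cos; apply: contD; [exact: cont_cst|exact: cont_innerr].
Qed.

Lemma is_derive_line (f : M -> R) x v (l : R) :
  is_derive (0 : R) 1 (fun s => f (s *: v + x)) l -> is_derive x v f l.
Proof.
move=> [dv ev].
have E : (fun h : R => h^-1 *: ((f \o shift x) (h *: v) - f x))
    = (fun h : R => h^-1 *: (((fun s => f (s *: v + x)) \o shift 0) (h *: (1 : R))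
         - (fun s => f (s *: v + x)) 0)).
  apply/funext => h /=; congr (_ *: (f (_ *: _ + _) - f _)).
    by rewrite addr0 /GRing.scale /= mulr1.
  by rewrite scale0r add0r.
split; first by rewrite /derivable E.
by rewrite /derive E.
Qed.

Lemma wave_derive a th A C x v : is_derive x v (wave a th A C)
  (- inner A v * wave a th A C x + inner C v * wave a (th + pi / 2) A C x).
Proof.
apply: is_derive_line.
have lin (B : M) : (fun s : R => inner B (s *: v + x)) = (fun s => inner B v * s + inner B x).
  by apply/funext => s; rewrite innerDr innerZr mulrC.
have dl (B : M) (k : R) : is_derive (0 : R) 1 (fun s => k + inner B (s *: v + x)) (inner B v).
  rewrite (_ : (fun _ => _) = fun s => k + (inner B v * s + inner B x)).
    apply: is_derive_val (derD (der_cst k 0) (derD (derZ _ (der_id 0)) (der_cst _ 0))).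
    by rewrite add0r addr0 mulr1.
  by apply/funext => s; rewrite innerDr innerZr mulrC.
have := derM (der_expR (derN (dl A a))) (der_cos (dl C th)).
apply: is_derive_val; rewrite wave_shift /wave scale0r add0r; ring.
Qed.

(** The span of a wave and its quarter-period shift is stable under directional derivatives, because
    two shifts change the sign. Hence all iterated derivatives needed for rapid decrease stay in
    this two-parameter family. *)
Definition wave2 a th A C (p q : R) x : R :=
  p * wave a th A C x + q * wave a (th + pi / 2) A C x.

Lemma is_derive_val' (f : M -> R) x v (k l : R) :
  k = l -> is_derive x v f k -> is_derive x v f l.
Proof. by move=> ->. Qed.

Lemma wave2_derive a th A C (p q : R) x v : is_derive x v (wave2 a th A C p q)
  (wave2 a th A C (- inner A v * p - inner C v * q) (inner C v * p - inner A v * q) x).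
Proof.
have h := is_deriveD (is_deriveZ p (wave_derive a th A C x v))
  (is_deriveZ q (wave_derive a (th + pi / 2) A C x v)).
apply: is_derive_val' h; rewrite wave_shift2 /wave2 /GRing.scale /=; ring.
Qed.

Lemma Dn_wave2 a th A C (p q : R) (vs : seq M) :
  exists p' q', Dn vs (wave2 a th A C p q) = wave2 a th A C p' q'.
Proof.
elim: vs => [|v vs [p' [q' IH]]]; first by exists p, q.
exists (- inner A v * p' - inner C v * q'), (inner C v * p' - inner A v * q').
apply/funext => x; rewrite /= IH.
by case: (wave2_derive a th A C p' q' x v).
Qed.

Lemma cont_wave2 a th A C (p q : R) : continuous (wave2 a th A C p q).
Proof.
by apply: contD; apply: contM; [exact: cont_cst|exact: cont_wave|exact: cont_cst|exact: cont_wave].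
Qed.

Lemma wave2_wave a th A C : wave2 a th A C 1 0 = wave a th A C.
Proof. by apply/funext => x; rewrite /wave2 mul1r mul0r addr0. Qed.

Lemma pow_exp_bounded (k : nat) (l : R) : 0 < l ->
  exists K : R, forall r, 0 <= r -> (1 + r) ^+ k * expR (- (l * r)) <= K.
Proof.
(* Dividing by [k.+1] rather than [k] covers [k = 0]; the [k]-th power of [exp (L * r)] still has
   rate at most [l]. *)
move=> l0; pose L := l / k.+1%:R; have L0 : 0 < L by rewrite divr_gt0.
pose K := 1 + L^-1; have K1 : 1 <= K by rewrite lerDl invr_ge0 ltW.
exists (K ^+ k) => r r0.
have h1 : 1 + r <= K * expR (L * r).
  apply: (@le_trans _ _ (K * (1 + L * r))).
    rewrite /K (_ : (1 + L^-1) * (1 + L * r) = 1 + r + (L^-1 + L * r)); last first.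
      by field; rewrite gt_eqF.
    by rewrite lerDl; apply: addr_ge0; [rewrite invr_ge0 ltW|rewrite mulr_ge0// ltW].
  by rewrite ler_wpM2l ?expR_ge1Dx// (le_trans ler01).
have h2 : (1 + r) ^+ k <= K ^+ k * expR (L * r) ^+ k.
  by rewrite -exprMn lerXn2r// ?nnegrE ?addr_ge0 ?mulr_ge0 ?expR_ge0// (le_trans ler01).
apply: le_trans (ler_wpM2r (expR_ge0 _) h2) _.
rewrite -mulrA ler_piMr ?exprn_ge0 ?(le_trans ler01)//.
rewrite -expRM_natl -expRD expR_le1 subr_le0 -mulr_natl mulrA ler_wpM2r//.
rewrite /L mulrCA ler_piMr ?(ltW l0)// ler_pdivrMr ?ltr0Sn// mul1r.
by rewrite mulr1 ler_nat.
Qed.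

Lemma wave_rapidly_decreasing a th A C : pd A -> rapidly_decreasing (wave a th A C).
Proof.
move=> /pdP[l l0 pl]; rewrite -wave2_wave; split=> [vs v _ _|k vs _].
  have [p [q ->]] := Dn_wave2 a th A C 1 0 vs.
  split=> [|x]; first exact: cont_wave2.
  by case: (wave2_derive a th A C p q x v).
have [p [q ->]] := Dn_wave2 a th A C 1 0 vs.
have [K hK] := pow_exp_bounded k l0.
exists (K * ((`|p| + `|q|) * expR (- a))) => x px.
have w0 t : `|wave a t A C x| <= expR (- a) * expR (- (l * fnorm x)).
  apply: le_trans (wave_norm _ _ _ _ _) _; rewrite -expRD ler_expR opprD lerD2l lerN2.
  apply: le_trans (inner_coercive pl px).
  by rewrite ler_pM2l// fnorm_le_tr.
apply: (@le_trans _ _ ((1 + fnorm x) ^+ k *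
    ((`|p| + `|q|) * (expR (- a) * expR (- (l * fnorm x)))))).
  rewrite ler_wpM2l ?exprn_ge0 ?addr_ge0 ?fnorm_ge0//.
  apply: le_trans (ler_normD _ _) _.
  rewrite [leRHS]mulrDl (normrM p) (normrM q).
  by apply: lerD; apply: ler_wpM2l.
rewrite (_ : _ * _ = ((1 + fnorm x) ^+ k * expR (- (l * fnorm x)))
  * ((`|p| + `|q|) * expR (- a))); last by ring.
rewrite ler_wpM2r ?mulr_ge0 ?addr_ge0 ?expR_ge0// hK// fnorm_ge0//.
Qed.

End DampedWaves.

(** * The generator on damped waves *)

Section GeneratorOfWaves.
Variables (R : realType) (d : nat) (alpha b : 'M[R]_d) (B : 'M[R]_d -> 'M[R]_d).
Variables (c : R) (gamma : 'M[R]_d) (m nu : {measure set (Mx R d) -> \bar R}).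
Variable H : 'M[R]_d -> 'M[R]_d.
Hypothesis adm : admissible alpha b B c gamma m nu H.
Notation M := 'M[R]_d.
Notation D := (@psdset0 R d).
Notation F1 := (ricF1 b c m).
Notation F2 := (ricF2 b m).
Notation R1 := (ricR1 alpha B gamma nu H).
Notation R2 := (ricR2 alpha B nu H).
Implicit Types (a th : R) (A C x v : M).

(** For [e] below the margin of [A] the integrand coincides with a truncated exponential, whose
    bound is known. *)
Lemma cexp_re_bound A C : pd A -> exists K, forall xi, D xi ->
  `|cexp_re (inner A xi) (inner C xi) - 1| <= K * Num.min (fnorm xi) 1.
Proof.
move=> /pdP[l l0 pl]; pose e := Num.min 1 l.
have e0 : 0 < e by rewrite lt_min ltr01.
have e01 : 0 <= e <= 1 by rewrite (ltW e0) ge_min lexx.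
have pe : psd (A - e%:M) by apply: psd_scalar_le pl; rewrite ge_min lexx orbT.
exists (2 * (mxsum A + mxsum C + 1)) => xi [pxi _].
by rewrite -(trunc_exp_re _ (ltW e0) pe pxi); exact: trunc_exp_bound.
Qed.

Lemma cexp_im_bound A C : pd A -> exists K, forall xi, D xi ->
  `|cexp_im (inner A xi) (inner C xi)| <= K * Num.min (fnorm xi) 1.
Proof.
move=> /pdP[l l0 pl]; pose e := Num.min 1 l.
have e0 : 0 < e by rewrite lt_min ltr01.
have e01 : 0 <= e <= 1 by rewrite (ltW e0) ge_min lexx.
have pe : psd (A - e%:M) by apply: psd_scalar_le pl; rewrite ge_min lexx orbT.
exists (2 * (mxsum A + mxsum C + 1)) => xi [pxi _].
by rewrite -(trunc_exp_im _ (ltW e0) pe pxi); exact: trunc_exp_bound.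
Qed.

Lemma cexp_re_measurable A C :
  measurable_fun D (fun xi : Mx R d => cexp_re (inner A xi) (inner C xi) - 1).
Proof.
apply: (@cont_measurable R d (fun xi => cexp_re (inner A xi) (inner C xi) - 1)).
  exact: measurable_psdset0.
apply: contB; last exact: cont_cst.
by apply: contM; [apply: cont_expR; apply: contN|apply: cont_cos]; exact: cont_innerr.
Qed.

Lemma cexp_im_measurable A C :
  measurable_fun D (fun xi : Mx R d => cexp_im (inner A xi) (inner C xi)).
Proof.
apply: (@cont_measurable R d (fun xi => cexp_im (inner A xi) (inner C xi))).
  exact: measurable_psdset0.
apply: contN.
apply: contM; first by apply: cont_expR; apply: contN; exact: cont_innerr.
by apply: (cont_comp (@continuous_sin R)); exact: cont_innerr.
Qed.

Lemma wave_jump a th A C x xi : wave a th A C (x + xi) - wave a th A C x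
  = wave a th A C x * (cexp_re (inner A xi) (inner C xi) - 1)
    - wave a (th + pi / 2) A C x * cexp_im (inner A xi) (inner C xi).
Proof.
rewrite wave_shift /wave /cexp_re /cexp_im !innerDr.
have -> : - (a + (inner A x + inner A xi)) = - (a + inner A x) + - inner A xi by ring.
have -> : th + (inner C x + inner C xi) = th + inner C x + inner C xi by ring.
by rewrite expRD cosD; ring.
Qed.

Lemma grad_wave2 a th A C (p q : R) x : sym A -> sym C ->
  grad (wave2 a th A C p q) x
    = wave2 a th A C p q x *: (- A) + wave2 a (th + pi / 2) A C p q x *: C.
Proof.
move=> sA sC; apply/matrixP => i j; rewrite !mxE.
have [_ ->] := wave2_derive a th A C p q x (Sij R i j).
by rewrite !inner_Sij// /wave2 wave_shift2; ring.
Qed.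

(** The index pattern of the diffusion part of [generator] once the Hessian splits into products of
    two matrix entries: the four-fold sum is [\tr (x z y w)]. *)
Lemma inner_sum4 (x y z w : M) : \sum_(i < d) \sum_(j < d) \sum_(k < d) \sum_(l < d)
  (x l i * y j k * (z i j * w k l) : R) = inner x (z *m y *m w).
Proof.
have E i : \sum_j \sum_k \sum_l (x l i * y j k * (z i j * w k l) : R)
    = \sum_l x l i * (z *m y *m w) i l.
  under [RHS]eq_bigr => l _ do rewrite mxE mulr_sumr.
  rewrite [RHS]exchange_big /=.
  under [RHS]eq_bigr => k _.
    under eq_bigr => l _ do rewrite mxE mulr_suml mulr_sumr.
    over.
  rewrite /= exchange_big /=; apply: eq_bigr => k _.
  rewrite exchange_big /=; apply: eq_bigr => l _.
  by apply: eq_bigr => j _; ring.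
rewrite innerE [RHS]exchange_big /=; apply: eq_bigr => i _.
by rewrite E.
Qed.

(** For the complex function [w = exp (- (a + i th) - <A + i C, x>)] the generator gives
    [- (F + <R, x>) w] with [F = F1 + i F2] and [R = R1 + i R2]. This is its real part; the wave
    with phase [th + pi / 2] is the imaginary part of [w]. *)
Lemma generator_wave a th A C x : pd A -> sym C -> psd x ->
  generator alpha b B c gamma m nu H (wave a th A C) x
    = - (F1 A C + inner (R1 A C) x) * wave a th A C x
      + (F2 A C + inner (R2 A C) x) * wave a (th + pi / 2) A C x.
Proof.
move=> pA sC px; have sA := pA.1.
set G := wave a th A C x; set G' := wave a (th + pi / 2) A C x.
rewrite /generator.
have gradE y : grad (wave a th A C) y
    = wave a th A C y *: (- A) + wave a (th + pi / 2) A C y *: C.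
  by have := grad_wave2 a th 1 0 y sA sC; rewrite !wave2_wave.
have grad2 i j k l : grad (fun y => grad (wave a th A C) y k l) x i j
    = G * (A i j * A k l) - G * (C i j * C k l)
      - G' * (A i j * C k l) - G' * (C i j * A k l).
  rewrite (_ : (fun y => grad _ y k l) = wave2 a th A C (- A k l) (C k l)).
    by rewrite grad_wave2// !mxE /wave2 wave_shift2 -/G -/G'; ring.
  by apply/funext => y; rewrite gradE !mxE /wave2; ring.
have second : \sum_(i < d) \sum_(j < d) \sum_(k < d) \sum_(l < d)
      x l i * alpha j k * grad (fun y => grad (wave a th A C) y k l) x i j
    = G * inner x (quad1 alpha A C) - G' * inner x (quad2 alpha A C).
  rewrite /quad1 /quad2 innerBr innerDr -!inner_sum4 mulrBr mulrDr opprD.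
  rewrite !mulr_sumr -!sumrN -!big_split /=; apply: eq_bigr => i _.
  rewrite !mulr_sumr -!sumrN -!big_split /=; apply: eq_bigr => j _.
  rewrite !mulr_sumr -!sumrN -!big_split /=; apply: eq_bigr => k _.
  rewrite !mulr_sumr -!sumrN -!big_split /=; apply: eq_bigr => l _.
  by rewrite grad2; ring.
have [K1 hK1] := cexp_re_bound C pA; have [K2 hK2] := cexp_im_bound C pA.
have mD := @measurable_psdset0 R d.
have mre := cexp_re_measurable A C; have mim := cexp_im_measurable A C.
set re := fun xi : M => cexp_re (inner A xi) (inner C xi) - 1.
set im := fun xi : M => cexp_im (inner A xi) (inner C xi).
have im1 : m.-integrable D (EFin \o re).
  have := levy_integrable (@mcst1 R d) (@cst1_le R d) (adm_iWm adm) mre hK1.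
  by rewrite (_ : (fun xi => _) = re)//; apply/funext => xi; rewrite mulr1.
have im2 : m.-integrable D (EFin \o im).
  have := levy_integrable (@mcst1 R d) (@cst1_le R d) (adm_iWm adm) mim hK2.
  by rewrite (_ : (fun xi => _) = im)//; apply/funext => xi; rewrite mulr1.
have jm : \int[m]_(xi in D) (wave a th A C (x + xi) - G)
    = G * \int[m]_(xi in D) re xi - G' * \int[m]_(xi in D) im xi.
  rewrite -!RintegralZl// -RintegralB//.
  - by apply: eq_Rintegral => xi _; rewrite wave_jump.
  - exact: (integrableZl mD G im1).
  - exact: (integrableZl mD G' im2).
have [in1 e1] := inner_levy adm x mre hK1.
have [in2 e2] := inner_levy adm x mim hK2.
have jn : \int[nu]_(xi in D) ((wave a th A C (x + xi) - G) * inner (H xi) x)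
    = G * inner (mu_integral nu H re) x - G' * inner (mu_integral nu H im) x.
  rewrite e1 e2 -!RintegralZl// -RintegralB//.
  - by apply: eq_Rintegral => xi _; rewrite wave_jump mulrBl !mulrA.
  - exact: (integrableZl mD G in1).
  - exact: (integrableZl mD G' in2).
rewrite second jm jn gradE -/G -/G' /ricF1 /ricF2 /ricR1 /ricR2.
rewrite -/re -/im (innerC x (quad1 _ _ _)) (innerC x (quad2 _ _ _)) (innerC b A) (innerC b C).
have aA : inner A (B x) = inner (adjoint B A) x by rewrite (adjointP adm)//; exact: px.1.
have aC : inner C (B x) = inner (adjoint B C) x by rewrite (adjointP adm)//; exact: px.1.
move: (quad1 alpha A C) (quad2 alpha A C) (mu_integral nu H re) (mu_integral nu H im) => q1 q2 M1 M2.
rewrite !innerDl !innerNl !innerZl !innerNl !innerDr aA aC.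
move: (adjoint B A) (adjoint B C) => a1 a2.
by ring.
Qed.

End GeneratorOfWaves.

(** * Comparison of trigonometric functions with real exponentials *)

Section HyperbolicBounds.
Variable R : realType.
Implicit Types (a b e y z : R).

Lemma exp_sub_ge a : 0 <= a -> 2 * a <= expR a - expR (- a).
Proof.
move=> a0; pose f z := expR (1 * z) - expR (-1 * z) - 2 * z.
pose f' z := expR (1 * z) * 1 - expR (-1 * z) * (-1) - 2 * 1.
have cf : continuous f.
  apply: contB; first by apply: contB; exact: cont_expRM.
  by apply: contM; [exact: cont_cst|move=> t; exact: cvg_id].
have df t : 0 < t < a -> is_derive t 1 f (f' t).
  move=> _; exact: derB (derB (der_expRM 1 t) (der_expRM (-1) t)) (derZ 2 (der_id t)).
have f0 t : 0 < t < a -> 0 <= f' t.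
  move=> _; rewrite /f' !mulr1 mul1r mulN1r mulrN1 opprK subr_ge0 expRN.
  have := expR_gt0 t; set r := expR t => r0.
  rewrite -subr_ge0; have -> : r + r^-1 - 2 = (r - 1) ^+ 2 / r by field; rewrite gt_eqF.
  by rewrite divr_ge0 ?sqr_ge0// ltW.
have := cont_deriv_ge0 cf df f0 (lexx 0) a0 (lexx a).
by rewrite /f !mulr0 expR0 subrr subrr mul1r mulN1r subr_ge0.
Qed.

(** [cosh y - 1 = 2 * sinh (y / 2) ^ 2], visible with [r = exp (y / 2)], and [sinh (y / 2) >= y / 2]
    for [y >= 0] by [exp_sub_ge]. *)
Lemma sqr_le_cosh y : y ^+ 2 / 2 <= (expR y + expR (- y)) / 2 - 1.
Proof.
wlog y0 : y / 0 <= y.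
  move=> h; have [/h//|/ltW y0] := leP 0 y.
  by have := h (- y); rewrite sqrrN opprK oppr_ge0 => /(_ y0); lra.
pose r := expR (y / 2); have r0 : 0 < r by exact: expR_gt0.
have e1 : expR y = r ^+ 2 by rewrite /r expr2 -expRD -splitr.
have e2 : expR (- y) = (r^-1) ^+ 2 by rewrite expRN e1 exprVn.
have h : y <= r - r^-1.
  have := @exp_sub_ge (y / 2); rewrite divr_ge0// => /(_ isT).
  by rewrite expRN -/r mulrC divfK.
rewrite e1 e2; have -> : (r ^+ 2 + r^-1 ^+ 2) / 2 - 1 = (r - r^-1) ^+ 2 / 2.
  by field; rewrite gt_eqF.
by rewrite ler_pM2r// lerXn2r// nnegrE// (le_trans y0).
Qed.

(** The two one-sided bounds amount to [1 - y <= exp (- y)] and [1 + y <= exp y]. *)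
Lemma sinh_sub_le y :
  `|(expR y - expR (- y)) / 2 - y| <= (expR y + expR (- y)) / 2 - 1.
Proof.
have h1 := expR_ge1Dx y; have h2 := expR_ge1Dx (- y).
by rewrite ler_norml; apply/andP; split; lra.
Qed.

Lemma sin_norm_le a : `|sin a| <= `|a|.
Proof.
have := cos_lipschitz (a + - (pi / 2)) (- (pi / 2)).
have -> : cos (a + - (pi / 2)) = sin a by rewrite -sinDpihalf subrK.
by rewrite cosN cos_pihalf subr0 addrK.
Qed.

Lemma half_sqr_bound (f f' : R -> R) a : continuous f ->
  (forall t : R, is_derive t 1 f (f' t)) -> (forall t, `|f' t| <= `|t|) -> f 0 = 0 ->
  0 <= a -> `|f a| <= a ^+ 2 / 2.
Proof.
move=> cf df hf f0 a0; rewrite expr2.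
apply: (@deriv_bound R f f' (fun t => t * t / 2) (fun t => t) a) => //.
- apply: contM; last exact: cont_cst.
  by apply: contM => t; exact: cvg_id.
- move=> t _; have := derM (derM (der_id t) (der_id t)) (der_cst 2^-1 t).
  by apply: is_derive_val; field.
- by move=> t /andP[t0 _]; rewrite (le_trans (hf t))// gtr0_norm.
- by rewrite f0 normr0 mul0r mul0r.
- by rewrite a0 lexx.
Qed.

Lemma cos_sub1_le a : `|cos a - 1| <= a ^+ 2 / 2.
Proof.
wlog a0 : a / 0 <= a.
  move=> h; have [/h//|/ltW a0] := leP 0 a.
  by have := h (- a); rewrite sqrrN cosN oppr_ge0; exact.
apply: (@half_sqr_bound (fun t => cos t - 1) (fun t => - sin t * 1 - 0)) => //.
- apply: contB; last exact: cont_cst.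
  by apply: cont_cos => t; exact: cvg_id.
- by move=> t; exact: derB (der_cos (der_id t)) (der_cst 1 t).
- by move=> t; rewrite subr0 mulr1 normrN sin_norm_le.
- by rewrite cos0 subrr.
Qed.

Lemma sin_sub_le a : `|sin a - a| <= a ^+ 2 / 2.
Proof.
wlog a0 : a / 0 <= a.
  move=> h; have [/h//|/ltW a0] := leP 0 a.
  have := h (- a); rewrite sqrrN sinN oppr_ge0 => /(_ a0).
  by rewrite -opprD normrN.
apply: (@half_sqr_bound (fun t => sin t - t) (fun t => cos t * 1 - 1)) => //.
- apply: contB; last by move=> t; exact: cvg_id.
  exact: (@continuous_sin R).
- by move=> t; exact: derB (der_comp (is_derive_sin t) (der_id t)) (der_id t).
- move=> t; rewrite mulr1; have := cos_lipschitz t 0.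
  by rewrite cos0 subr0.
- by rewrite sin0 subrr.
Qed.

(* The remainder is itself a combination of real exponentials, so that small-time
   bounds on the semigroup pass from these to oscillating functions. *)
Lemma cos_cosh_bound e b z : 0 < e ->
  `|cos (b + z) - cos b + sin b / (2 * e) * (expR (e * z) - expR (- (e * z)))|
    <= (2 / e ^+ 2 + e^-1) * ((expR (e * z) + expR (- (e * z))) / 2 - 1).
Proof.
move=> e0; set y := e * z; set ch := _ / 2 - 1.
have e2 : 0 < e ^+ 2 by rewrite exprn_gt0.
have zE : z ^+ 2 / 2 <= ch / e ^+ 2.
  rewrite ler_pdivlMr// (_ : z ^+ 2 / 2 * e ^+ 2 = y ^+ 2 / 2); last first.
    by rewrite /y exprMn; ring.
  exact: sqr_le_cosh.
have sh : `|(expR y - expR (- y)) / 2 / e - z| <= ch / e.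
  have -> : (expR y - expR (- y)) / 2 / e - z = ((expR y - expR (- y)) / 2 - y) / e.
    by rewrite /y; field; rewrite gt_eqF.
  rewrite normrM (gtr0_norm (_ : 0 < e^-1)) ?invr_gt0// ler_pM2r ?invr_gt0//.
  exact: sinh_sub_le.
(* [sinh (e z) / e], the stand-in for [sin z] built from real exponentials; both are within a
   multiple of [ch] of [z]. *)
set s := (expR y - expR (- y)) / 2 / e in sh.
have -> : cos (b + z) - cos b + sin b / (2 * e) * (expR y - expR (- y))
  = cos b * (cos z - 1) - sin b * (sin z - s).
  by rewrite cosD /s; field; rewrite gt_eqF.
have h1 : `|cos b * (cos z - 1)| <= ch / e ^+ 2.
  rewrite normrM; apply: le_trans zE; apply: le_trans (cos_sub1_le z).
  by rewrite ler_piMl// cos_norm_le1.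
have h2 : `|sin b * (sin z - s)| <= ch / e ^+ 2 + ch / e.
  rewrite normrM; apply: (@le_trans _ _ `|sin z - s|).
    by rewrite ler_piMl// ler_norml sin_geN1 sin_le1.
  have -> : sin z - s = (sin z - z) - (s - z) by ring.
  apply: le_trans (ler_normB _ _) _; apply: lerD => //.
  exact: le_trans (sin_sub_le z) zE.
apply: le_trans (ler_normB _ _) _; apply: le_trans (lerD h1 h2) _.
rewrite le_eqVlt; apply/orP; left; apply/eqP; ring.
Qed.

Lemma expR_sub1_le z : `|expR z - 1| <= expR `|z| - 1.
Proof.
have [z0|z0] := leP 0 z.
  by rewrite (ger0_norm z0) ger0_norm// subr_ge0 -[leLHS]expR0 ler_expR.
rewrite (ltr0_norm z0) ltr0_norm ?subr_lt0 ?expR_lt1//.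
have h1 := expR_ge1Dx z; have h2 := expR_ge1Dx (- z); lra.
Qed.

(** Turns a bound on the relative increment of an exponential into one on its exponent; the
    threshold [1 / 2] enters through [1 / (1 - k) <= 1 + 2 * k]. *)
Lemma small_log z (k : R) : k <= 1 / 2 -> `|expR z - 1| <= k -> `|z| <= 2 * k.
Proof.
move=> k2 h; have k0 : 0 <= k by exact: le_trans h.
have [z0|z0] := leP 0 z.
  have := expR_ge1Dx z; have := ler_norm (expR z - 1).
  by rewrite (ger0_norm z0); lra.
have hz := expR_ge1Dx (- z); rewrite expRN in hz.
have e1 : 1 - k <= expR z.
  by have := ler_norm (- (expR z - 1)); rewrite normrN; lra.
have e0 : 0 < 1 - k by lra.
have : (expR z)^-1 <= (1 - k)^-1 by rewrite lef_pV2// posrE// expR_gt0.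
have : (1 - k)^-1 <= 1 + 2 * k.
  rewrite -[leLHS]mul1r ler_pdivrMr//.
  have -> : (1 + 2 * k) * (1 - k) = 1 + k * (1 - 2 * k) by ring.
  by rewrite lerDl mulr_ge0// subr_ge0; lra.
by rewrite (ltr0_norm z0); lra.
Qed.

End HyperbolicBounds.

(** * Integration against a composition of kernels *)

Section KernelComposition.
Context d (X : measurableType d) (R : realType).
Variables (mu : {measure set X -> \bar R}) (q : X -> {measure set X -> \bar R}).
Hypothesis mu_fin : (mu [set: X] <= 1)%E.
Hypothesis q_meas : forall U, measurable U -> measurable_fun [set: X] (q ^~ U).
Hypothesis q_le1 : forall y, (q y [set: X] <= 1)%E.

(** [mu] becomes a kernel from the one-point space and [q] a kernel from its product with [X]: this
    is the shape in which [integral_kcomp] composes kernels. *)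
Definition cst_kernel (_ : unit) : {measure set X -> \bar R} := mu.
Definition snd_kernel (uy : unit * X) : {measure set X -> \bar R} := q uy.2.

Lemma cst_kernel_measurable U : measurable U ->
  measurable_fun [set: unit] (cst_kernel ^~ U).
Proof. by move=> _; exact: measurable_cst. Qed.

Lemma snd_kernel_measurable U : measurable U ->
  measurable_fun [set: unit * X] (snd_kernel ^~ U).
Proof. by move=> mU; exact: (measurableT_comp (q_meas mU) measurable_snd). Qed.

HB.instance Definition _ := isKernel.Build _ _ _ _ R cst_kernel cst_kernel_measurable.
HB.instance Definition _ := isKernel.Build _ _ _ _ R snd_kernel snd_kernel_measurable.

Lemma cst_kernel_uub : measure_fam_uub cst_kernel.
Proof. by exists 2 => u; apply: le_lt_trans mu_fin _; rewrite lte_fin ltr1n. Qed.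

Lemma snd_kernel_uub : measure_fam_uub snd_kernel.
Proof. by exists 2 => u; apply: le_lt_trans (q_le1 _) _; rewrite lte_fin ltr1n. Qed.

HB.instance Definition _ := Kernel_isFinite.Build _ _ _ _ R cst_kernel cst_kernel_uub.
HB.instance Definition _ := Kernel_isFinite.Build _ _ _ _ R snd_kernel snd_kernel_uub.

Lemma integral_composition (nu : {measure set X -> \bar R}) (f : X -> \bar R) :
  (forall U, measurable U -> nu U = \int[mu]_y q y U)%E ->
  (forall x, 0 <= f x)%E -> measurable_fun [set: X] f ->
  (\int[nu]_x f x = \int[mu]_y \int[q y]_z f z)%E.
Proof.
move=> hnu f0 mf.
have := @integral_kcomp _ _ _ _ _ _ R cst_kernel snd_kernel tt f f0 mf => /= <-.
by apply: eq_measure_integral => U mU _; rewrite hnu.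
Qed.

End KernelComposition.

(** * The transition semigroup on bounded measurable functions *)

Section AffineSemigroup.
Variables (R : realType) (d : nat).
Variable p : R -> 'M[R]_d -> {measure set (Mx R d) -> \bar R}.
Hypothesis aff : affine_transition p.
Notation M := 'M[R]_d.
Notation S := (@psdset R d).
Implicit Types (f g : M -> R) (x y : M) (s t K : R).

Definition semigroup t f x : R := \int[p t x]_(xi in S) f xi.
Notation P := semigroup.

Lemma p_le1 t x (A : set (Mx R d)) : 0 <= t -> psd x -> measurable A -> (p t x A <= 1)%E.
Proof.
move=> t0 px mA; case: aff => -[h _ _ _ _] _; have [_ h1] := h t x t0 px.
by apply: le_trans h1; apply: le_measure; rewrite ?inE//; exact: subsetT.
Qed.

Lemma bounded_integrable t f x K : 0 <= t -> psd x ->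
  measurable_fun S (f : Mx R d -> R) -> (forall y, psd y -> `|f y| <= K) ->
  (p t x).-integrable S (EFin \o f).
Proof.
move=> t0 px mf fK; apply: measurable_bounded_integrable.
- exact: measurable_psdset.
- by rewrite (le_lt_trans (p_le1 t0 px ((@measurable_psdset R d))))// ltry.
- exact: mf.
- exists K; split; first exact: num_real.
  by move=> k Kk y py; exact: le_trans (fK y py) (ltW Kk).
Qed.

Lemma semigroup_bound t f x K : 0 <= t -> psd x ->
  measurable_fun S (f : Mx R d -> R) -> (forall y, psd y -> `|f y| <= K) ->
  `|P t f x| <= K.
Proof.
move=> t0 px mf fK; have fi := bounded_integrable t0 px mf fK.
have mS := (@measurable_psdset R d).
have K0 : 0 <= K by apply: le_trans (fK 0 (psd0 R d)).
apply: le_trans (le_normr_Rintegral mS fi) _.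
apply: (@le_trans _ _ (\int[p t x]_(xi in S) K)).
  apply: le_Rintegral => //; first exact: (integrable_abse fi).
  apply: (bounded_integrable (K := `|K|)) => //; exact: measurable_cst.
rewrite Rintegral_cst// ler_piMr// -lee_fin fineK ?p_le1//.
by rewrite ge0_fin_numE// (le_lt_trans (p_le1 t0 px mS))// ltry.
Qed.

Lemma semigroupD t f g x K K' : 0 <= t -> psd x ->
  measurable_fun S (f : Mx R d -> R) -> measurable_fun S (g : Mx R d -> R) ->
  (forall y, psd y -> `|f y| <= K) -> (forall y, psd y -> `|g y| <= K') ->
  P t (fun y => f y + g y) x = P t f x + P t g x.
Proof.
move=> t0 px mf mg fK gK; apply: RintegralD; first exact: measurable_psdset.
- exact: bounded_integrable fK.
- exact: bounded_integrable gK.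
Qed.

Lemma semigroupZ t f x K (k : R) : 0 <= t -> psd x ->
  measurable_fun S (f : Mx R d -> R) -> (forall y, psd y -> `|f y| <= K) ->
  P t (fun y => k * f y) x = k * P t f x.
Proof.
move=> t0 px mf fK; apply: RintegralZl; first exact: measurable_psdset.
exact: bounded_integrable fK.
Qed.

Lemma semigroup_le t f g x K K' : 0 <= t -> psd x ->
  measurable_fun S (f : Mx R d -> R) -> measurable_fun S (g : Mx R d -> R) ->
  (forall y, psd y -> `|f y| <= K) -> (forall y, psd y -> `|g y| <= K') ->
  (forall y, psd y -> f y <= g y) -> P t f x <= P t g x.
Proof.
move=> t0 px mf mg fK gK fg; apply: le_Rintegral => //; first exact: measurable_psdset.
- exact: bounded_integrable fK.
- exact: bounded_integrable gK.
Qed.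

Lemma chapman_kolmogorov_ge0 s t f x K : 0 <= s -> 0 <= t -> psd x ->
  measurable_fun S (f : Mx R d -> R) -> (forall y, psd y -> 0 <= f y <= K) ->
  measurable_fun S (P t f : Mx R d -> R) /\ P (s + t) f x = P s (P t f) x.
Proof.
move=> s0 t0 px mf fK; have mS := (@measurable_psdset R d).
have [[_ hm _ hck _] _] := aff.
(* Measurability and the mass bound are known only for starting points in the cone, so the kernel is
   extended by the zero measure outside it; likewise [f] is extended by zero below. *)
pose q (y : Mx R d) : {measure set (Mx R d) -> \bar R} :=
  if pselect (psd y) then p t y else mzero.
have qE y : psd y -> q y = p t y by rewrite /q; case: pselect.
have q0 y U : ~ psd y -> q y U = 0%E by rewrite /q; case: pselect.
have qrestr U : (q ^~ U) = ((fun y => p t y U) \_ S).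
  apply/funext => y; rewrite /patch; case: ifPn => [|/negP yS].
    by rewrite inE => py; rewrite qE.
  by rewrite q0// => py; apply: yS; rewrite inE.
have mq U : measurable U -> measurable_fun [set: Mx R d] (q ^~ U).
  move=> mU; rewrite qrestr; apply/(measurable_restrictT _ mS); exact: hm.
have q1 y : (q y [set: Mx R d] <= 1)%E.
  have [py|py] := pselect (psd y); first by rewrite qE// p_le1.
  by rewrite q0.
have hnu U : measurable U -> (p (s + t) x U = \int[p s x]_y q y U)%E.
  by move=> mU; rewrite hck// integral_mkcond -qrestr.
pose g : Mx R d -> \bar R := (EFin \o f) \_ S.
have g0 z : (0 <= g z)%E.
  rewrite /g /patch; case: ifPn => //; rewrite inE => pz.
  by rewrite lee_fin; case/andP: (fK z pz).
have mg : measurable_fun [set: Mx R d] g.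
  by apply/(measurable_restrictT _ mS); exact/measurable_EFinP.
have px1 : (p s x [set: Mx R d] <= 1)%E by exact: p_le1.
have comp := integral_composition px1 mq q1 hnu g0 mg.
have fK' y : psd y -> `|f y| <= K.
  by move=> py; have /andP[f0 fk] := fK y py; rewrite ger0_norm.
have inE' y : psd y -> (\int[q y]_z g z = (P t f y)%:E)%E.
  move=> py; rewrite qE// -integral_mkcond /P /Rintegral fineK//.
  by apply: integrable_fin_num => //; exact: bounded_integrable fK'.
have mPt : measurable_fun S (P t f : Mx R d -> R).
  have h := @measurable_fun_integral_kernel _ _ _ _ R q mq g g0 mg.
  apply/measurable_EFinP; apply: (@eq_measurable_fun _ _ _ _ S (fun y => \int[q y]_z g z)%E).
    by move=> y; rewrite inE => py; rewrite inE'.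
  exact: measurable_funS h.
split=> //; rewrite /P /Rintegral; congr fine.
rewrite [LHS]integral_mkcond [LHS]comp [RHS]integral_mkcond.
apply: eq_integral => y _; rewrite /patch; case: ifPn => [|/negP yS].
  by rewrite inE => py; rewrite inE'.
rewrite (@eq_measure_integral _ _ _ setT mzero).
  by rewrite integral_measure_zero.
by move=> U _ _; rewrite q0// => py; apply: yS; rewrite inE.
Qed.

(** Reduction to a nonnegative function by adding the constant [K]. Since mass may be lost, [P t]
    need not fix constants, so the identity for the constant function is subtracted rather than the
    constant itself. *)
Lemma chapman_kolmogorov s t f x K : 0 <= s -> 0 <= t -> psd x ->
  measurable_fun S (f : Mx R d -> R) -> (forall y, psd y -> `|f y| <= K) ->
  measurable_fun S (P t f : Mx R d -> R) /\ P (s + t) f x = P s (P t f) x.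
Proof.
move=> s0 t0 px mf fK.
have K0 : 0 <= K by apply: le_trans (fK 0 (psd0 R d)).
have mK : measurable_fun S ((fun=> K) : Mx R d -> R) by exact: measurable_cst.
have mfK : measurable_fun S ((fun y => f y + K) : Mx R d -> R) by exact: measurable_funD.
have KK y : psd y -> 0 <= K <= K by rewrite K0 lexx.
have KK' y : psd y -> `|K| <= K by move=> _; rewrite ger0_norm.
have hfK y : psd y -> 0 <= f y + K <= K + K.
  by move=> /fK; rewrite ler_norml => /andP[h1 h2]; apply/andP; split; lra.
have [m1 e1] := chapman_kolmogorov_ge0 s0 t0 px mfK hfK.
have [m2 e2] := chapman_kolmogorov_ge0 s0 t0 px mK KK.
have PD r y : 0 <= r -> psd y -> P r (fun y => f y + K) y = P r f y + P r (fun=> K) y.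
  by move=> r0 py; exact: (semigroupD r0 py mf mK fK KK').
have Pf y : psd y -> P t f y = P t (fun y => f y + K) y - P t (fun=> K) y.
  by move=> py; rewrite PD// addrK.
have mPf : measurable_fun S (P t f : Mx R d -> R).
  apply: (@eq_measurable_fun _ _ _ _ S
    ((fun y => P t (fun y => f y + K) y - P t (fun=> K) y) : Mx R d -> R)).
    by move=> y; rewrite inE => py; rewrite Pf.
  exact: measurable_funB.
split; first exact: mPf.
have bP y : psd y -> `|P t f y| <= K by move=> py; exact: semigroup_bound.
have bK y : psd y -> `|P t (fun=> K) y| <= K by move=> py; exact: semigroup_bound.
have st0 : 0 <= s + t by exact: addr_ge0.
have h : P s (P t (fun y => f y + K)) x = P s (fun y => P t f y + P t (fun=> K) y) x.
  by apply: eq_Rintegral => y; rewrite inE => py; rewrite PD.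
have := etrans (esym (PD _ _ st0 px)) (etrans e1 (etrans h (semigroupD s0 px mPf m2 bP bK))).
rewrite -[X in _ = _ + X]e2; exact: addIr.
Qed.

End AffineSemigroup.

(** * Small-time bounds for exponents that are affine in the state *)

Section SmallTimeExponent.
Variables (R : realType) (d : nat).
Notation M := 'M[R]_d.

Lemma near_right (Q : R -> Prop) : (\forall h \near (0 : R)^'+, Q h) ->
  exists2 dl : R, 0 < dl & forall h : R, 0 < h -> h < dl -> Q h.
Proof.
move=> -[e /= e0 he]; exists e => // h h0 hd; apply: he => //=.
by rewrite sub0r normrN gtr0_norm.
Qed.

Lemma cvg_near_bounded (f : R -> R) (l : R) : f t @[t --> 0^'+] --> l ->
  \forall t \near (0 : R)^'+, `|f t| <= `|l| + 1.
Proof.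
move=> /cvgrPdist_le /(_ 1 ltr01); apply: filterS => t h.
have -> : f t = l - (l - f t) by ring.
by apply: le_trans (ler_normB _ _) _; rewrite lerD2l.
Qed.

(* The entries of [D t] are recovered by polarization from the values at the
   matrices [v v^T] with [v = e_i + e_j]. *)
Lemma affine_small_time (a : R -> R) (D : R -> M) :
  (forall t : R, 0 < t -> sym (D t)) ->
  (forall x, psd x -> exists K : R,
     \forall t \near (0 : R)^'+, `|a t + inner (D t) x| <= K * t) ->
  exists2 K : R, 0 <= K &
    \forall t \near (0 : R)^'+, forall x, psd x -> `|a t + inner (D t) x| <= K * t * (1 + \tr x).
Proof.
move=> sD h.
have [K0 h0] := h 0 (psd0 R d).
(* The pair [(i, i)] is included: there [v = 2 e_i] and the form is [4 D_ii], so the same family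
   also yields the diagonal entries. *)
pose v (p : 'I_d * 'I_d) : 'cV[R]_d := delta_mx p.1 ord0 + 1 *: delta_mx p.2 ord0.
have /boolp.choice[K1 h1] : forall p, exists K : R,
    \forall t \near (0 : R)^'+, `|a t + inner (D t) (v p *m (v p)^T)| <= K * t.
  by move=> p; apply: h; exact: psd_colmul.
pose L := \sum_p (`|K1 p| + `|K0|).
have L1 p : `|K1 p| + `|K0| <= L.
  by rewrite /L (bigD1 p)//= lerDl sumr_ge0// => q _; rewrite addr_ge0.
have L0 : 0 <= L by rewrite sumr_ge0// => q _; rewrite addr_ge0.
exists (`|K0| + \sum_(i < d) \sum_(j < d) L).
  by rewrite addr_ge0// sumr_ge0// => i _; rewrite sumr_ge0.
have h2 : \forall t \near (0 : R)^'+,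
  forall q, `|a t + inner (D t) (v q *m (v q)^T)| <= K1 q * t.
  by apply: filter_forall => q; exact: h1.
near=> t => x px.
have t0 : 0 < t by near: t; exact: nbhs_right_gt.
have a0 : `|a t| <= `|K0| * t.
  have : `|a t + inner (D t) 0| <= K0 * t by near: t.
  rewrite inner0r addr0 => /le_trans; apply.
  by rewrite ler_pM2r// ler_norm.
have qb p : `|qf (D t) (v p)| <= L * t.
  have : `|a t + inner (D t) (v p *m (v p)^T)| <= K1 p * t.
    by move: p; near: t.
  rewrite inner_col => hp.
  have -> : qf (D t) (v p) = a t + qf (D t) (v p) - a t by ring.
  apply: le_trans (ler_normB _ _) _; apply: le_trans (lerD hp a0) _.
  rewrite -mulrDl ler_pM2r//; apply: le_trans (L1 p).
  by rewrite lerD2r ler_norm.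
have qE i j : qf (D t) (v (i, j)) = D t i i + D t j j + 2 * D t i j.
  rewrite /v /= qf_shift; last exact: sD.
  have -> : (D t *m (delta_mx i ord0 : 'cV[R]_d)) j ord0 = D t i j.
    rewrite (symE i j (sD t t0)) mxE (bigD1 i)//= big1 ?addr0 => [|k ki].
      by rewrite mxE !eqxx mulr1.
    by rewrite mxE (negbTE ki) mulr0.
  by rewrite qf_delta expr1n; ring.
have db i j : `|D t i j| <= L * t.
  have := qb (i, j); have := qb (i, i); have := qb (j, j); rewrite !qE.
  rewrite !ler_norml => /andP[? ?] /andP[? ?] /andP[? ?].
  by apply/andP; split; lra.
have mD : mxsum (D t) <= (\sum_(i < d) \sum_(j < d) L) * t.
  rewrite /mxsum mulr_suml; apply: ler_sum => i _.
  by rewrite mulr_suml; apply: ler_sum => j _.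
have tr0 := psd_tr_ge0 px.
apply: le_trans (ler_normD _ _) _.
have h3 := le_trans (inner_le_tr (D t) px) (ler_wpM2r tr0 mD).
apply: le_trans (lerD a0 h3) _.
set s := \sum_(i < d) _; set k := `|K0|.
have s0 : 0 <= s by rewrite sumr_ge0// => i _; rewrite sumr_ge0.
have -> : (k + s) * t * (1 + \tr x) = k * t + s * t * \tr x + (k * t * \tr x + s * t).
  by ring.
have k0 : 0 <= k by exact: normr_ge0.
by rewrite lerDl addr_ge0// !mulr_ge0// ltW.
Unshelve. all: by end_near.
Qed.

End SmallTimeExponent.

(** * Uniform domination of small-time difference quotients *)

Section Domination.
Variables (R : realType) (d : nat).
Variables (alpha b : 'M[R]_d) (B : 'M[R]_d -> 'M[R]_d) (c : R) (gamma : 'M[R]_d).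
Variables (m nu : {measure set (Mx R d) -> \bar R}) (H : 'M[R]_d -> 'M[R]_d).
Variable p : R -> 'M[R]_d -> {measure set (Mx R d) -> \bar R}.
Hypothesis aff : affine_transition p.
Hypothesis gen : has_generator p alpha b B c gamma m nu H.
Notation M := 'M[R]_d.
Notation S := (@psdset R d).
Notation P := (semigroup p).
Implicit Types (A C x : M) (a th t h K : R).

Definition bounded_fun (f : M -> R) : Prop :=
  measurable_fun S (f : Mx R d -> R) /\ exists K, forall y, psd y -> `|f y| <= K.

Lemma bounded_comb k f g : bounded_fun f -> bounded_fun g ->
  bounded_fun (fun y => k * f y + g y).
Proof.
move=> [mf [K fK]] [mg [K' gK]]; split.
  by apply: measurable_funD => //; apply: measurable_funM => //; exact: measurable_cst.
exists (`|k| * K + K') => y py; apply: le_trans (ler_normD _ _) _.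
by rewrite normrM lerD ?ler_wpM2l// ?fK// gK.
Qed.

Lemma semigroup_comb k f g t x : 0 <= t -> psd x -> bounded_fun f -> bounded_fun g ->
  P t (fun y => k * f y + g y) x = k * P t f x + P t g x.
Proof.
move=> t0 px [mf [K fK]] [mg [K' gK]].
have mkf : measurable_fun S ((fun y => k * f y) : Mx R d -> R).
  by apply: measurable_funM => //; exact: measurable_cst.
have kfK y : psd y -> `|k * f y| <= `|k| * K.
  by move=> py; rewrite normrM ler_wpM2l// fK.
rewrite (semigroupD aff t0 px mkf mg kfK gK).
by rewrite (semigroupZ aff k t0 px mf fK).
Qed.

Lemma semigroup_ge0 f g t x : 0 <= t -> psd x -> bounded_fun f -> bounded_fun g ->
  (forall y, psd y -> `|f y| <= g y) -> `|P t f x| <= P t g x.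
Proof.
move=> t0 px bf bg fg.
have b0 : bounded_fun (fun=> 0).
  by split; [exact: measurable_cst|exists 0 => y _; rewrite normr0].
have bN : bounded_fun (fun y => -1 * f y + 0) by exact: bounded_comb.
have le1 u : bounded_fun u -> (forall y, psd y -> u y <= g y) -> P t u x <= P t g x.
  move=> [mu [K uK]]; case: bg => mg [K' gK].
  exact: (semigroup_le aff t0 px mu mg uK gK).
have P0 : P t (fun=> 0) x = 0.
  by rewrite /semigroup /Rintegral integral0.
rewrite ler_norml; apply/andP; split; last first.
  by apply: le1 => // y py; exact: le_trans (ler_norm _) (fg y py).
have := le1 _ bN; rewrite (semigroup_comb (-1) t0 px bf b0) P0 => h.
rewrite lerNl; have -> : - P t f x = -1 * P t f x + 0 by ring.
apply: h => y py; rewrite mulN1r addr0; apply: le_trans (fg y py).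
by rewrite -normrN ler_norm.
Qed.

Definition ew A x : R := expR (- inner A x).

Lemma wave_ew A : wave 0 0 A 0 = ew A.
Proof. by apply/funext => x; rewrite /wave inner0l !add0r cos0 mulr1. Qed.

Lemma cont_ew A : continuous (ew A).
Proof. rewrite -wave_ew; exact: cont_wave. Qed.

Lemma ew_le1 A x : psd A -> psd x -> 0 <= ew A x <= 1.
Proof. by move=> pA px; rewrite /ew expR_ge0 expR_le1 oppr_le0 inner_psd_ge0. Qed.

Lemma bounded_ew A : psd A -> bounded_fun (ew A).
Proof.
move=> pA; split; first exact: cont_measurable (@measurable_psdset R d) (@cont_ew A).
by exists 1 => y py; have /andP[h0 h1] := ew_le1 pA py; rewrite ger0_norm.
Qed.

(** The constant depends on [x], because the generator is assumed to exist only as a pointwise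
    limit; uniformity comes from [ew_domination]. *)
Lemma ew_small_time A x : pd A -> psd x -> exists K,
  \forall t \near (0 : R)^'+, `|P t (ew A) x - ew A x| <= K * t.
Proof.
move=> pA px; have := gen (wave_rapidly_decreasing 0 0 0 pA) px.
rewrite wave_ew => /cvg_near_bounded; set K := `|_| + 1 => h; exists K.
near=> t; have t0 : 0 < t by near: t; exact: nbhs_right_gt.
have : `|(P t (ew A) x - ew A x) / t| <= K by near: t.
by rewrite normrM (gtr0_norm (_ : 0 < t^-1)) ?invr_gt0// ler_pdivrMr.
Unshelve. all: by end_near.
Qed.

(** By the affine formula [P t (ew A)] is [ew A] times the exponential of [a t + <D t, x>]. The
    pointwise bound makes this exponent [O(t)] at each fixed [x] through [small_log], and
    [affine_small_time] makes it [O(t * (1 + \tr x))] for all [x] at once. *)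
Lemma ew_domination A : pd A -> exists2 K, 0 <= K &
  \forall t \near (0 : R)^'+, forall x, psd x ->
    `|P t (ew A) x - ew A x| <= ew A x * (expR (K * t * (1 + \tr x)) - 1).
Proof.
move=> pA; have [_ [phi0 [psi0 hp]]] := aff.
have psA := pd_psd pA.
pose a t := - phi0 t A; pose D t := - (psi0 t A - A).
have PE t x : 0 < t -> psd x -> P t (ew A) x = ew A x * expR (a t + inner (D t) x).
  move=> t0 px; have [_ _ h] := hp t A x (ltW t0) psA px.
  rewrite [LHS]h /ew -expRD /a /D innerNl innerBl; congr expR; ring.
have sD t : 0 < t -> sym (D t).
  move=> t0; have [_ [s1 _] _] := hp t A 0 (ltW t0) psA (psd0 R d).
  by apply: symN; apply: symB => //; case: pA.
have hx x : psd x -> exists K,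
    \forall t \near (0 : R)^'+, `|a t + inner (D t) x| <= K * t.
  move=> px; have [K hK] := ew_small_time pA px.
  have e0 : 0 < ew A x by exact: expR_gt0.
  pose L := `|K| / ew A x; have L0 : 0 <= L by rewrite divr_ge0// ltW.
  have L1 : 0 < 1 / (2 * (L + 1)).
    by rewrite divr_gt0// mulr_gt0// ltr_wpDl.
  exists (2 * L); near=> t.
  have t0 : 0 < t by near: t; exact: nbhs_right_gt.
  rewrite -mulrA; apply: small_log.
    have : t <= 1 / (2 * (L + 1)) by near: t; exact: nbhs_right_le.
    rewrite ler_pdivlMr ?mulr_gt0 ?ltr_wpDl// => h.
    have : 0 <= L * t by rewrite mulr_ge0// ltW.
    by nra.
  have : `|P t (ew A) x - ew A x| <= K * t by near: t.
  rewrite PE// -[X in _ - X]mulr1 -mulrBr normrM (gtr0_norm e0) mulrC -ler_pdivlMr//.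
  move=> /le_trans; apply; rewrite /L mulrAC ler_wpM2r// ?invr_ge0 ?(ltW e0)//.
  by apply: ler_wpM2r; [rewrite invr_ge0 ltW|exact: ler_norm].
have [K K0 hK] := affine_small_time sD hx.
exists K => //; near=> t => x px.
have t0 : 0 < t by near: t; exact: nbhs_right_gt.
have e0 : 0 < ew A x by exact: expR_gt0.
rewrite PE// -[X in _ - X]mulr1 -mulrBr normrM (gtr0_norm e0) ler_pM2l//.
apply: le_trans (expR_sub1_le _) _; rewrite lerD2r ler_expR.
have : forall x, psd x -> `|a t + inner (D t) x| <= K * t * (1 + \tr x) by near: t.
exact.
Unshelve. all: by end_near.
Qed.

(** The factors [exp (e * z)] and [exp (- (e * z))] of [cos_cosh_bound] are to be absorbed into
    [exp (- <A, x>)]; [e] is so small that this uses at most half of the margin of [A]. *)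
Lemma shifted_coercive A C : pd A -> sym C -> exists l e : R,
  [/\ 0 < l, 0 < e, psd (A - l%:M), psd (A + e *: C - l%:M) & psd (A - e *: C - l%:M)].
Proof.
move=> /pdP[l2 l0 pl] sC; pose l := l2 / 2; pose e := l / (1 + mxsum C).
have l1 : 0 < l by rewrite divr_gt0.
have C0 : 0 < 1 + mxsum C by rewrite ltr_wpDr// mxsum_ge0.
have e0 : 0 < e by rewrite divr_gt0.
have E (D : M) : A + D - l%:M = (A - l2%:M) + (D + l%:M).
  have -> : l2%:M = l%:M + l%:M :> M by rewrite -raddfD/= /l -splitr.
  by rewrite opprD [D + _]addrC !addrA subrK addrAC.
have he : mxsum (e *: C) <= l.
  rewrite mxsumZ gtr0_norm// /e mulrAC ler_pdivrMr// ler_pM2l//.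
  by rewrite lerDr.
exists l, e; split=> //.
- rewrite -[A]addr0 E; apply: psdD => //; rewrite add0r; apply: psd_scalar; exact: ltW.
- by rewrite E; apply: psdD => //; apply: psd_perturb => //; exact: symZ.
- rewrite E; apply: psdD => //; apply: psd_perturb; first by apply: symN; exact: symZ.
  by rewrite mxsumN.
Qed.

Lemma coercive_pd A (l : R) : 0 < l -> psd (A - l%:M) -> pd A.
Proof. by move=> l0 pl; apply/pdP; exists l. Qed.

Lemma ew_coercive A (l : R) x : psd (A - l%:M) -> psd x -> ew A x <= expR (- (l * \tr x)).
Proof. by move=> pl px; rewrite /ew ler_expR lerN2 inner_coercive. Qed.

(** With [y = K * t * (1 + \tr x)], [exp y - 1 <= y * exp y]. For [K * t <= l / 2], half of the
    decay rate [l] cancels [exp y] up to a constant, and the other half absorbs the factor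
    [1 + \tr x]. *)
Lemma exp_excess_small A (l K : R) : 0 < l -> psd (A - l%:M) -> 0 <= K -> exists2 K', 0 <= K' &
  \forall t \near (0 : R)^'+, forall x, psd x ->
    ew A x * (expR (K * t * (1 + \tr x)) - 1) <= K' * t.
Proof.
move=> l0 pl K0; have l2 : 0 < l / 2 by rewrite divr_gt0.
have [K3 h3] := pow_exp_bounded 1 l2.
have K30 : 0 <= K3.
  by apply: le_trans (h3 0 (lexx 0)); rewrite mulr_ge0 ?expR_ge0// exprn_ge0// addr0.
exists (K * K3 * expR (l / 2)); first by rewrite !mulr_ge0// expR_ge0.
near=> t => x px.
have t0 : 0 < t by near: t; exact: nbhs_right_gt.
have r0 := psd_tr_ge0 px; set r := \tr x in r0 *.
have Kt : K * t <= l / 2.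
  have : t <= l / 2 / (K + 1) by near: t; apply: nbhs_right_le; rewrite divr_gt0// ltr_wpDl.
  rewrite ler_pdivlMr ?ltr_wpDl// => h.
  by apply: le_trans h; rewrite mulrC ler_wpM2l ?(ltW t0)// lerDl.
set y := K * t * (1 + r).
have y0 : 0 <= y by rewrite !mulr_ge0// ?(ltW t0)// addr_ge0.
have ey0 := expR_ge0 y.
have h1 : expR y - 1 <= y * expR y.
  have := ler_wpM2r ey0 (expR_ge1Dx (- y)).
  rewrite -expRD addNr expR0; move: (expR y) => z h; lra.
have h2 : expR y <= expR (l / 2) * expR (l / 2 * r).
  rewrite -expRD ler_expR /y -[X in _ <= X + _]mulr1 -mulrDr ler_wpM2r// addr_ge0//.
have e0 : 0 <= ew A x by exact: expR_ge0.
apply: le_trans (ler_wpM2l e0 h1) _.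
apply: (@le_trans _ _ (expR (- (l * r)) * (y * (expR (l / 2) * expR (l / 2 * r))))).
  by apply: ler_pM => //; [rewrite mulr_ge0|exact: ew_coercive|rewrite ler_wpM2l].
have -> : expR (- (l * r)) = expR (- (l / 2 * r)) * expR (- (l / 2 * r)).
  by rewrite -expRD; congr expR; field.
have e1 : expR (- (l / 2 * r)) * expR (l / 2 * r) = 1 by rewrite -expRD addNr expR0.
have := h3 r r0; rewrite expr1 => h4.
rewrite /y; set E1 := expR (- _) in e1 h4 *; set E2 := expR (l / 2 * r) in e1 *.
have -> : E1 * E1 * (K * t * (1 + r) * (expR (l / 2) * E2))
  = K * expR (l / 2) * t * ((1 + r) * E1) * (E1 * E2) by ring.
rewrite e1 mulr1 (_ : K * K3 * _ * t = K * expR (l / 2) * t * K3); last by ring.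
by rewrite ler_wpM2l// !mulr_ge0// ?expR_ge0// ltW.
Unshelve. all: by end_near.
Qed.

Lemma bounded_cst (k : R) : bounded_fun (fun=> k).
Proof. by split; [exact: measurable_cst|exists `|k|]. Qed.

Lemma bounded_wave a th A C : psd A -> bounded_fun (wave a th A C).
Proof.
move=> pA; split; first exact: cont_measurable (@measurable_psdset R d) (@cont_wave _ _ a th A C).
exists (expR (- a)) => y py; apply: le_trans (wave_norm _ _ _ _ _) _.
by rewrite ler_expR opprD -[leRHS]addr0 lerD2l oppr_le0 inner_psd_ge0.
Qed.

Lemma semigroup0 t x : P t (fun=> 0) x = 0.
Proof. by rewrite /semigroup /Rintegral integral0. Qed.

Lemma average_sub_le (u v w X : R) : `|u| <= X -> `|v| <= X -> `|w| <= X ->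
  - u + (v + w) / 2 <= 2 * X.
Proof. rewrite !ler_norml => /andP[? ?] /andP[? ?] /andP[? ?]; lra. Qed.

Lemma combination_le (g k s k' e u v w X : R) : `|g| <= k * X -> `|k'| <= 1 ->
  `|s| <= e / 2 -> `|u| <= X -> `|v| <= X -> `|w| <= X ->
  `|g + (k' * u + (s * v - s * w))| <= (k + (1 + e)) * X.
Proof.
move=> hg hk hs hu hv hw.
apply: le_trans (ler_normD _ _) _; rewrite [leRHS]mulrDl; apply: (lerD hg).
apply: le_trans (ler_normD _ _) _; rewrite [leRHS]mulrDl; apply: lerD.
  by rewrite normrM; exact: (ler_pM (normr_ge0 _) (normr_ge0 _) hk hu).
apply: le_trans (ler_normB _ _) _.
have -> : e * X = e / 2 * X + e / 2 * X by field.
rewrite !normrM; exact: (lerD (ler_pM (normr_ge0 _) (normr_ge0 _) hs hv)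
  (ler_pM (normr_ge0 _) (normr_ge0 _) hs hw)).
Qed.

(** The comparison with real exponentials is centred at the evaluation point [x], where the
    increment is measured. All errors are then multiples of one quantity [X], which is [O(t)]
    uniformly by [exp_excess_small]. *)
Lemma wave_domination_near th A C : pd A -> sym C -> exists2 K, 0 <= K &
  \forall t \near (0 : R)^'+, forall x, psd x ->
    `|P t (wave 0 th A C) x - wave 0 th A C x| <= K * t.
Proof.
move=> pA sC; have [l [e [l0 e0 pl pp pm]]] := shifted_coercive pA sC.
set Ap := A + e *: C in pp; set Am := A - e *: C in pm.
have psA := pd_psd pA; have psp := pd_psd (coercive_pd l0 pp).
have psm := pd_psd (coercive_pd l0 pm).
have [K1 K10 h1] := ew_domination pA.
have [K2 K20 h2] := ew_domination (coercive_pd l0 pp).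
have [K3 K30 h3] := ew_domination (coercive_pd l0 pm).
pose K := K1 + K2 + K3.
have K0 : 0 <= K by rewrite !addr_ge0.
have [K' K'0 hK'] := exp_excess_small l0 pl K0.
pose k := 2 / e ^+ 2 + e^-1.
have k0 : 0 <= k by rewrite addr_ge0// ?divr_ge0 ?invr_ge0 ?exprn_ge0// ltW.
exists ((2 * k + (1 + e^-1)) * K').
  by rewrite mulr_ge0// !addr_ge0// ?mulr_ge0// invr_ge0 ltW.
near=> t => x px.
have t0 : 0 < t by near: t; exact: nbhs_right_gt.
have r0 := psd_tr_ge0 px.
set X := ew A x * (expR (K * t * (1 + \tr x)) - 1).
have XK : X <= K' * t.
  have : forall x, psd x -> ew A x * (expR (K * t * (1 + \tr x)) - 1) <= K' * t by near: t.
  exact.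
(* Normalising factors at the fixed [x]: [qp * ew Ap] and [qm * ew Am] both equal [ew A] there, so
   the bounds for the three exponentials become bounds by the same [X]. *)
pose qp := expR (e * inner C x); pose qm := expR (- (e * inner C x)).
have qpE y : qp * ew Ap y = ew A y * expR (- (e * (inner C y - inner C x))).
  by rewrite /qp /ew /Ap innerDl innerZl -!expRD; congr expR; ring.
have qmE y : qm * ew Am y = ew A y * expR (e * (inner C y - inner C x)).
  by rewrite /qm /ew /Am innerBl innerZl -!expRD; congr expR; ring.
have qpx : qp * ew Ap x = ew A x by rewrite qpE subrr mulr0 oppr0 expR0 mulr1.
have qmx : qm * ew Am x = ew A x by rewrite qmE subrr mulr0 expR0 mulr1.
have XE (L : R) : L <= K -> ew A x * (expR (L * t * (1 + \tr x)) - 1) <= X.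
  move=> LK; rewrite ler_wpM2l ?expR_ge0// lerD2r ler_expR.
  by rewrite ler_wpM2r ?addr_ge0// ler_wpM2r// ltW.
have d1 : `|P t (ew A) x - ew A x| <= X.
  have h : forall x, psd x ->
    `|P t (ew A) x - ew A x| <= ew A x * (expR (K1 * t * (1 + \tr x)) - 1) by near: t.
  by apply: le_trans (h x px) (XE _ _); rewrite /K; lra.
have d2 : `|qp * P t (ew Ap) x - ew A x| <= X.
  have h : forall x, psd x ->
    `|P t (ew Ap) x - ew Ap x| <= ew Ap x * (expR (K2 * t * (1 + \tr x)) - 1) by near: t.
  rewrite -{1}qpx -mulrBr normrM (gtr0_norm (expR_gt0 _)).
  apply: le_trans (ler_wpM2l (expR_ge0 _) (h x px)) _.
  by rewrite mulrA qpx; apply: XE; rewrite /K; lra.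
have d3 : `|qm * P t (ew Am) x - ew A x| <= X.
  have h : forall x, psd x ->
    `|P t (ew Am) x - ew Am x| <= ew Am x * (expR (K3 * t * (1 + \tr x)) - 1) by near: t.
  rewrite -{1}qmx -mulrBr normrM (gtr0_norm (expR_gt0 _)).
  apply: le_trans (ler_wpM2l (expR_ge0 _) (h x px)) _.
  by rewrite mulrA qmx; apply: XE; rewrite /K; lra.
pose be := th + inner C x; pose s := sin be / (2 * e).
have s1 : `|s| <= e^-1 / 2.
  have e1 : 0 <= e^-1 / 2 by rewrite divr_ge0// invr_ge0 ltW.
  have -> : s = e^-1 / 2 * sin be by rewrite /s; field; rewrite gt_eqF.
  rewrite normrM (ger0_norm e1) ler_piMr//.
  by rewrite ler_norml sin_geN1 sin_le1.
pose W := wave 0 th A C.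
pose F1 y := 1 * W y + (- cos be * ew A y + (s * qm * ew Am y + (- (s * qp) * ew Ap y + 0))).
pose F2 y := - k * ew A y + (k * qm / 2 * ew Am y + (k * qp / 2 * ew Ap y + 0)).
have bA := bounded_ew psA; have bp := bounded_ew psp; have bm := bounded_ew psm.
have bW := bounded_wave 0 th C psA; have b0 := bounded_cst 0.
(* [cos_cosh_bound] at [be] and [z = <C, y> - <C, x>], multiplied by [ew A y]. Since [F2] vanishes
   at [x], positivity of the semigroup bounds [P t F1 x] by a small-time increment of [F2]. *)
have F12 y : psd y -> `|F1 y| <= F2 y.
  move=> py; set z := inner C y - inner C x.
  have -> : F1 y = ew A y * (cos (be + z) - cos be + s * (expR (e * z) - expR (- (e * z)))).
    have -> : be + z = th + inner C y by rewrite /be /z; ring.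
    have -> : F1 y = W y - cos be * ew A y + (s * (qm * ew Am y) - s * (qp * ew Ap y)).
      by rewrite /F1; ring.
    rewrite qmE qpE.
    by rewrite /W /wave add0r -/(ew A y) -/z; ring.
  have -> : F2 y = ew A y * (k * ((expR (e * z) + expR (- (e * z))) / 2 - 1)).
    have -> : F2 y = - k * ew A y + (k / 2 * (qm * ew Am y) + k / 2 * (qp * ew Ap y)).
      by rewrite /F2; ring.
    by rewrite qmE qpE -/z; ring.
  by rewrite normrM (gtr0_norm (expR_gt0 _)) ler_wpM2l ?expR_ge0// cos_cosh_bound.
have t0' := ltW t0.
have B1 := bounded_comb (- (s * qp)) bp b0.
have B2 := bounded_comb (s * qm) bm B1.
have B3 := bounded_comb (- cos be) bA B2.
have B4 := bounded_comb 1 bW B3.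
have D1 := bounded_comb (k * qp / 2) bp b0.
have D2 := bounded_comb (k * qm / 2) bm D1.
have D3 := bounded_comb (- k) bA D2.
have := semigroup_ge0 t0' px B4 D3 F12.
rewrite (semigroup_comb _ t0' px bW B3) (semigroup_comb _ t0' px bA B2).
rewrite (semigroup_comb _ t0' px bm B1) (semigroup_comb _ t0' px bp b0).
rewrite (semigroup_comb _ t0' px bA D2) (semigroup_comb _ t0' px bm D1).
rewrite (semigroup_comb _ t0' px bp b0) semigroup0.
have Wx : W x = cos be * ew A x by rewrite /W /wave add0r mulrC.
have c1 := @cos_norm_le1 R be.
move: d1 d2 d3; rewrite -/W Wx.
set PW := P t W x; set PA := P t (ew A) x; set Pp := P t (ew Ap) x; set Pm := P t (ew Am) x.
move=> d1 d2 d3; set G1 := (X in `|X| <= _); set G2 := (X in _ <= X) => h.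
have X0 : 0 <= X by exact: le_trans d1.
have g2 : G2 <= 2 * k * X.
  have -> : G2 = k * (- (PA - ew A x) + ((qm * Pm - ew A x) + (qp * Pp - ew A x)) / 2).
    by rewrite /G2; field.
  rewrite [2 * k]mulrC -mulrA ler_wpM2l//.
  exact: (average_sub_le d1 d3 d2).
have -> : PW - cos be * ew A x = G1 + (cos be * (PA - ew A x)
    + (s * (qp * Pp - ew A x) - s * (qm * Pm - ew A x))) by rewrite /G1; ring.
apply: (@le_trans _ _ ((2 * k + (1 + e^-1)) * X)); last first.
  by rewrite -mulrA ler_wpM2l// addr_ge0// ?mulr_ge0// addr_ge0// invr_ge0 ltW.
exact: (combination_le (le_trans h g2) c1 s1 d1 d2 d3).
Unshelve. all: by end_near.
Qed.

Lemma wave_domination a th A C : pd A -> sym C -> exists2 K, 0 <= K &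
  forall h x, 0 < h -> psd x -> `|P h (wave a th A C) x - wave a th A C x| <= K * h.
Proof.
move=> pA sC; have [K K0 /near_right[dl dl0 hK]] := wave_domination_near th pA sC.
have psA := pd_psd pA.
have bW := bounded_wave 0 th C psA.
have W1 y : psd y -> `|wave 0 th A C y| <= 1.
  move=> py; apply: le_trans (wave_norm _ _ _ _ _) _.
  by rewrite expR_le1 add0r oppr_le0 inner_psd_ge0.
have aW : wave a th A C = fun y => expR (- a) * wave 0 th A C y + 0.
  by apply/funext => y; rewrite addr0 /wave mulrA -expRD add0r opprD.
exists (expR (- a) * (K + 2 / dl)).
  by rewrite mulr_ge0 ?expR_ge0// addr_ge0// divr_ge0// ltW.
move=> h x h0 px; rewrite aW (semigroup_comb _ (ltW h0) px bW (bounded_cst 0)).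
rewrite semigroup0 !addr0 -mulrBr normrM (ger0_norm (expR_ge0 _)) -mulrA ler_wpM2l ?expR_ge0//.
have [hd|hd] := ltP h dl.
  apply: le_trans (hK h h0 hd x px) _.
  by rewrite ler_wpM2r ?(ltW h0)// lerDl divr_ge0// ltW.
(* For [h >= dl] the trivial bound 2 is at most [2 / dl * h]; this makes the constant valid for all
   positive [h]. *)
apply: (@le_trans _ _ 2).
  apply: le_trans (ler_normB _ _) _; have -> : 2 = 1 + 1 :> R by ring.
  apply: lerD; last exact: W1.
  by case: bW => mW _; exact: (semigroup_bound aff (ltW h0) px mW W1).
rewrite mulrDl; apply: (@le_trans _ _ (2 / dl * h)); last by rewrite lerDr mulr_ge0// ltW.
by rewrite mulrAC ler_pdivlMr// ler_wpM2l.
Qed.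

End Domination.

(** * Functions with vanishing right derivative *)

Section ZeroRightDerivative.
Variable R : realType.

(** A continuation argument: for a slope [e > 0], the bound [|K r - K 0| <= e * r] holds below some
    maximal [s]; left continuity includes [s] itself, and the right estimate would carry the bound
    past [s] if [s < T]. *)
Lemma zero_right_derivative_const (K : R -> R) (T : R) : 0 <= T ->
  (forall s e : R, 0 < s -> s <= T -> 0 < e ->
     \forall h \near (0 : R)^'+, `|K (s - h) - K s| <= e) ->
  (forall s e : R, 0 <= s -> s < T -> 0 < e ->
     \forall h \near (0 : R)^'+, `|K (s + h) - K s| <= e * h) ->
  K T = K 0.
Proof.
move=> T0 hl hr; apply/eqP; rewrite -subr_eq0 -normr_le0; apply/ler_addgt0Pr => e1 e10.
(* The denominator [T + 1] keeps the total error [e * T] below [e1] and is positive even for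
   [T = 0]. *)
rewrite add0r; pose e := e1 / (T + 1).
have e0 : 0 < e by rewrite divr_gt0// ltr_wpDl.
suff h : `|K T - K 0| <= e * T.
  apply: le_trans h _; rewrite /e mulrAC ler_pdivrMr ?ltr_wpDl//.
  by rewrite ler_wpM2l ?(ltW e10)// lerDl.
pose E : set R := [set s | 0 <= s <= T /\ forall r, 0 <= r -> r <= s -> `|K r - K 0| <= e * r].
have E0 : E 0.
  split; first by rewrite lexx.
  move=> r r0 r1; have -> : r = 0 by apply/le_anti; rewrite r0 r1.
  by rewrite subrr normr0 mulr0.
have ubE : ubound E T by move=> s [/andP[]].
have hsE : has_sup E by split; [exists 0|exists T].
pose s := sup E.
have s0 : 0 <= s by apply: ub_le_sup => //; exists T.
have sT : s <= T by apply: ge_sup => //; exists 0.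
have below r : 0 <= r -> r < s -> `|K r - K 0| <= e * r.
  move=> r0 rs; have [r' [_ hr'] rr'] := sup_gt (ex_intro _ 0 E0) rs.
  by apply: hr' => //; exact: ltW.
have Ks : `|K s - K 0| <= e * s.
  have [s1|s1] := ltP 0 s; last first.
    have -> : s = 0 by apply/le_anti; rewrite s0 s1.
    by rewrite subrr normr0 mulr0.
  apply/ler_addgt0Pr => e2 e20.
  have [dl dl0 hdl] := near_right (hl s e2 s1 sT e20).
  pose h := Num.min dl s / 2.
  have hm : 0 < Num.min dl s by rewrite lt_min dl0.
  have h0 : 0 < h by rewrite divr_gt0.
  have hd : h < Num.min dl s by rewrite /h ltr_pdivrMr// mulr_natr mulr2n ltrDl.
  move: (hd); rewrite lt_min => /andP[hd1 hs].
  have h1 := hdl h h0 hd1.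
  have h2 := below (s - h) (ltac:(by rewrite subr_ge0 ltW)) (ltac:(by rewrite ltrBlDr ltrDl)).
  have -> : K s - K 0 = (K (s - h) - K 0) - (K (s - h) - K s) by ring.
  apply: le_trans (ler_normB _ _) _; apply: lerD => //.
  by apply: le_trans h2 _; rewrite ler_pM2l// gerBl ltW.
have [sT'|sT'] := ltP s T; last first.
  by have -> : T = s by apply/le_anti; rewrite sT sT'.
have [dl dl0 hdl] := near_right (hr s e s0 sT' e0).
pose h := Num.min dl (T - s) / 2.
have hm : 0 < Num.min dl (T - s) by rewrite lt_min dl0 subr_gt0.
have h0 : 0 < h by rewrite divr_gt0.
have hd : h < Num.min dl (T - s) by rewrite /h ltr_pdivrMr// mulr_natr mulr2n ltrDl.
move: hd; rewrite lt_min => /andP[hd1 hs].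
have : E (s + h).
  split.
    by apply/andP; split; [rewrite addr_ge0// ltW|rewrite -lerBrDl ltW].
  move=> r r0 rs; have [r1|r1] := ltP r s; first exact: below.
  have [->//|/eqP rs'] := eqVneq r s.
  have rh : 0 < r - s by rewrite subr_gt0 lt_neqAle eq_sym r1 andbT; apply/eqP.
  have rd : r - s < dl by apply: le_lt_trans hd1; rewrite lerBlDl.
  have := hdl _ rh rd; rewrite [s + _]addrC subrK => h1.
  have -> : K r - K 0 = (K r - K s) + (K s - K 0) by ring.
  apply: le_trans (ler_normD _ _) _; apply: le_trans (lerD h1 Ks) _.
  by rewrite -mulrDr subrK.
move=> /(ub_le_sup (ex_intro _ T ubE)); rewrite -/s => h1.
by move: h0; rewrite -(ltrDl s) ltNge h1.
Qed.

End ZeroRightDerivative.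

(** * Right derivative and continuity in time of the semigroup *)

Section SemigroupDerivative.
Variables (R : realType) (d : nat).
Variables (alpha b : 'M[R]_d) (B : 'M[R]_d -> 'M[R]_d) (c : R) (gamma : 'M[R]_d).
Variables (m nu : {measure set (Mx R d) -> \bar R}) (H : 'M[R]_d -> 'M[R]_d).
Variable p : R -> 'M[R]_d -> {measure set (Mx R d) -> \bar R}.
Hypothesis aff : affine_transition p.
Hypothesis gen : has_generator p alpha b B c gamma m nu H.
Notation M := 'M[R]_d.
Notation S := (@psdset R d).
Notation P := (semigroup p).
Notation bounded := (@bounded_fun R d).
Implicit Types (A C x : M) (a th t h K : R).

(** Rate of change of a wave whose exponents [a, th, A, C] move with velocities [p1, p2, P1, P2].
    The formula of [generator_wave] has the same shape, which is why the two derivatives in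
    [wave_duality] cancel. *)
Definition dwave (p1 p2 : R) (P1 P2 : M) a th A C y : R :=
  - (p1 + inner P1 y) * wave a th A C y + (p2 + inner P2 y) * wave a (th + pi / 2) A C y.

Lemma cont_dwave p1 p2 P1 P2 a th A C : continuous (dwave p1 p2 P1 P2 a th A C).
Proof.
apply: contD; apply: contM; try exact: cont_wave.
  by apply: contN; apply: contD; [exact: cont_cst|exact: cont_innerr].
by apply: contD; [exact: cont_cst|exact: cont_innerr].
Qed.

Lemma affine_le (k : R) (D : M) y : psd y ->
  `|k + inner D y| <= (`|k| + mxsum D) * (1 + \tr y).
Proof.
move=> py; have r0 := psd_tr_ge0 py.
apply: le_trans (ler_normD _ _) _; rewrite mulrDl; apply: lerD.
  by rewrite ler_peMr// lerDl.
apply: le_trans (inner_le_tr D py) _.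
by rewrite ler_wpM2l ?mxsum_ge0// lerDr.
Qed.

Lemma wave_coercive a th A C y (l : R) : psd (A - l%:M) -> psd y ->
  `|wave a th A C y| <= expR (- a) * expR (- (l * \tr y)).
Proof.
move=> pl py; apply: le_trans (wave_norm _ _ _ _ _) _.
by rewrite opprD expRD ler_wpM2l ?expR_ge0// ler_expR lerN2 inner_coercive.
Qed.

Lemma bounded_dwave p1 p2 P1 P2 a th A C : pd A -> bounded (dwave p1 p2 P1 P2 a th A C).
Proof.
move=> pA; split; first exact: cont_measurable (@measurable_psdset R d) (@cont_dwave _ _ _ _ _ _ _ _).
have /pdP[l l0 pl] := pA.
have [K3 h3] := pow_exp_bounded 1 l0.
exists ((`|p1| + mxsum P1 + (`|p2| + mxsum P2)) * expR (- a) * K3) => y py.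
have r0 := psd_tr_ge0 py; have := h3 _ r0; rewrite expr1 => h4.
have k1 : 0 <= `|p1| + mxsum P1 by rewrite addr_ge0// mxsum_ge0.
have k2 : 0 <= `|p2| + mxsum P2 by rewrite addr_ge0// mxsum_ge0.
apply: (@le_trans _ _ ((`|p1| + mxsum P1 + (`|p2| + mxsum P2)) * expR (- a)
   * ((1 + \tr y) * expR (- (l * \tr y))))); last first.
  by rewrite ler_wpM2l// mulr_ge0 ?expR_ge0// addr_ge0.
have e1 (k : R) (D : M) s : `|(k + inner D y) * wave a s A C y|
   <= (`|k| + mxsum D) * (1 + \tr y) * (expR (- a) * expR (- (l * \tr y))).
  rewrite normrM; exact: (ler_pM (normr_ge0 _) (normr_ge0 _) (affine_le k D py)
    (wave_coercive a s C pl py)).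
apply: le_trans (ler_normD _ _) _; rewrite mulNr normrN.
apply: le_trans (lerD (e1 _ _ _) (e1 _ _ _)) _.
by rewrite le_eqVlt; apply/orP; left; apply/eqP; ring.
Qed.

(** By Chapman-Kolmogorov the quotient is [P s] of [(P h W - W) / h], which converges to [V]
    pointwise on the cone; the constant of [wave_domination] is an integrable majorant because
    [p s x] has mass at most 1. *)
Lemma semigroup_right_derivative s x a th A C (V : M -> R) :
  0 <= s -> psd x -> pd A -> sym C -> bounded V ->
  (forall y, psd y -> generator alpha b B c gamma m nu H (wave a th A C) y = V y) ->
  (P (s + h) (wave a th A C) x - P s (wave a th A C) x) / h @[h --> 0^'+] --> P s V x.
Proof.
move=> s0 px pA sC [mV [KV bV]] gV; set W := wave a th A C.
have psA := pd_psd pA; have [mW [KW bW]] := bounded_wave a th C psA.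
have BW : bounded W by split => //; exists KW.
have [K K0 hK] := wave_domination aff gen a th pA sC.
apply/cvg_at_rightP => u [u0 u1].
have mS := @measurable_psdset R d.
pose q n y := (u n)^-1 * P (u n) W y + (- (u n)^-1 * W y + 0).
have qE n y : q n y = (P (u n) W y - W y) / u n by rewrite /q; ring.
have BP n : bounded (P (u n) W).
  split; first by have [] := chapman_kolmogorov aff s0 (ltW (u0 n)) px mW bW.
  by exists KW => y py; exact: (semigroup_bound aff (ltW (u0 n)) py mW bW).
have b0 := @bounded_cst R d 0.
have Bq1 n := bounded_comb (- (u n)^-1) BW b0.
have Bq n : bounded (q n) by exact: bounded_comb.
have sq n : (P (s + u n) W x - P s W x) / u n = P s (q n) x.
  rewrite /q (semigroup_comb aff _ s0 px (BP n) (Bq1 n)).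
  rewrite (semigroup_comb aff _ s0 px BW b0) semigroup0 addr0.
  have [_ ->] := chapman_kolmogorov aff s0 (ltW (u0 n)) px mW bW.
  by rewrite -/W; ring.
have -> : (fun n => (P (s + u n) W x - P s W x) / u n) = (fun n => P s (q n) x).
  by apply/funext => n; rewrite sq.
apply: (@fine_cvg _ _ _ _ (fun n => \int[p s x]_(y in S) (q n y)%:E)%E).
have -> : (P s V x)%:E = (\int[p s x]_(y in S) (V y)%:E)%E.
  rewrite /semigroup /Rintegral fineK//; apply: integrable_fin_num => //.
  exact: (bounded_integrable aff s0 px mV bV).
apply: (@dominated_cvg _ _ _ _ _ mS _ _ (EFin \o (fun=> K))) => //.
- by move=> n; apply/measurable_EFinP; case: (Bq n).
- move=> y py; apply: cvg_EFin; first by apply: nearW.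
  have /cvg_at_rightP/(_ u (conj u0 u1)) := gen (wave_rapidly_decreasing a th C pA) py.
  rewrite gV//; apply: cvg_trans; apply: near_eq_cvg; apply: nearW => n /=.
  by rewrite qE.
- apply: (bounded_integrable aff s0 px (K := K)); first exact: measurable_cst.
  by move=> y _; rewrite ger0_norm.
- move=> n y py; rewrite lee_fin qE normrM (gtr0_norm (_ : 0 < (u n)^-1)) ?invr_gt0//.
  by rewrite ler_pdivrMr//; apply: hK.
Qed.

Lemma clamp_norm_le K (v : R) : 0 <= K -> `|Num.max (- K) (Num.min K v)| <= K.
Proof.
move=> K0; rewrite ler_norml le_max lexx /= ge_max ge_min lexx/= andbT.
by rewrite (le_trans _ K0)// oppr_le0.
Qed.

Lemma clamp_id K (v : R) : `|v| <= K -> Num.max (- K) (Num.min K v) = v.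
Proof.
by rewrite ler_norml => /andP[h1 h2]; rewrite min_r// max_r.
Qed.

(* Stochastic continuity is assumed for functions that are bounded on the whole
   matrix space, hence the truncation. *)
Lemma stochastic_continuity (f : M -> R) x s (e : R) :
  psd x -> continuous f -> bounded f -> 0 <= s -> 0 < e ->
  exists2 dl : R, 0 < dl &
    forall t, 0 <= t -> `|t - s| < dl -> `|P t f x - P s f x| <= e.
Proof.
move=> px cf [mf [K bK]] s0 e0.
have K0 : 0 <= K by apply: le_trans (bK 0 (psd0 R d)).
pose g y := Num.max (- K) (Num.min K (f y)).
have cg : continuous g.
  apply: cont_maxr; first exact: cont_cst.
  by apply: cont_minr => //; exact: cont_cst.
have bg : exists K', forall y, `|g y| <= K' by exists K => y; exact: clamp_norm_le.
have gf t : P t f x = P t g x.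
  apply: eq_Rintegral => y; rewrite inE => py; by rewrite /g clamp_id// bK.
have [[_ _ _ _ sc] _] := aff.
have /subspace_continuousP /(_ s s0) /cvgrPdist_le /(_ e e0) := sc x g px cg bg.
rewrite /within /= => -[dl /= dl0 hdl]; exists dl => // t t0 ts.
by rewrite distrC !gf; apply: hdl => //=; rewrite distrC.
Qed.

End SemigroupDerivative.

(** * First-order expansion of a damped cosine with quadratic remainder *)

Section ExpCosTaylor.
Variable R : realType.

(** Interpolate linearly between the two exponents: the derivative of the remainder [f] is built
    from increments of [E], which [expcos_lipschitz] bounds by [exp (- k)] times the displacement.
    That factor later compensates growth in the trace. *)
Lemma expcos_taylor (k a b a' b' : R) : k <= a -> k <= a' ->
  `|expR (- a') * cos b' - expR (- a) * cos b + (a' - a) * (expR (- a) * cos b)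
    + (b' - b) * (expR (- a) * sin b)| <= expR (- k) * (`|a' - a| + `|b' - b|) ^+ 2.
Proof.
move=> ka ka'; set u := a' - a; set v := b' - b; set L := `|u| + `|v|.
have L0 : 0 <= L by rewrite addr_ge0.
pose E s w := expR (- (a + s * u)) * cos (w + s * v).
pose E0 w := expR (- a) * cos w.
pose f s := E s b - E0 b + s * (u * E0 b + v * E0 (b - pi / 2)).
pose f' s := - u * (E s b - E0 b) - v * (E s (b - pi / 2) - E0 (b - pi / 2)).
have sE (w : R) : cos (w - pi / 2) = sin w by rewrite -sinDpihalf subrK.
have cl (k1 k2 : R) : continuous (fun s : R => k1 + s * k2).
  apply: contD; first exact: cont_cst.
  by apply: contM; [move=> t; exact: cvg_id|exact: cont_cst].
have dl (k1 k2 t : R) : is_derive t 1 (fun s : R => k1 + s * k2) k2.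
  have := derD (der_cst k1 t) (derM (der_id t) (der_cst k2 t)).
  by apply: is_derive_val; ring.
have cE w : continuous (fun s => E s w).
  by apply: contM; [apply: cont_expR; apply: contN; exact: cl|apply: cont_cos; exact: cl].
have dE (w t : R) : is_derive t 1 (fun s => E s w) (- u * E t w - v * E t (w - pi / 2)).
  have := derM (der_expR (derN (dl a u t))) (der_cos (dl w v t)).
  apply: is_derive_val; rewrite /E addrAC sE; ring.
have cf : continuous f.
  apply: contD; first by apply: contB; [exact: cE|exact: cont_cst].
  by apply: contM; [move=> t; exact: cvg_id|exact: cont_cst].
have df (t : R) : is_derive t 1 f (f' t).
  have := derD (derB (dE b t) (der_cst (E0 b) t))
    (derM (der_id t) (der_cst (u * E0 b + v * E0 (b - pi / 2)) t)).
  by apply: is_derive_val; rewrite /f'; ring.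
have bE w s : 0 < s < 1 -> `|E s w - E0 w| <= expR (- k) * L.
  move=> /andP[s0 s1].
  have ks : k <= a + s * u.
    have -> : a + s * u = (1 - s) * a + s * a' by rewrite /u; ring.
    have -> : k = (1 - s) * k + s * k by ring.
    by apply: lerD; rewrite ler_wpM2l// ?subr_ge0 ltW.
  apply: le_trans (expcos_lipschitz _ _ ks ka) _.
  rewrite ler_wpM2l ?expR_ge0//.
  rewrite [a + _]addrC addrK [w + _]addrC addrK !normrM (gtr0_norm s0) -mulrDr.
  by rewrite -/L ler_piMl// ltW.
have bf (t : R) : 0 < t < 1 -> `|f' t| <= expR (- k) * L ^+ 2.
  move=> t01; rewrite /f'; apply: le_trans (ler_normB _ _) _.
  have -> : expR (- k) * L ^+ 2 = `|u| * (expR (- k) * L) + `|v| * (expR (- k) * L).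
    by rewrite /L; ring.
  by rewrite mulNr normrN !normrM; apply: lerD; rewrite ler_wpM2l// bE.
have cg : continuous (fun s : R => 0 + s * (expR (- k) * L ^+ 2)) by exact: cl.
have dg (t : R) : 0 < t < 1 ->
  is_derive t 1 (fun s : R => 0 + s * (expR (- k) * L ^+ 2)) (expR (- k) * L ^+ 2).
  by move=> _; exact: dl.
have f0 : `|f 0| <= 0 + 0 * (expR (- k) * L ^+ 2).
  by rewrite /f /E /E0 !mul0r !addr0 subrr normr0.
have := @deriv_bound R f f' _ _ 1 cf cg (fun t _ => df t) dg bf f0 1.
rewrite ler01 lexx => /(_ isT); rewrite add0r mul1r; apply: le_trans.
rewrite /f /E /E0 !mul1r sE.
have -> : a + u = a' by rewrite /u; ring.
have -> : b + v = b' by rewrite /v; ring.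
rewrite le_eqVlt; apply/orP; left; apply/eqP; congr `|_|; ring.
Qed.

Lemma der_left_approx (f : R -> R) (t p e : R) : is_derive t 1 f p -> 0 < e ->
  \forall h \near (0 : R)^'+, `|f (t - h) - f t + h * p| <= e * h.
Proof.
move=> [df vf] e0; have := df; rewrite /derivable => dc.
have /cvgrPdist_le /(_ e e0) : h^-1 *: ((f \o shift t) (h *: 1) - f t) @[h --> 0^'] --> p.
  by rewrite -vf.
move=> -[dl /= dl0 hdl]; exists dl => // h /=; rewrite sub0r normrN => hd h0.
have := hdl (- h); rewrite /= sub0r opprK => /(_ hd).
rewrite oppr_eq0 => /(_ (lt0r_neq0 h0)).
rewrite /GRing.scale /= mulr1 [- h + t]addrC => hh.
have -> : f (t - h) - f t + h * p = h * (p - (- h)^-1 * (f (t - h) - f t)).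
  by field; rewrite gt_eqF.
by rewrite normrM (gtr0_norm h0) mulrC ler_pM2r.
Qed.

End ExpCosTaylor.

(** * Continuity and first-order estimates for matrix paths *)

Section MatrixPathEstimates.
Variables (R : realType) (d : nat).
Notation M := 'M[R]_d.
Implicit Types (X : R -> M).

(** The gauge [q] is left general so that the same statement yields continuity ([q = 1]) and
    first-order expansions ([q] the time step). *)
Lemma mxsum_near (F : set_system R) (X : R -> M) (q : R -> R) (e : R) : Filter F ->
  0 < e -> (forall s, 0 <= q s) ->
  (forall e' i j, 0 < e' -> \forall s \near F, `|X s i j| <= e' * q s) ->
  \forall s \near F, mxsum (X s) <= e * q s.
Proof.
move=> FF e0 q0 h; pose e' := e / (d%:R * d%:R + 1).
have dd : 0 < d%:R * d%:R + 1 :> R by rewrite ltr_wpDl// mulr_ge0.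
have e'0 : 0 < e' by rewrite divr_gt0.
have h1 : \forall s \near F, forall ij : 'I_d * 'I_d, `|X s ij.1 ij.2| <= e' * q s.
  by apply: filter_forall => ij; exact: h.
apply: filterS h1 => s hs.
apply: (@le_trans _ _ (\sum_(i < d) \sum_(j < d) (e' * q s))).
  by apply: ler_sum => i _; apply: ler_sum => j _; exact: (hs (i, j)).
rewrite !sumr_const !card_ord -mulrnA -mulr_natl natrM mulrA ler_wpM2r// /e'.
by rewrite mulrA ler_pdivrMr// mulrC ler_wpM2l ?(ltW e0)// lerDl.
Qed.

Lemma mder_left_approx X (t : R) (x : M) (e : R) : mder t X x -> 0 < e ->
  \forall h \near (0 : R)^'+, mxsum (X (t - h) - X t + h *: x) <= e * h.
Proof.
move=> dX e0.
(* [mxsum_near] asks for a gauge that is nonnegative everywhere, hence [Num.max h 0] in place of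
   [h]. *)
have h1 : \forall h \near (0 : R)^'+, mxsum (X (t - h) - X t + h *: x) <= e * Num.max h 0.
  apply: mxsum_near => // [s|e' i j e'0]; first by rewrite le_max lexx orbT.
  near=> h; have h0 : 0 < h by near: h; exact: nbhs_right_gt.
  rewrite max_l ?(ltW h0)// !mxE; near: h.
  exact: der_left_approx (dX i j) e'0.
near=> h; have h0 : 0 < h by near: h; exact: nbhs_right_gt.
by rewrite -[X in e * X](max_l (ltW h0)); near: h.
Unshelve. all: by end_near.
Qed.

Lemma cont_near (f : R -> R) (t e : R) : continuous f -> 0 < e ->
  \forall s \near t, `|f t - f s| <= e.
Proof.
move=> cf e0; have /cvgrPdist_le : f s @[s --> t] --> f t by exact: cf.
exact.
Qed.

Lemma mcont_near X (t : R) (e : R) : mcont X -> 0 < e ->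
  \forall s \near t, mxsum (X s - X t) <= e.
Proof.
move=> cX e0.
have : \forall s \near t, mxsum (X s - X t) <= e * 1.
  apply: (@mxsum_near (nbhs t) (fun s => X s - X t) (fun=> 1)) => // e' i j e'0.
  apply: filterS (cont_near t (cX i j) e'0) => s.
  by rewrite mulr1 !mxE distrC.
by apply: filterS => s; rewrite mulr1.
Qed.

Lemma near_shift (Q : R -> Prop) (t : R) : (\forall s \near t, Q s) ->
  (\forall h \near (0 : R)^'+, Q (t + h)) /\ (\forall h \near (0 : R)^'+, Q (t - h)).
Proof.
move=> -[e /= e0 he]; split; exists e => //= h /=; rewrite sub0r normrN => hd h0; apply: he => /=.
  by rewrite opprD addNKr normrN.
by rewrite subKr.
Qed.

End MatrixPathEstimates.

(** * Waves along a path of exponents, uniformly on the cone *)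

Section WavePaths.
Variables (R : realType) (d : nat).
Notation M := 'M[R]_d.
Variables (f1 f2 : R -> R) (A C : R -> M).
Hypotheses (cf1 : continuous f1) (cf2 : continuous f2) (cA : mcont A) (cC : mcont C).
Hypothesis symA : forall s, sym (A s).
Hypothesis f1A : forall t : R, 0 <= t -> 0 <= f1 t /\ pd (A t).

Definition path_wave (th t : R) : M -> R := wave (f1 t) (th + f2 t) (A t) (C t).

(** Uniformity on the unbounded cone: the exponents move by [O(n * (1 + \tr y))], and this growth is
    absorbed by [exp (- (l * \tr y))], where [near_pd] supplies one margin [l] for all times near
    [t]. *)
Lemma path_wave_cont (th t e : R) : 0 <= t -> 0 < e ->
  \forall h \near (0 : R)^'+, forall y, psd y -> `|path_wave th (t + h) y - path_wave th t y| <= e.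
Proof.
move=> t0 e0; have [ft pA] := f1A t0.
have [l l0 nA] := near_pd cA symA pA.
have pl := nbhs_singleton nA.
have [K3 h3] := pow_exp_bounded 1 l0.
have K30 : 0 <= K3.
  by apply: le_trans (h3 0 (lexx 0)); rewrite mulr_ge0 ?expR_ge0// exprn_ge0// addr0.
(* The 4 accounts for two exponents, each moving by at most [2 * n * (1 + r)]; [K3 + 1] is positive
   even if [K3] is 0. *)
pose n := e / (4 * (K3 + 1)).
have n0 : 0 < n by rewrite divr_gt0// mulr_gt0// ltr_wpDl.
have n1 : 4 * n * K3 <= e.
  rewrite /n (_ : 4 * _ * K3 = e * (K3 / (K3 + 1))); last by field; rewrite gt_eqF// ltr_wpDl.
  by rewrite ler_piMr ?(ltW e0)// ler_pdivrMr ?ltr_wpDl// mul1r lerDl.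
have [nA' _] := near_shift nA.
have [nAc _] := near_shift (mcont_near t cA n0).
have [nCc _] := near_shift (mcont_near t cC n0).
have [nf1 _] := near_shift (cont_near t cf1 n0).
have [nf2 _] := near_shift (cont_near t cf2 n0).
near=> h => y py.
have h0 : 0 < h by near: h; exact: nbhs_right_gt.
have [fh _] := f1A (addr_ge0 t0 (ltW h0)).
have pl' : psd (A (t + h) - l%:M) by near: h.
have r0 := psd_tr_ge0 py; set r := \tr y in r0.
have k1 : l * r <= f1 (t + h) + inner (A (t + h)) y.
  by apply: le_trans (inner_coercive pl' py) _; rewrite lerDr.
have k2 : l * r <= f1 t + inner (A t) y.
  by apply: le_trans (inner_coercive pl py) _; rewrite lerDr.
rewrite /path_wave /wave; apply: le_trans (expcos_lipschitz _ _ k1 k2) _.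
have aff (F : R -> R) (X : R -> M) (k : R) : `|F t - F (t + h)| <= n ->
    mxsum (X (t + h) - X t) <= n ->
    `|k + F (t + h) + inner (X (t + h)) y - (k + F t + inner (X t) y)| <= 2 * n * (1 + r).
  move=> hF hX.
  have -> : k + F (t + h) + inner (X (t + h)) y - (k + F t + inner (X t) y)
    = - (F t - F (t + h)) + inner (X (t + h) - X t) y by rewrite innerBl; ring.
  apply: le_trans (ler_normD _ _) _; rewrite normrN.
  apply: le_trans (lerD hF (inner_le_tr _ py)) _.
  apply: (@le_trans _ _ (n + n * r)).
    by rewrite lerD2l ler_wpM2r.
  by have : 0 <= n * r by [rewrite mulr_ge0// ltW]; lra.
have a1 : `|f1 (t + h) + inner (A (t + h)) y - (f1 t + inner (A t) y)| <= 2 * n * (1 + r).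
  have := aff f1 A 0; rewrite !add0r; apply; first by near: h.
  by near: h.
have a2 : `|th + f2 (t + h) + inner (C (t + h)) y - (th + f2 t + inner (C t) y)|
    <= 2 * n * (1 + r).
  by apply: aff; near: h.
apply: le_trans (ler_wpM2l (expR_ge0 _) (lerD a1 a2)) _; apply: le_trans n1.
have -> : expR (- (l * r)) * (2 * n * (1 + r) + 2 * n * (1 + r))
  = 4 * n * ((1 + r) * expR (- (l * r))) by ring.
have h4 : (1 + r) * expR (- (l * r)) <= K3 := h3 r r0.
by apply: ler_wpM2l h4; rewrite mulr_ge0// ltW.
Unshelve. all: by end_near.
Qed.

(** The Taylor remainder is quadratic in the displacement, hence of order [h ^ 2 * (1 + \tr y) ^ 2];
    this is why [pow_exp_bounded] is taken with exponent 2. The linear terms reproduce [dwave] up to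
    the errors in the derivatives of the exponents. *)
Lemma path_wave_deriv (th t e p1 p2 : R) (P1 P2 : M) : 0 < t -> 0 < e ->
  is_derive t 1 f1 p1 -> is_derive t 1 f2 p2 -> mder t A P1 -> mder t C P2 ->
  \forall h \near (0 : R)^'+, forall y, psd y ->
    `|path_wave th (t - h) y - path_wave th t y
       + h * dwave p1 p2 P1 P2 (f1 t) (th + f2 t) (A t) (C t) y| <= e * h.
Proof.
move=> t0 e0 d1 d2 dA dC; have [ft pA] := f1A (ltW t0).
have [l l0 nA] := near_pd cA symA pA.
have pl := nbhs_singleton nA.
have [K3 h3] := pow_exp_bounded 2 l0.
have K30 : 0 <= K3.
  by apply: le_trans (h3 0 (lexx 0)); rewrite mulr_ge0 ?expR_ge0// exprn_ge0// addr0.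
pose k := `|p1| + mxsum P1 + (`|p2| + mxsum P2) + 4.
have k0 : 0 <= k by rewrite !addr_ge0// mxsum_ge0.
(* Error allowed in the four derivatives: the cap 1 serves the crude bound [L] on displacements, and
   the other value leaves half of [e] for the second-order part. *)
pose n := Num.min 1 (e / (8 * (K3 + 1))).
have K31 : 0 < K3 + 1 by rewrite ltr_wpDl.
have n0 : 0 < n by rewrite lt_min ltr01 divr_gt0// mulr_gt0.
have n1 : n <= 1 by rewrite /n ge_min lexx.
have n2 : 4 * n * K3 <= e / 2.
  apply: (@le_trans _ _ (4 * (e / (8 * (K3 + 1))) * K3)).
    by rewrite ler_wpM2r// ler_wpM2l// /n ge_min lexx orbT.
  rewrite (_ : 4 * _ * K3 = e / 2 * (K3 / (K3 + 1))); last by field; rewrite gt_eqF.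
  by rewrite ler_piMr ?divr_ge0 ?(ltW e0)// ler_pdivrMr// mul1r lerDl.
have [_ nA'] := near_shift nA.
have q1 := der_left_approx d1 n0; have q2 := der_left_approx d2 n0.
have qA := mder_left_approx dA n0; have qC := mder_left_approx dC n0.
(* Chosen so that the bound [h * (dl * (k ^+ 2 + 1) * (K3 + 1))] on the second-order part equals
   [h * (e / 2)]. *)
pose dl := e / 2 / ((K3 + 1) * (k ^+ 2 + 1)).
have kk : 0 < k ^+ 2 + 1 by rewrite ltr_wpDl// sqr_ge0.
have dl0 : 0 < dl by rewrite divr_gt0 ?divr_gt0// mulr_gt0.
near=> h => y py.
have h0 : 0 < h by near: h; exact: nbhs_right_gt.
have ht : h < t by near: h; exact: nbhs_right_lt.
have hdl : h <= dl by near: h; exact: nbhs_right_le.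
have [fh _] := f1A (ltac:(by rewrite subr_ge0 ltW) : 0 <= t - h).
have pl' : psd (A (t - h) - l%:M) by near: h.
have r0 := psd_tr_ge0 py; set r := \tr y in r0.
have k1 : l * r <= f1 (t - h) + inner (A (t - h)) y.
  by apply: le_trans (inner_coercive pl' py) _; rewrite lerDr.
have k2 : l * r <= f1 t + inner (A t) y.
  by apply: le_trans (inner_coercive pl py) _; rewrite lerDr.
have aff (F : R -> R) (X : R -> M) (k' q : R) (Q : M) : `|F (t - h) - F t + h * q| <= n * h ->
    mxsum (X (t - h) - X t + h *: Q) <= n * h ->
    `|k' + F (t - h) + inner (X (t - h)) y - (k' + F t + inner (X t) y)
       + h * (q + inner Q y)| <= 2 * n * h * (1 + r).
  move=> hF hX.
  have -> : k' + F (t - h) + inner (X (t - h)) y - (k' + F t + inner (X t) y)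
       + h * (q + inner Q y)
    = (F (t - h) - F t + h * q) + inner (X (t - h) - X t + h *: Q) y.
    by rewrite innerDl innerBl innerZl; ring.
  apply: le_trans (ler_normD _ _) _.
  apply: le_trans (lerD hF (inner_le_tr _ py)) _.
  apply: (@le_trans _ _ (n * h + n * h * r)).
    by rewrite lerD2l ler_wpM2r.
  have : 0 <= n * h * r by rewrite !mulr_ge0// ltW.
  have : 0 <= n * h by rewrite mulr_ge0// ltW.
  lra.
set a := f1 t + inner (A t) y in k2; set a' := f1 (t - h) + inner (A (t - h)) y in k1.
set be := th + f2 t + inner (C t) y; set be' := th + f2 (t - h) + inner (C (t - h)) y.
have a1 : `|a' - a + h * (p1 + inner P1 y)| <= 2 * n * h * (1 + r).
  have := aff f1 A 0 p1 P1; rewrite !add0r; apply; first by near: h.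
  by near: h.
have a2 : `|be' - be + h * (p2 + inner P2 y)| <= 2 * n * h * (1 + r).
  by apply: aff; near: h.
have lin (u q : R) (Q : M) : `|u + h * (q + inner Q y)| <= 2 * n * h * (1 + r) ->
    `|u| <= h * ((`|q| + mxsum Q + 2) * (1 + r)).
  move=> hu; have -> : u = (u + h * (q + inner Q y)) - h * (q + inner Q y) by ring.
  apply: le_trans (ler_normB _ _) _; rewrite [X in _ + X]normrM (gtr0_norm h0).
  apply: le_trans (lerD hu (ler_wpM2l (ltW h0) (affine_le q Q py))) _.
  rewrite -/r.
  have -> : h * ((`|q| + mxsum Q + 2) * (1 + r))
    = h * (2 * (1 + r)) + h * ((`|q| + mxsum Q) * (1 + r)) by ring.
  rewrite lerD2r.
  rewrite (_ : 2 * n * h * (1 + r) = h * (2 * (1 + r)) * n); last by ring.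
  by rewrite ler_piMr// !mulr_ge0// ?(ltW h0)// addr_ge0.
have L : `|a' - a| + `|be' - be| <= h * (k * (1 + r)).
  apply: le_trans (lerD (lin _ _ _ a1) (lin _ _ _ a2)) _.
  by rewrite le_eqVlt; apply/orP; left; apply/eqP; rewrite /k; ring.
have ty := expcos_taylor be be' k2 k1.
set E := expR (- (l * r)) in ty.
have E0 : 0 <= E by exact: expR_ge0.
have h32 : (1 + r) ^+ 2 * E <= K3 := h3 r r0.
have r1 : 1 + r <= (1 + r) ^+ 2 by rewrite expr2 ler_peMr ?addr_ge0// lerDl.
have h31 : (1 + r) * E <= K3 by apply: le_trans h32; rewrite ler_wpM2r.
have ea : expR (- a) <= E by rewrite ler_expR lerN2.
rewrite /path_wave /dwave wave_shift /wave -/a -/a' -/be -/be'.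
move: ty; set T1 := expR (- a') * cos be'; set c1 := expR (- a) * cos be.
set s1 := expR (- a) * sin be => ty.
have -> : T1 - c1 + h * (- (p1 + inner P1 y) * c1 + (p2 + inner P2 y) * - s1)
  = (T1 - c1 + (a' - a) * c1 + (be' - be) * s1)
    - ((a' - a + h * (p1 + inner P1 y)) * c1 + (be' - be + h * (p2 + inner P2 y)) * s1).
  by ring.
have c1E : `|c1| <= E.
  apply: le_trans ea; rewrite normrM (ger0_norm (expR_ge0 _)) ler_piMr ?expR_ge0//.
  exact: cos_norm_le1.
have s1E : `|s1| <= E.
  apply: le_trans ea; rewrite normrM (ger0_norm (expR_ge0 _)) ler_piMr ?expR_ge0//.
  by rewrite ler_norml sin_geN1 sin_le1.
have b1 : `|T1 - c1 + (a' - a) * c1 + (be' - be) * s1| <= h * (e / 2).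
  apply: le_trans ty _.
  have L2 : (`|a' - a| + `|be' - be|) ^+ 2 <= (h * (k * (1 + r))) ^+ 2.
    by rewrite lerXn2r// nnegrE ?addr_ge0// !mulr_ge0// ?(ltW h0)// addr_ge0.
  apply: le_trans (ler_wpM2l E0 L2) _.
  have -> : E * (h * (k * (1 + r))) ^+ 2 = h * (h * k ^+ 2 * ((1 + r) ^+ 2 * E)) by ring.
  rewrite ler_wpM2l ?(ltW h0)//.
  apply: (@le_trans _ _ (dl * (k ^+ 2 + 1) * (K3 + 1))).
    have hk : h * k ^+ 2 <= dl * (k ^+ 2 + 1).
      by apply: (ler_pM (ltW h0) (sqr_ge0 k) hdl); rewrite lerDl.
    have hE : (1 + r) ^+ 2 * E <= K3 + 1 by apply: le_trans h32 _; rewrite lerDl.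
    exact: (ler_pM (mulr_ge0 (ltW h0) (sqr_ge0 k)) (mulr_ge0 (sqr_ge0 (1 + r)) E0) hk hE).
  by rewrite le_eqVlt; apply/orP; left; apply/eqP; rewrite /dl; field; rewrite !gt_eqF.
have b2 (u v : R) : `|u| <= 2 * n * h * (1 + r) -> `|v| <= E ->
    `|u * v| <= 2 * n * K3 * h.
  move=> hu hv; rewrite normrM.
  apply: le_trans (ler_pM (normr_ge0 _) (normr_ge0 _) hu hv) _.
  have -> : 2 * n * h * (1 + r) * E = 2 * n * h * ((1 + r) * E) by ring.
  have -> : 2 * n * K3 * h = 2 * n * h * K3 by ring.
  by rewrite ler_wpM2l// !mulr_ge0// ltW.
apply: le_trans (ler_normB _ _) _; apply: le_trans (lerD b1 (ler_normD _ _)) _.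
apply: le_trans (lerD (lexx _) (lerD (b2 _ _ a1 c1E) (b2 _ _ a2 s1E))) _.
have -> : h * (e / 2) + (2 * n * K3 * h + 2 * n * K3 * h) = (e / 2 + 4 * n * K3) * h by ring.
by rewrite ler_wpM2r ?(ltW h0)// [e in leRHS]splitr lerD2l.
Unshelve. all: by end_near.
Qed.

End WavePaths.

(** * Duality between the semigroup and the Riccati flow *)

Section Duality.
Variables (R : realType) (d : nat).
Variables (alpha b : 'M[R]_d) (B : 'M[R]_d -> 'M[R]_d) (c : R) (gamma : 'M[R]_d).
Variables (m nu : {measure set (Mx R d) -> \bar R}) (H : 'M[R]_d -> 'M[R]_d).
Variable p : R -> 'M[R]_d -> {measure set (Mx R d) -> \bar R}.
Hypothesis adm : admissible alpha b B c gamma m nu H.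
Hypothesis aff : affine_transition p.
Hypothesis gen : has_generator p alpha b B c gamma m nu H.
Notation M := 'M[R]_d.
Notation S := (@psdset R d).
Notation P := (semigroup p).
Notation bounded := (@bounded_fun R d).

Lemma semigroup_dist (t e : R) (f g : M -> R) x : 0 <= t -> psd x -> bounded f -> bounded g ->
  (forall y, psd y -> `|f y - g y| <= e) -> `|P t f x - P t g x| <= e.
Proof.
move=> t0 px bf bg fg; have b0 := @bounded_cst R d 0.
have bN := bounded_comb (-1) bg b0; have bc := bounded_comb 1 bf bN.
have e1 := semigroup_comb aff 1 t0 px bf bN.
have e2 := semigroup_comb aff (-1) t0 px bg b0.
have -> : P t f x - P t g x = P t (fun y => 1 * f y + (-1 * g y + 0)) x.
  by rewrite e1 e2 semigroup0; ring.
case: bc => mc _; apply: (semigroup_bound aff t0 px mc) => y py.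
by have -> : 1 * f y + (-1 * g y + 0) = f y - g y; [ring|exact: fg].
Qed.

Lemma semigroup_time0 (f : M -> R) x : psd x -> bounded f -> P 0 f x = f x.
Proof.
move=> px [mf _]; have [[_ _ h0 _ _] _] := aff.
have mS := @measurable_psdset R d.
rewrite /semigroup /Rintegral.
rewrite (@eq_measure_integral _ _ _ S (dirac (x : Mx R d))); last first.
  by move=> U mU _; rewrite h0.
rewrite integral_dirac//; last exact/measurable_EFinP.
have -> : \d_(x : Mx R d) S = 1%E :> \bar R by rewrite diracE mem_set.
by rewrite mul1e.
Qed.

Variables (u1 u2 : M) (f1 f2 : R -> R) (A C : R -> M).
Hypothesis init : path_init u1 u2 f1 f2 A C.
Hypothesis sol : forall T, ric_solves alpha b B c gamma m nu H T f1 f2 A C.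
Hypothesis pos : forall t : R, 0 <= t -> 0 <= f1 t /\ pd (A t).

Theorem wave_duality (th T : R) x : 0 <= T -> psd x ->
  P T (wave 0 th u1 u2) x = wave (f1 T) (th + f2 T) (A T) (C T) x.
Proof.
move=> T0 px; have [[f10 f20 A0 C0] [[cf1 cf2 cA cC] sAC]] := init.
have sA s := (sAC s).1.
pose g t := path_wave f1 f2 A C th t.
have bg t : 0 <= t -> bounded (g t).
  by move=> t0; apply: bounded_wave; apply: pd_psd; case: (pos t0).
have cg t : continuous (g t) by exact: cont_wave.
pose K s := P s (g (T - s)) x.
suff : K T = K 0.
  rewrite /K subrr subr0 semigroup_time0//; last exact: bg.
  by rewrite /g /path_wave f10 f20 A0 C0 addr0.
apply: (zero_right_derivative_const T0) => s e s0 sT e0.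
(* Left continuity at [s]: replace [g (T - s + h)] by [g (T - s)], uniformly on the cone, then move
   the time of the semigroup by stochastic continuity. *)
- have Ts : 0 <= T - s by rewrite subr_ge0.
  have e2 : 0 < e / 2 by rewrite divr_gt0.
  have n1 := path_wave_cont cf1 cf2 cA cC sA pos th Ts e2.
  have [dl dl0 hdl] := stochastic_continuity aff px (cg (T - s)) (bg _ Ts) (ltW s0) e2.
  near=> h.
  have h0 : 0 < h by near: h; exact: nbhs_right_gt.
  have hs : h <= s by near: h; exact: nbhs_right_le.
  have hd : h < dl by near: h; exact: nbhs_right_lt.
  have sh : 0 <= s - h by rewrite subr_ge0.
  have E : T - (s - h) = T - s + h by ring.
  have Tsh : 0 <= T - s + h by rewrite addr_ge0// ltW.
  have q1 : `|P (s - h) (g (T - s + h)) x - P (s - h) (g (T - s)) x| <= e / 2.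
    by apply: (semigroup_dist sh px (bg _ Tsh) (bg _ Ts)); near: h.
  have q2 := hdl (s - h) sh (ltac:(by rewrite addrC addKr normrN gtr0_norm)).
  rewrite /K E; have -> : P (s - h) (g (T - s + h)) x - P s (g (T - s)) x
    = (P (s - h) (g (T - s + h)) x - P (s - h) (g (T - s)) x)
      + (P (s - h) (g (T - s)) x - P s (g (T - s)) x) by ring.
  by apply: le_trans (ler_normD _ _) _; rewrite [e]splitr lerD.
- have Ts : 0 < T - s by rewrite subr_gt0.
  set t := T - s in Ts.
  have [pft pA] := pos (ltW Ts).
  have e3 : 0 < e / 3 by rewrite divr_gt0.
  have t1 : 0 < t < t + 1 by apply/andP; split; [exact: Ts|rewrite ltrDl].
  have [d1 d2 dA dC] := sol t1.
  have n1 := path_wave_deriv cA sA pos th Ts e3 d1 d2 dA dC.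
  set D := dwave _ _ _ _ _ _ _ _ in n1.
  have bD : bounded D by exact: bounded_dwave.
  have cD : continuous D by exact: cont_dwave.
  have gD y : psd y -> generator alpha b B c gamma m nu H (g t) y = D y.
    by move=> py; rewrite /g /path_wave (generator_wave adm)//; exact: (sAC t).2.
  have rd := semigroup_right_derivative aff gen s0 px pA (sAC t).2 bD gD.
  have [dl dl0 hdl] := stochastic_continuity aff px cD bD s0 e3.
  have /cvgrPdist_le /(_ _ e3) n2 := rd.
  near=> h.
  have h0 : 0 < h by near: h; exact: nbhs_right_gt.
  have ht : h <= t by near: h; exact: nbhs_right_le.
  have hd : h < dl by near: h; exact: nbhs_right_lt.
  have sh : 0 <= s + h by rewrite addr_ge0// ltW.
  have th0 : 0 <= t - h by rewrite subr_ge0.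
  have bgt := bg _ (ltW Ts).
  have bc := bounded_comb (- h) bD bgt.
  have q1 : `|P (s + h) (g (t - h)) x - P (s + h) (fun y => - h * D y + g t y) x| <= e / 3 * h.
    apply: (semigroup_dist sh px (bg _ th0) bc) => y py.
    have -> : g (t - h) y - (- h * D y + g t y) = g (t - h) y - g t y + h * D y by ring.
    by move: y py; near: h.
  rewrite (semigroup_comb aff _ sh px bD bgt) in q1.
  have q2 := hdl (s + h) sh (ltac:(by rewrite addrC addKr gtr0_norm)).
  have q3 : `|P s D x - (P (s + h) (g t) x - P s (g t) x) / h| <= e / 3 by near: h.
  have E : T - (s + h) = t - h by rewrite /t; ring.
  rewrite /K E -/t.
  (* Three errors of size [e / 3 * h]: the expansion of [g] in time, the continuity in time of the
     semigroup on [D], and the right derivative of the semigroup. The main terms cancel because [D]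
     is both the time derivative of [g] and its generator. *)
  have -> : P (s + h) (g (t - h)) x - P s (g t) x
    = (P (s + h) (g (t - h)) x - (- h * P (s + h) D x + P (s + h) (g t) x))
      - h * (P (s + h) D x - P s D x)
      - h * (P s D x - (P (s + h) (g t) x - P s (g t) x) / h).
    by field; rewrite gt_eqF.
  apply: le_trans (ler_normB _ _) _.
  have -> : e * h = e / 3 * h + h * (e / 3) + h * (e / 3) by field.
  apply: lerD; last by rewrite normrM (gtr0_norm h0) ler_pM2l.
  apply: le_trans (ler_normB _ _) _; apply: lerD => //.
  by rewrite normrM (gtr0_norm h0) ler_pM2l.
Unshelve. all: by end_near.
Qed.

End Duality.

(** * The transform formula *)

Theorem theorem4p1 (R : realType) (d : nat) (hd : (2 <= d)%N)
    (alpha b : 'M[R]_d) (B : 'M[R]_d -> 'M[R]_d) (c : R) (gamma : 'M[R]_d)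
    (m nu : {measure set (Mx R d) -> \bar R}) (H : 'M[R]_d -> 'M[R]_d)
    (p : R -> 'M[R]_d -> {measure set (Mx R d) -> \bar R}) :
  admissible alpha b B c gamma m nu H ->
  (\det alpha != 0 \/ alpha = 0) ->
  affine_transition p ->
  has_generator p alpha b B c gamma m nu H ->
  exists (ph1 ph2 : 'M[R]_d -> 'M[R]_d -> R -> R)
         (ps1 ps2 : 'M[R]_d -> 'M[R]_d -> R -> 'M[R]_d),
    forall u1 u2 : 'M[R]_d, pd u1 -> sym u2 ->
      riccati_solution alpha b B c gamma m nu H u1 u2
        (ph1 u1 u2) (ph2 u1 u2) (ps1 u1 u2) (ps2 u1 u2)
      /\ (forall (q1 q2 : R -> R) (r1 r2 : R -> 'M[R]_d),
            riccati_solution alpha b B c gamma m nu H u1 u2 q1 q2 r1 r2 ->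
            forall t, 0 <= t ->
              [/\ q1 t = ph1 u1 u2 t, q2 t = ph2 u1 u2 t,
                  r1 t = ps1 u1 u2 t & r2 t = ps2 u1 u2 t])
      /\ (forall (t : R) (x : 'M[R]_d), 0 <= t -> psd x ->
            \int[p t x]_(xi in @psdset R d)
               cexp_re (inner u1 xi) (inner u2 xi)
              = cexp_re (ph1 u1 u2 t + inner (ps1 u1 u2 t) x)
                        (ph2 u1 u2 t + inner (ps2 u1 u2 t) x)
            /\ \int[p t x]_(xi in @psdset R d)
               cexp_im (inner u1 xi) (inner u2 xi)
              = cexp_im (ph1 u1 u2 t + inner (ps1 u1 u2 t) x)
                        (ph2 u1 u2 t + inner (ps2 u1 u2 t) x)).
Proof.
move=> adm ha aff gen.
have /boolp.choice[F hF] : forall u : 'M[R]_d * 'M[R]_d,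
    exists s : ((R -> R) * (R -> R)) * ((R -> 'M[R]_d) * (R -> 'M[R]_d)),
    pd u.1 -> sym u.2 ->
    [/\ path_init u.1 u.2 s.1.1 s.1.2 s.2.1 s.2.2,
        forall T : R, ric_solves alpha b B c gamma m nu H T s.1.1 s.1.2 s.2.1 s.2.2
      & forall t : R, 0 <= t -> 0 <= s.1.1 t /\ pd (s.2.1 t)].
  move=> u; have [[p1 s2]|h] := pselect (pd u.1 /\ sym u.2).
    have [f1 [f2 [A [C h]]]] := riccati_global adm ha p1 s2.
    by exists ((f1, f2), (A, C)).
  (* Outside the domain of the equations the value is arbitrary; zero functions make the choice
     total. *)
  by exists ((cst 0, cst 0), (cst 0, cst 0)) => p1 s2; case: h.
exists (fun u1 u2 => (F (u1, u2)).1.1), (fun u1 u2 => (F (u1, u2)).1.2),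
  (fun u1 u2 => (F (u1, u2)).2.1), (fun u1 u2 => (F (u1, u2)).2.2) => u1 u2 p1 s2.
have [init sol pos] := hF (u1, u2) p1 s2.
have rs := riccati_solutionP init sol pos.
split; first exact: rs.
split; first by move=> q1 q2 r1 r2 hq t t0; exact: (riccati_unique adm hq rs t0).
have re0 (y : 'M[R]_d) : cexp_re (inner u1 y) (inner u2 y) = wave 0 0 u1 u2 y.
  by rewrite /wave !add0r.
(* The imaginary part is the wave whose phase is shifted by a quarter period, so the same duality
   statement covers it. *)
have im0 (y : 'M[R]_d) : cexp_im (inner u1 y) (inner u2 y) = wave 0 (0 + pi / 2) u1 u2 y.
  by rewrite wave_shift !add0r.
move=> t x t0 px; split.
- have -> : (fun y => cexp_re (inner u1 y) (inner u2 y)) = wave 0 0 u1 u2.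
    by apply/funext => y; exact: re0.
  by rewrite [LHS](wave_duality adm aff gen init sol pos 0 t0 px) /wave add0r.
- have -> : (fun y => cexp_im (inner u1 y) (inner u2 y)) = wave 0 (0 + pi / 2) u1 u2.
    by apply/funext => y; exact: im0.
  rewrite [LHS](wave_duality adm aff gen init sol pos (0 + pi / 2) t0 px).
  by rewrite addrAC wave_shift add0r.
Qed.
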